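(* Let $k$ be a perfect field with $\mathrm{char}(k)\neq2$, let $n\geq1$ be an integer, and let $D$ be the principal Cartier divisor on $\mathbb G_m=\mathrm{Spec}(k[t^{\pm1}])$ defined by $$g:=(t^{n+1}-1)/(t^{n+1}-t)\in k(t).$$ Denote by $\mathcal O_{\mathbb G_m}\to\mathcal O_{\mathbb G_m}(D)$ and $\mathcal O_{\mathbb G_m}\to\omega_{\mathbb G_m/k}$ the evident trivializations ($1\mapsto g^{-1}$ and $1\mapsto dt$), and let $$\chi:\mathrm H^1_{|D|}(\mathbb G_m,\mathbf K_1^{\mathrm{MW}},\mathcal O_{\mathbb G_m}(D))\to\mathrm H^1_{|D|}(\mathbb G_m,\mathbf K_1^{\mathrm{MW}},\omega_{\mathbb G_m/k})$$ denote the induced isomorphism. For $p:\mathbb G_m\to\mathrm{Spec}(k)$ and the induced push-forward map $$p_*:\mathrm H^1_{|D|}(\mathbb G_m,\mathbf K_1^{\mathrm{MW}},\omega_{\mathbb G_m/k})\to\mathbf K_0^{\mathrm{MW}}(k),$$ we have $p_*\chi(D\cdot1)=\langle-1\rangle$.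
   Context: $\mathbf K^{\mathrm{MW}}_*(F)$ is the Milnor-Witt $K$-theory of a field $F$, $\langle a\rangle:=1+\eta[a]\in\mathbf K_0^{\mathrm{MW}}(F)\cong\mathbf{GW}(F)$; for a one-dimensional $F$-vector space $L$, $\mathbf K^{\mathrm{MW}}_*(F,L)=\mathbf K^{\mathrm{MW}}_*(F)\otimes_{\mathbb Z[F^\times]}\mathbb Z[L^\times]$, with $a\in F^\times$ acting on $\mathbf K^{\mathrm{MW}}_*(F)$ through $\langle a\rangle$. $\mathrm H^i_T(X,\mathbf K^{\mathrm{MW}}_j,\mathcal L)$ is the cohomology with support in $T$ of the Rost-Schmid complex with terms $C_i(X,\mathbf K^{\mathrm{MW}}_j,\mathcal L)=\bigoplus_{x\in X^{(i)}}\mathbf K^{\mathrm{MW}}_{j-i}(k(x),\wedge^i(\mathfrak m_x/\mathfrak m_x^2)^\vee\otimes_{k(x)}\mathcal L_x)$. For a Cartier divisor $D=\{(U_i,f_i)\}$ on a smooth integral scheme $X$, with support $|D|$, $\mathcal O_X(D)$ is the $\mathcal O_X$-submodule of $k(X)$ generated by $f_i^{-1}$ on $U_i$. For $x\in X^{(1)}$, $x\in U_i$, put $\widetilde{\mathrm{ord}}_x(D):=\partial_x([f_i]\otimes f_i^{-1})\in\mathbf K^{\mathrm{MW}}_0(k(x),(\mathfrak m_x/\mathfrak m_x^2)^\vee\otimes\mathcal O_X(D)_x)$, where $\partial_x$ is the (twisted, uniformizer-independent) residue map in Milnor-Witt $K$-theory. $\widetilde{\mathrm{ord}}(D)=\sum_{x\in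 X^{(1)}\cap|D|}\widetilde{\mathrm{ord}}_x(D)$ is a cocycle, and $D\cdot1=\widetilde{\mathrm{div}}(D)$ denotes its class in $\mathrm H^1_{|D|}(X,\mathbf K_1^{\mathrm{MW}},\mathcal O_X(D))$. The push-forward $p_*$ is the sum over closed points $x\in|D|$ of the transfers $\mathbf K_0^{\mathrm{MW}}(k(x),(\mathfrak m_x/\mathfrak m_x^2)^\vee\otimes\omega_{\mathbb G_m/k,x})\cong\mathbf K_0^{\mathrm{MW}}(k(x),\omega_{k(x)/k})\to\mathbf K_0^{\mathrm{MW}}(k)$ (cohomological transfers; since $k$ is perfect, $\mathfrak m_x/\mathfrak m_x^2\cong\omega_{\mathbb G_m/k}\otimes k(x)$ canonically via $f\mapsto df$, and the transfer $\mathbf{GW}(k(x))\to\mathbf{GW}(k)$ is composition of forms with the field trace). *)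

(* Defs.v *)
From HB Require Import structures.
From mathcomp Require Import all_boot all_order all_algebra all_field.
From mathcomp Require Import boolp classical_sets functions cardinality fsbigop.
From mathcomp Require Import freeg.

Set Implicit Arguments.
Unset Strict Implicit.
Unset Printing Implicit Defensive.

Import GRing.Theory.

Local Open Scope ring_scope.
Local Open Scope quotient_scope.
Local Open Scope classical_set_scope.

Section Presentation.
Variables (X : choiceType) (R : {freeg X / int} -> Prop).

Inductive relator_span : {freeg X / int} -> Prop :=
| relator_span0 : relator_span 0
| relator_spanR r : R r -> relator_span r
| relator_spanB r s : relator_span r -> relator_span s -> relator_span (r - s).

Definition relator_spanb : {pred {freeg X / int}} :=
  fun r => `[< relator_span r >].

Lemma relator_spanb_zmod_closed : zmod_closed relator_spanb.
Proof.
split=> [|r s /asboolP rR /asboolP sR]; apply/asboolP; first exact: relator_span0.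
exact: relator_spanB.
Qed.

HB.instance Definition _ := GRing.isZmodClosed.Build _ relator_spanb
  relator_spanb_zmod_closed.

Definition presented := Quotient.quot relator_spanb.

HB.instance Definition _ := GRing.Zmodule.on presented.
HB.instance Definition _ := EqQuotient.on presented.
HB.instance Definition _ := ZmodQuotient.on presented.

Definition pgen (x : X) : presented := \pi_presented << x >>.

(** The homomorphism extending [f]; it does not depend on the representative
    whenever the additive extension of [f] kills the relators. *)
Definition plift (M : zmodType) (f : X -> M) (z : presented) : M :=
  fglift (f : X -> zmodule M) (repr z).

Section Lift.
Variables (M : zmodType) (f : X -> M).
Hypothesis fR : forall r, R r -> fglift (f : X -> zmodule M) r = 0.

Let fg := fglift (f : X -> zmodule M).
Let fgB : {morph fg : r s / r - s}.
Proof. exact: lift_is_additive. Qed.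

Lemma plift_relator r : relator_span r -> fg r = 0.
Proof.
elim=> [|{}r /fR//|{}r s _ r0 _ s0]; last by rewrite fgB r0 s0 subrr.
by rewrite -(subrr 0) fgB subrr.
Qed.

Lemma plift_pi r : plift f (\pi_presented r) = fg r.
Proof.
apply/eqP; rewrite -subr_eq0; apply/eqP; rewrite -fgB; apply: plift_relator.
suff /asboolP : repr (\pi_presented r) - r \in relator_spanb by [].
by rewrite Quotient.idealrBE reprK.
Qed.

Lemma plift_is_zmod_morphism : zmod_morphism (plift f).
Proof.
elim/quotW=> r; elim/quotW=> s.
by rewrite -(raddfB \pi_presented) !plift_pi fgB.
Qed.

Lemma plift_gen x : plift f (pgen x) = f x.
Proof. by rewrite /pgen plift_pi /fg liftU scale1r. Qed.

End Lift.

End Presentation.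

Section MilnorWitt.
Variable F : fieldType.

Inductive mwterm :=
| MWsym of F | MWeta | MWzero | MWone
| MWopp of mwterm | MWadd of mwterm & mwterm | MWmul of mwterm & mwterm.

Local Notation "[ a ]t" := (MWsym a) (at level 0, format "[ a ]t").
Local Notation "s +t u" := (MWadd s u) (at level 50, left associativity).
Local Notation "s *t u" := (MWmul s u) (at level 40, left associativity).
Local Notation eta := MWeta.

(** The smallest ring congruence on terms that contains the Milnor-Witt
    relations. The symbols of the theory are the [a] with [a] in F^*; the
    extra symbol [0] is killed. *)
Inductive mwcong : mwterm -> mwterm -> Prop :=
| mwcong_refl s : mwcong s s
| mwcong_sym s u : mwcong s u -> mwcong u s
| mwcong_trans u s v : mwcong s u -> mwcong u v -> mwcong s v
| mwcong_opp s u : mwcong s u -> mwcong (MWopp s) (MWopp u)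
| mwcong_add s s' u u' :
    mwcong s s' -> mwcong u u' -> mwcong (s +t u) (s' +t u')
| mwcong_mul s s' u u' :
    mwcong s s' -> mwcong u u' -> mwcong (s *t u) (s' *t u')
| mwcong_addA s u v : mwcong (s +t (u +t v)) (s +t u +t v)
| mwcong_addC s u : mwcong (s +t u) (u +t s)
| mwcong_add0 s : mwcong (MWzero +t s) s
| mwcong_addN s : mwcong (MWopp s +t s) MWzero
| mwcong_mulA s u v : mwcong (s *t (u *t v)) (s *t u *t v)
| mwcong_mul1l s : mwcong (MWone *t s) s
| mwcong_mul1r s : mwcong (s *t MWone) s
| mwcong_mulDl s u v : mwcong ((s +t u) *t v) (s *t v +t u *t v)
| mwcong_mulDr s u v : mwcong (s *t (u +t v)) (s *t u +t s *t v)
| mwcong_sym0 : mwcong [0]t MWzero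
| mwcong_steinberg a : a != 0 -> a != 1 -> mwcong ([a]t *t [1 - a]t) MWzero
| mwcong_symM a b : a != 0 -> b != 0 ->
    mwcong [a * b]t ([a]t +t [b]t +t eta *t ([a]t *t [b]t))
| mwcong_eta_sym a : a != 0 -> mwcong ([a]t *t eta) (eta *t [a]t)
| mwcong_eta_h :
    mwcong (eta *t (eta *t [-1]t +t (MWone +t MWone))) MWzero.

HB.instance Definition _ := gen_eqMixin mwterm.
HB.instance Definition _ := gen_choiceMixin mwterm.

Definition mwequiv : rel mwterm := fun s u => `[< mwcong s u >].

Lemma mwequiv_class : equiv_class_of mwequiv.
Proof.
split=> [s|s u|u s v].
- exact/asboolP/mwcong_refl.
- by apply/asboolP/asboolP; exact: mwcong_sym.
- by move=> /asboolP su /asboolP uv; apply/asboolP; exact: mwcong_trans su uv.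
Qed.

Canonical mwequiv_equiv := EquivRelPack mwequiv_class.
Canonical mwequiv_encModRel := defaultEncModRel mwequiv.

Definition KMW := {eq_quot mwequiv}.

HB.instance Definition _ := Choice.on KMW.
HB.instance Definition _ := EqQuotient.on KMW.

Let K0 : KMW := \pi_KMW MWzero.
Let K1 : KMW := \pi_KMW MWone.
Let Kopp (x : KMW) : KMW := \pi_KMW (MWopp (repr x)).
Let Kadd (x y : KMW) : KMW := \pi_KMW (repr x +t repr y).
Let Kmul (x y : KMW) : KMW := \pi_KMW (repr x *t repr y).

Lemma KMWP s u : mwcong s u <-> \pi_KMW s = \pi_KMW u.
Proof.
by split=> [su|/eqmodP/asboolP//]; apply/eqmodP/asboolP.
Qed.

Let reprP s : mwcong (repr (\pi_KMW s)) s.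
Proof. by apply/KMWP; rewrite reprK. Qed.

Let KoppE s : Kopp (\pi_KMW s) = \pi_KMW (MWopp s).
Proof. exact/KMWP/mwcong_opp. Qed.

Let KaddE s u : Kadd (\pi_KMW s) (\pi_KMW u) = \pi_KMW (s +t u).
Proof. exact/KMWP/mwcong_add. Qed.

Let KmulE s u : Kmul (\pi_KMW s) (\pi_KMW u) = \pi_KMW (s *t u).
Proof. exact/KMWP/mwcong_mul. Qed.

Let KaddA : associative Kadd.
Proof.
elim/quotW=> s; elim/quotW=> u; elim/quotW=> v.
by rewrite (KaddE u v) (KaddE s u) !KaddE; apply/KMWP; exact: mwcong_addA.
Qed.
Let KaddC : commutative Kadd.
Proof.
by elim/quotW=> s; elim/quotW=> u; rewrite !KaddE; apply/KMWP; exact: mwcong_addC.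
Qed.
Let Kadd0 : left_id K0 Kadd.
Proof. by elim/quotW=> s; rewrite KaddE; apply/KMWP; exact: mwcong_add0. Qed.
Let KaddN : left_inverse K0 Kopp Kadd.
Proof. by elim/quotW=> s; rewrite KoppE KaddE; apply/KMWP; exact: mwcong_addN. Qed.
Let KmulA : associative Kmul.
Proof.
elim/quotW=> s; elim/quotW=> u; elim/quotW=> v.
by rewrite (KmulE u v) (KmulE s u) !KmulE; apply/KMWP; exact: mwcong_mulA.
Qed.
Let Kmul1l : left_id K1 Kmul.
Proof. by elim/quotW=> s; rewrite KmulE; apply/KMWP; exact: mwcong_mul1l. Qed.
Let Kmul1r : right_id K1 Kmul.
Proof. by elim/quotW=> s; rewrite KmulE; apply/KMWP; exact: mwcong_mul1r. Qed.
Let KmulDl : left_distributive Kmul Kadd.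
Proof.
elim/quotW=> s; elim/quotW=> u; elim/quotW=> v.
rewrite (KaddE s u) (KmulE s v) (KmulE u v) KmulE KaddE.
by apply/KMWP; exact: mwcong_mulDl.
Qed.
Let KmulDr : right_distributive Kmul Kadd.
Proof.
elim/quotW=> s; elim/quotW=> u; elim/quotW=> v.
rewrite (KaddE u v) (KmulE s u) (KmulE s v) KmulE KaddE.
by apply/KMWP; exact: mwcong_mulDr.
Qed.

HB.instance Definition _ := GRing.isZmodule.Build KMW KaddA KaddC Kadd0 KaddN.
HB.instance Definition _ := GRing.Zmodule_isPzRing.Build KMW
  KmulA Kmul1l Kmul1r KmulDl KmulDr.

Definition mwsym (a : F) : KMW := \pi_KMW [a]t.
Definition mweta : KMW := \pi_KMW eta.
Definition mwform (a : F) : KMW := 1 + mweta * mwsym a.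

(** [mwhomog n] is the degree n part: [a] has degree 1 and eta degree -1. *)
Inductive mwhomog : int -> KMW -> Prop :=
| mwhomog0 n : mwhomog n 0
| mwhomog1 : mwhomog 0 1
| mwhomog_sym a : mwhomog 1 (mwsym a)
| mwhomog_eta : mwhomog (-1) mweta
| mwhomogB n x y : mwhomog n x -> mwhomog n y -> mwhomog n (x - y)
| mwhomogM m n x y : mwhomog m x -> mwhomog n y -> mwhomog (m + n) (x * y).

Definition mwdeg (n : int) : {pred KMW} := fun x => `[< mwhomog n x >].

Lemma mwdeg_zmod_closed n : zmod_closed (mwdeg n).
Proof.
split=> [|x y /asboolP xn /asboolP yn]; apply/asboolP; first exact: mwhomog0.
exact: mwhomogB.
Qed.

HB.instance Definition _ n := GRing.isZmodClosed.Build KMW (mwdeg n)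
  (mwdeg_zmod_closed n).

Record KMWdeg (n : int) := MkKMWdeg {
  mwval :> KMW;
  _ : mwdeg n mwval
}.

HB.instance Definition _ n := [isSub for @mwval n].
HB.instance Definition _ n := [Choice of KMWdeg n by <:].
HB.instance Definition _ n := [SubChoice_isSubZmodule of KMWdeg n by <:].

Lemma mwsym_homog a : mwdeg 1 (mwsym a).
Proof. exact/asboolP/mwhomog_sym. Qed.

Lemma mwform_homog a : mwdeg 0 (mwform a).
Proof.
apply: rpredD; apply/asboolP; first exact: mwhomog1.
by rewrite -(addNr 1); apply: mwhomogM; [exact: mwhomog_eta|exact: mwhomog_sym].
Qed.

Lemma mwform_mul_homog n a (x : KMWdeg n) : mwdeg n (mwform a * mwval x).
Proof.
have /asboolP a0 := mwform_homog a; have /asboolP xn := valP x.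
by apply/asboolP; have := mwhomogM a0 xn; rewrite add0r.
Qed.

Definition mwsym1 a : KMWdeg 1 := MkKMWdeg (mwsym_homog a).
Definition mwform0 a : KMWdeg 0 := MkKMWdeg (mwform_homog a).

(** The action of [a] in F^* on the degree [n] part, through <a>. *)
Definition mwact n (a : F) (x : KMWdeg n) : KMWdeg n :=
  MkKMWdeg (mwform_mul_homog a x).

End MilnorWitt.

Arguments mweta {F}.

Section Twisted.
Variables (F : fieldType) (n : int) (L : lmodType F).

(** Relators of K^MW_n(F) (x)_{Z[F^*]} Z[L^*] on the generators (x, l). The
    pairs with l = 0, which are not in L^*, are killed. *)
Inductive twist_relator : {freeg (KMWdeg F n * L) / int} -> Prop :=
| twist_relator0 x : twist_relator << (x, 0) >>
| twist_relatorD x y l :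
    twist_relator (<< (x + y, l) >> - << (x, l) >> - << (y, l) >>)
| twist_relatorZ a x l : a != 0 ->
    twist_relator (<< (mwact a x, l) >> - << (x, a *: l) >>).

Definition KMWtw := presented twist_relator.

HB.instance Definition _ := GRing.Zmodule.on KMWtw.

Definition mwtens (x : KMWdeg F n) (l : L) : KMWtw :=
  pgen twist_relator (x, l).

(** The homomorphism sending x (x) l to [f x l], for l in L^*. *)
Definition twlift (M : zmodType) (f : KMWdeg F n -> L -> M) : KMWtw -> M :=
  plift (fun xl => if xl.2 == 0 then 0 else f xl.1 xl.2).

Section TwistedLift.
Variables (M : zmodType) (f : KMWdeg F n -> L -> M).
Hypotheses (fD : forall x y l, l != 0 -> f (x + y) l = f x l + f y l)
  (fZ : forall a x l, a != 0 -> l != 0 -> f (mwact a x) l = f x (a *: l)).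

Let g := fun xl : KMWdeg F n * L => if xl.2 == 0 then 0 else f xl.1 xl.2.
Let gB : {morph fglift (g : _ -> zmodule M) : r s / r - s}.
Proof. exact: lift_is_additive. Qed.

Lemma twlift_relator r :
  twist_relator r -> fglift (g : _ -> zmodule M) r = 0.
Proof.
case=> [x|x y l|a x l a0]; rewrite ?gB !liftU !scale1r /g /= ?eqxx //.
  by have [_|l0] := eqVneq l 0; rewrite ?subr0 // fD // -addrA -opprD subrr.
rewrite scaler_eq0 (negPf a0) /=.
by have [_|l0] := eqVneq l 0; rewrite ?subr0 // fZ ?subrr.
Qed.

Lemma twlift_is_zmod_morphism : zmod_morphism (twlift f).
Proof. exact: plift_is_zmod_morphism twlift_relator. Qed.

Lemma twlift_tens x l : l != 0 -> twlift f (mwtens x l) = f x l.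
Proof.
move=> /negPf l0; have := plift_gen twlift_relator (x, l).
by rewrite /g /= l0.
Qed.

End TwistedLift.

Lemma mwtens0 x : mwtens x 0 = 0.
Proof.
rewrite /mwtens /pgen -(raddf0 \pi_(presented twist_relator)).
apply/eqP; rewrite -Quotient.idealrBE subr0.
by apply/asboolP/relator_spanR; constructor.
Qed.

Lemma mwtensD x y l : mwtens (x + y) l = mwtens x l + mwtens y l.
Proof.
rewrite /mwtens /pgen -(raddfD \pi_(presented twist_relator)).
apply/eqP; rewrite -Quotient.idealrBE opprD addrA.
by apply/asboolP/relator_spanR; constructor.
Qed.

Lemma mwtensZ a x l : a != 0 -> mwtens (mwact a x) l = mwtens x (a *: l).
Proof.
move=> a0; apply/eqP; rewrite /mwtens /pgen -Quotient.idealrBE.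
by apply/asboolP/relator_spanR; constructor.
Qed.

End Twisted.

Definition twmap (F : fieldType) (n : int) (L L' : lmodType F) (f : L -> L') :
    KMWtw n L -> KMWtw n L' :=
  twlift (fun x l => mwtens x (f l)).

Lemma twmap_is_zmod_morphism (F : fieldType) (n : int) (L L' : lmodType F)
  (f : L -> L') : scalable f -> zmod_morphism (@twmap F n L L' f).
Proof.
move=> fZ; apply: twlift_is_zmod_morphism => [x y l _|a x l a0 _].
  by rewrite mwtensD.
by rewrite mwtensZ // fZ.
Qed.

Section GrothendieckWitt.
Variable F : fieldType.

(** A nondegenerate symmetric bilinear form on F^m, given by its Gram matrix. *)
Record symform := SymForm {
  form_mx :> {m : nat & 'M[F]_m};
  _ : ((tagged form_mx)^T == tagged form_mx) && (tagged form_mx \in unitmx)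
}.

HB.instance Definition _ := [isSub for form_mx].
HB.instance Definition _ := [Choice of symform by <:].

Definition symform_of (m : nat) (A : 'M[F]_m) : option symform :=
  insub (Tagged (fun m => 'M[F]_m) A).

(** The Grothendieck group of isometry classes under orthogonal sum. *)
Inductive gw_relator : {freeg symform / int} -> Prop :=
| gw_relator_isom m (A B P : 'M[F]_m) p q :
    P \in unitmx -> A = P *m B *m P^T ->
    symform_of A = Some p -> symform_of B = Some q ->
    gw_relator (<< p >> - << q >>)
| gw_relator_sum m m' (A : 'M[F]_m) (B : 'M[F]_m') p q r :
    symform_of A = Some p -> symform_of B = Some q ->
    symform_of (block_mx A 0 0 B) = Some r ->
    gw_relator (<< r >> - << p >> - << q >>).

Definition GW := presented gw_relator.

HB.instance Definition _ := GRing.Zmodule.on GW.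

(** The class of a Gram matrix (0 if it is not symmetric invertible). *)
Definition gwclass m (A : 'M[F]_m) : GW :=
  oapp (pgen gw_relator) 0 (symform_of A).

(** For char(F) <> 2 there is exactly one such map, the canonical isomorphism
    K^MW_0(F) = GW(F): the symbols <a> generate K^MW_0(F). *)
Definition is_KMW0_GW (f : KMWdeg F 0 -> GW) : Prop :=
  [/\ {morph f : x y / x + y}, bijective f
    & forall a, a != 0 -> f (mwform0 a) = gwclass (a%:M : 'M_1)].

Definition KMW0_GW : KMWdeg F 0 -> GW := xget (fun=> 0) [set f | is_KMW0_GW f].

End GrothendieckWitt.

Section Transfer.
Variables (k : fieldType) (L : fieldExtType k).

Definition field_trace (a : L) : k :=
  \sum_i coord (vbasis {:L}) i (a * (vbasis {:L})`_i).

(** Gram matrix of Tr_{L/k} o A on L^m = k^(m [L:k]). *)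
Definition trace_mx m (A : 'M[L]_m) : 'M[k]_(\sum_(i < m) \dim {:L}) :=
  \mxblock_(i < m, j < m) \matrix_(a, b)
    field_trace (A i j * (vbasis {:L})`_a * (vbasis {:L})`_b).

(** Composition with the trace, for L/k separable (otherwise the trace form is
    degenerate). *)
Definition gw_transfer : GW L -> GW k :=
  plift (fun p : symform L => gwclass (trace_mx (tagged (val p)))).

(** The transfer K^MW_0(L) -> K^MW_0(k) corresponding to [gw_transfer]. *)
Definition mw_transfer (x : KMWdeg L 0) : KMWdeg k 0 :=
  xget 0 [set y | KMW0_GW y = gw_transfer (KMW0_GW x)].

End Transfer.

Section Points.
Variable k : fieldType.

Local Notation K := {fraction {poly k}}.
Local Notation "p %:F" := (FracField.tofrac p).

(** The closed points of Spec k[t, t^-1]: monic irreducible polynomials other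
    than t. *)
Record Gm_point := GmPoint {
  pt_poly :> {poly k};
  pt_irr : monic_irreducible_poly pt_poly;
  pt_neqX : pt_poly != 'X
}.

HB.instance Definition _ := gen_eqMixin Gm_point.
HB.instance Definition _ := gen_choiceMixin Gm_point.

Lemma Gm_point_inj : injective pt_poly.
Proof.
case=> p p1 p2 [q q1 q2] /= pq; case: q / pq q1 q2 => q1 q2.
by rewrite (Prop_irrelevance p1 q1) (bool_irrelevance p2 q2).
Qed.

Definition resfield (x : Gm_point) : fieldExtType k :=
  {poly %/ x with pt_irr x}.

Section AtPoint.
Variable x : Gm_point.

(** [z = p / q] with [q] nonzero at [x]. *)
Definition local_frac (z : K) (pq : {poly k} * {poly k}) : Prop :=
  ~~ (pt_poly x %| pq.2)%R /\ z = pq.1%:F / pq.2%:F.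

(** The local ring O_x and its maximal ideal. *)
Definition localring : {pred K} := fun z => `[< exists pq, local_frac z pq >].

Definition maxideal : {pred K} :=
  fun z => `[< exists2 pq, local_frac z pq & (pt_poly x %| pq.1)%R >].

Definition local_unit (z : K) : Prop :=
  z \in localring /\ z \notin maxideal.

(** The reduction O_x -> k(x). *)
Definition red (z : K) : resfield x :=
  let pq := xget (0, 1) [set pq | local_frac z pq] in
  in_qpoly x pq.1 / in_qpoly x pq.2.

Lemma in_qpoly_eq0 (p : {poly k}) :
  ((in_qpoly x p : resfield x) == 0) = (pt_poly x %| p).
Proof.
rewrite Pdiv.Idomain.dvdpE /Pdiv.Ring.rdvdp -[in RHS](mk_monicE (pt_irr x)).
by apply/eqP/eqP => [/(congr1 val)|p0]; [|exact: val_inj].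
Qed.

Lemma resfieldK (a : resfield x) : in_qpoly x (a : {poly k}) = a.
Proof.
by apply: val_inj; rewrite /=; apply: in_qpoly_small; exact: size_mk_monic.
Qed.

Lemma local_fracP z p q : local_frac z (p, q) ->
  red z = (in_qpoly x p : resfield x) / in_qpoly x q.
Proof. 
move=> zpq; rewrite /red; set pq := xget _ _.
have [/= xq' e'] : local_frac z pq by apply: (@xgetPex _ (0, 1)); exists (p, q).
case: zpq => /= xq e; rewrite -!in_qpoly_eq0 in xq xq'.
have nz r : (in_qpoly x r : resfield x) != 0 -> r%:F != 0.
  by rewrite tofrac_eq0; apply: contraNneq => ->; rewrite raddf0.
apply/eqP; rewrite eqr_div //; apply/eqP.
have := e; rewrite e' => /eqP; rewrite eqr_div ?nz //.
rewrite -!tofracM tofrac_eq => /eqP pqE.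
by have := congr1 (in_qpoly x) pqE; rewrite !in_qpolyM.
Qed.

Lemma local_frac_exists z : z \in localring -> exists p q, local_frac z (p, q).
Proof. by move=> /asboolP[[p q] zpq]; exists p, q. Qed.

Lemma local_frac_localring z p q : local_frac z (p, q) -> z \in localring.
Proof. by move=> zpq; apply/asboolP; exists (p, q). Qed.

Lemma pt_dvdM p q : (pt_poly x %| p * q) = (pt_poly x %| p) || (pt_poly x %| q).
Proof. by rewrite -!in_qpoly_eq0 in_qpolyM mulf_eq0. Qed.

Lemma pt_ndvd_tofrac p : ~~ (pt_poly x %| p) -> p%:F != 0 :> K.
Proof. by rewrite tofrac_eq0; apply: contraNneq => ->; rewrite dvdp0. Qed.

Lemma local_fracB z w p q r s : local_frac z (p, q) -> local_frac w (r, s) ->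
  local_frac (z - w) (p * s - r * q, q * s).
Proof.
move=> [/= xq ->] [/= xs ->]; split; first by rewrite /= pt_dvdM negb_or xq.
rewrite /= rmorphB !rmorphM /= -[- (r%:F / s%:F)]mulNr.
by rewrite addf_div ?pt_ndvd_tofrac // mulNr.
Qed.

Lemma local_fracM z w p q r s : local_frac z (p, q) -> local_frac w (r, s) ->
  local_frac (z * w) (p * r, q * s).
Proof.
move=> [/= xq ->] [/= xs ->]; split; first by rewrite /= pt_dvdM negb_or xq.
by rewrite /= !rmorphM /= mulf_div.
Qed.

Lemma local_frac_poly p : local_frac p%:F (p, 1).
Proof.
split; last by rewrite /= rmorph1 divr1.
by rewrite /= -in_qpoly_eq0 in_qpoly1 oner_eq0.
Qed.

Lemma localring_poly p : p%:F \in localring.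
Proof. exact: local_frac_localring (local_frac_poly p). Qed.

Lemma localringB z w :
  z \in localring -> w \in localring -> z - w \in localring.
Proof.
move=> /local_frac_exists[p [q zpq]] /local_frac_exists[r [s wrs]].
exact: local_frac_localring (local_fracB zpq wrs).
Qed.

Lemma localringM z w :
  z \in localring -> w \in localring -> z * w \in localring.
Proof.
move=> /local_frac_exists[p [q zpq]] /local_frac_exists[r [s wrs]].
exact: local_frac_localring (local_fracM zpq wrs).
Qed.

Lemma redB z w : z \in localring -> w \in localring ->
  red (z - w) = red z - red w.
Proof.
move=> /local_frac_exists[p [q zpq]] /local_frac_exists[r [s wrs]].
rewrite (local_fracP (local_fracB zpq wrs)) (local_fracP zpq) (local_fracP wrs).
case: zpq wrs => /= xq _ [/= xs _].
rewrite -[- (in_qpoly x r / _)]mulNr addf_div ?in_qpoly_eq0 //.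
by rewrite mulNr raddfB /= !in_qpolyM.
Qed.

Lemma redM z w : z \in localring -> w \in localring ->
  red (z * w) = red z * red w.
Proof.
move=> /local_frac_exists[p [q zpq]] /local_frac_exists[r [s wrs]].
rewrite (local_fracP (local_fracM zpq wrs)) (local_fracP zpq) (local_fracP wrs).
by rewrite /= !in_qpolyM mulf_div.
Qed.

Lemma red_poly p : red p%:F = in_qpoly x p.
Proof. by rewrite (local_fracP (local_frac_poly p)) /= in_qpoly1 divr1. Qed.

Lemma maxidealP z : reflect (z \in localring /\ red z = 0) (z \in maxideal).
Proof.
apply: (iffP (asboolP _)) => [[[p q] zpq /= xp]|[/asboolP[[p q] zpq] rz]].
  split; first exact: local_frac_localring zpq.
  by move: xp; rewrite (local_fracP zpq) -in_qpoly_eq0 => /eqP ->; rewrite mul0r.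
exists (p, q) => //=; rewrite -in_qpoly_eq0.
move: rz; rewrite (local_fracP zpq) => /eqP; rewrite mulf_eq0 invr_eq0.
by case: zpq => /= /negPf; rewrite -in_qpoly_eq0 => -> _; rewrite orbF.
Qed.

Lemma maxideal_localring z : z \in maxideal -> z \in localring.
Proof. by case/maxidealP. Qed.

End AtPoint.

(** A free O-submodule of rank one in k(t), given by a generator. It is used
    both for line bundles on G_m and for the ideals m_x. *)
Record fracideal := FracIdeal {
  fgen : K;
  fgen_neq0 : fgen != 0
}.

(** The fibre L_x / m_x L_x of L = O.c at x, as a line over k(x). *)
Section Fibre.
Variables (x : Gm_point) (L : fracideal).

Local Notation c := (fgen L).

Definition in_stalk : {pred K} := fun z => z / c \in localring x.

Lemma in_stalk_zmod_closed : zmod_closed in_stalk.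
Proof.
split=> [|z w zL wL]; rewrite unfold_in.
  by rewrite mul0r -tofrac0 localring_poly.
by rewrite mulrBl localringB.
Qed.

HB.instance Definition _ := GRing.isZmodClosed.Build K in_stalk
  in_stalk_zmod_closed.

Record stalk := MkStalk {
  stalk_val :> K;
  _ : in_stalk stalk_val
}.

HB.instance Definition _ := [isSub for stalk_val].
HB.instance Definition _ := [Choice of stalk by <:].
HB.instance Definition _ := [SubChoice_isSubZmodule of stalk by <:].

Definition in_mstalk : {pred stalk} := fun z => stalk_val z / c \in maxideal x.

Lemma in_mstalk_zmod_closed : zmod_closed in_mstalk.
Proof.
split=> [|z w /maxidealP[zO rz] /maxidealP[wO rw]]; rewrite unfold_in.
  apply/maxidealP; rewrite mul0r -tofrac0 localring_poly; split=> //.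
  by rewrite red_poly raddf0.
by apply/maxidealP; rewrite mulrBl localringB // redB // rz rw subrr.
Qed.

HB.instance Definition _ := GRing.isZmodClosed.Build stalk in_mstalk
  in_mstalk_zmod_closed.

Definition fibre := Quotient.quot in_mstalk.

HB.instance Definition _ := GRing.Zmodule.on fibre.
HB.instance Definition _ := EqQuotient.on fibre.
HB.instance Definition _ := ZmodQuotient.on fibre.

(** The class in the fibre of a section of [L] near [x] (0 off the stalk). *)
Definition fcls (z : K) : fibre := \pi_fibre (insubd 0 z).

(** A section of [L] near [x] with given value at [x]. *)
Definition frep (v : fibre) : K := stalk_val (repr v).

Definition fscale (a : resfield x) (v : fibre) : fibre :=
  fcls ((a : {poly k})%:F * frep v).

Lemma frep_stalk v : frep v / c \in localring x.
Proof. exact: valP (repr v). Qed.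

(** Coordinate of a vector of the fibre with respect to the class of [c]. *)
Definition fcoord (v : fibre) : resfield x := red x (frep v / c).

Lemma frepK : cancel frep fcls.
Proof.
by move=> v; rewrite /fcls -[RHS]reprK; congr (\pi_fibre _); exact: valKd.
Qed.

Lemma fcls_stalkE z (zL : in_stalk z) : fcls z = \pi_fibre (MkStalk zL).
Proof. by congr (\pi_fibre _); apply/val_inj; rewrite val_insubd zL. Qed.

Lemma fcoord_pi (z : stalk) : fcoord (\pi_fibre z) = red x (stalk_val z / c).
Proof.
have zO : stalk_val z / c \in localring x by exact: (valP z).
have := frep_stalk (\pi_fibre z) => rO.
apply/eqP; rewrite -subr_eq0 -redB // -mulrBl.
have : (repr (\pi_fibre z) - z) \in in_mstalk.
  by rewrite Quotient.idealrBE reprK.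
by rewrite unfold_in => /maxidealP[_ /= ->].
Qed.

Lemma fcoord_cls z : in_stalk z -> fcoord (fcls z) = red x (z / c).
Proof. by move=> zL; rewrite fcls_stalkE fcoord_pi. Qed.

Lemma fcoord_is_zmod_morphism : zmod_morphism fcoord.
Proof.
elim/quotW=> z; elim/quotW=> w; rewrite -raddfB !fcoord_pi /= mulrBl redB //.
  exact: (valP z).
exact: (valP w).
Qed.

HB.instance Definition _ := GRing.isZmodMorphism.Build fibre (resfield x) fcoord
  fcoord_is_zmod_morphism.

Lemma fcoord_inj : injective fcoord.
Proof.
apply: raddf_inj; elim/quotW=> z /=; rewrite fcoord_pi => rz.
apply/eqP; rewrite -(raddf0 \pi_fibre) -Quotient.idealrBE subr0 unfold_in.
by apply/maxidealP; split=> //; exact: (valP z).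
Qed.

Lemma fscale_coord a v : fcoord (fscale a v) = a * fcoord v.
Proof.
rewrite /fscale fcoord_cls; last first.
  by rewrite /in_stalk -mulrA localringM ?localring_poly ?frep_stalk.
rewrite -mulrA redM ?localring_poly ?frep_stalk // red_poly.
by rewrite resfieldK.
Qed.

Let fscaleA a b v : fscale a (fscale b v) = fscale (a * b) v.
Proof. by apply: fcoord_inj; rewrite !fscale_coord mulrA. Qed.

Let fscale1 : left_id 1 fscale.
Proof. by move=> v; apply: fcoord_inj; rewrite fscale_coord mul1r. Qed.

Let fscaleDr a (u v : fibre) : fscale a (u + v) = fscale a u + fscale a v.
Proof.
by apply: fcoord_inj; rewrite fscale_coord !raddfD /= !fscale_coord mulrDr.
Qed.

Let fscaleDl (v : fibre) a b : fscale (a + b) v = fscale a v + fscale b v.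
Proof.
by apply: fcoord_inj; rewrite fscale_coord raddfD /= !fscale_coord mulrDl.
Qed.

HB.instance Definition _ := GRing.Zmodule_isLmodule.Build (resfield x) fibre
  fscaleA fscale1 fscaleDr fscaleDl.

Lemma fibre_vect_axiom : Vector.axiom 1 fibre.
Proof.
exists (fun v => const_mx (fcoord v)).
  by move=> a u v; apply/matrixP=> i j; rewrite !mxE raddfD /= fscale_coord.
have cE (a : resfield x) : (a : {poly k})%:F * c / c = (a : {poly k})%:F.
  by rewrite mulfK ?fgen_neq0.
have coordE (a : resfield x) : fcoord (fcls ((a : {poly k})%:F * c)) = a.
  by rewrite fcoord_cls ?cE ?red_poly ?resfieldK // /in_stalk cE localring_poly.
exists (fun r : 'rV[resfield x]_1 => fcls ((r 0 0 : {poly k})%:F * c)) => [v|r].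
  by apply: fcoord_inj; rewrite coordE mxE.
by apply/matrixP=> i j; rewrite !ord1 !mxE coordE.
Qed.

HB.instance Definition _ := Lmodule_hasFinDim.Build (resfield x) fibre
  fibre_vect_axiom.

End Fibre.

Lemma pt_ideal_subproof (x : Gm_point) : (pt_poly x)%:F != 0 :> K.
Proof. by rewrite tofrac_eq0 monic_neq0 //; case: (pt_irr x). Qed.

(** m_x, generated by the uniformizer [pt_poly x]; its fibre is m_x/m_x^2. *)
Definition pt_ideal x := FracIdeal (pt_ideal_subproof x).

Definition OX : fracideal := FracIdeal (oner_neq0 K).

(** omega_{G_m/k} = O dt, inside the differentials k(t) dt of k(t): the
    element [f] of k(t) stands for f dt. *)
Definition omegaX : fracideal := FracIdeal (oner_neq0 K).

(** The derivation d/dt of k(t). *)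
Definition fracderiv (z : K) : K :=
  let r := repr z in
  ((\n_r)^`() * \d_r - \n_r * (\d_r)^`())%:F / (\d_r ^+ 2)%:F.

Section Coefficients.
Variable x : Gm_point.

(** (m_x/m_x^2)^v (x) L_x, as Hom_{k(x)}(m_x/m_x^2, L_x/m_x L_x). *)
Definition normal_twist (L : fracideal) : vectType (resfield x) :=
  'Hom(fibre x (pt_ideal x), fibre x L).

(** Multiplication by [s], from the fibre of [L] to that of [L']. *)
Definition fibre_mul (L L' : fracideal) (s : K) :
    'Hom(fibre x L, fibre x L') :=
  linfun (fun v => fcls x L' (s * frep v)).

(** The canonical map m_x/m_x^2 -> omega_x, [f] |-> df. *)
Definition fibre_d : normal_twist omegaX :=
  linfun (fun v => fcls x omegaX (fracderiv (frep v))).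

(** Morel's characterization of the residue d_x^pi : K^MW_n(k(t)) ->
    K^MW_{n-1}(k(x)) for a uniformizer [pi] at x: there is exactly one such map
    on the direct sum over n. *)
Definition is_mwresidue (pi : K) (d : KMW K -> KMW (resfield x)) : Prop :=
  [/\ {morph d : z w / z + w},
      forall n z, mwhomog n z -> mwhomog (n - 1) (d z),
      forall z, d (mweta * z) = mweta * d z,
      forall us : seq K, {in us, forall u, local_unit x u} ->
        d (mwsym pi * \prod_(u <- us) mwsym u) = \prod_(u <- us) mwsym (red x u)
    & forall us : seq K, {in us, forall u, local_unit x u} ->
        d (\prod_(u <- us) mwsym u) = 0].

Definition mwresidue (pi : K) : KMW K -> KMW (resfield x) :=
  xget (fun=> 0) [set d | is_mwresidue pi d].

(** K^MW_1(k(t)) -> K^MW_0(k(x)); the value of [mwresidue] on a symbol of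
    degree 1 has degree 0. *)
Definition mwresidue1 (pi : K) (z : KMWdeg K 1) : KMWdeg (resfield x) 0 :=
  insubd 0 (mwresidue pi (mwval z)).

(** The twisted residue at x, with values in
    K^MW_0(k(x), (m_x/m_x^2)^v (x) L_x): if c generates L_x, then
    z (x) l = <l/c>z (x) c is sent to d_x^pi(<l/c>z) (x) pi^v (x) c. The result
    does not depend on the choices of c and of the uniformizer pi, for which
    [fgen L] and [pt_poly x] are taken; pi^v (x) c is the map pi |-> c. *)
Definition twresidue (L : fracideal) :
    KMWtw 1 K^o -> KMWtw 0 (normal_twist L) :=
  twlift (fun (z : KMWdeg K 1) (l : K^o) =>
    mwtens (mwresidue1 (pt_poly x)%:F (mwact ((l : K) / fgen L) z))
      (fibre_mul (pt_ideal x) L (fgen L / (pt_poly x)%:F) : normal_twist L)).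

(** K^MW_0(k(x), (m_x/m_x^2)^v (x) omega_x) = K^MW_0(k(x)), through the
    isomorphism m_x/m_x^2 = omega_x given by [fibre_d]. *)
Definition untwist : KMWtw 0 (normal_twist omegaX) -> KMWdeg (resfield x) 0 :=
  twlift (fun z (l : normal_twist omegaX) =>
    mwact (xget 0 [set c | l = c *: fibre_d]) z).

End Coefficients.

Section Cohomology.
Variables (T : set Gm_point) (L : fracideal).

Definition RS1 := forall x : Gm_point, KMWtw 0 (normal_twist x L).

HB.instance Definition _ := gen_eqMixin RS1.
HB.instance Definition _ := gen_choiceMixin RS1.

Let RS1_0 : RS1 := fun=> 0.
Let RS1_opp (f : RS1) : RS1 := fun x => - f x.
Let RS1_add (f g : RS1) : RS1 := fun x => f x + g x.

Let RS1_addA : associative RS1_add.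
Proof. by move=> f g h; apply: functional_extensionality_dep => x; exact: addrA. Qed.
Let RS1_addC : commutative RS1_add.
Proof. by move=> f g; apply: functional_extensionality_dep => x; exact: addrC. Qed.
Let RS1_add0 : left_id RS1_0 RS1_add.
Proof. by move=> f; apply: functional_extensionality_dep => x; exact: add0r. Qed.
Let RS1_addN : left_inverse RS1_0 RS1_opp RS1_add.
Proof. by move=> f; apply: functional_extensionality_dep => x; exact: addNr. Qed.

HB.instance Definition _ :=
  GRing.isZmodule.Build RS1 RS1_addA RS1_addC RS1_add0 RS1_addN.

Definition RS1_supported : {pred RS1} := fun f =>
  `[< (forall x, ~ T x -> f x = 0) /\ finite_set [set x | f x <> 0] >].

Lemma RS1_supported_zmod_closed : zmod_closed RS1_supported.
Proof.
split=> [|f g /asboolP[fT fin_f] /asboolP[gT fin_g]]; apply/asboolP.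
  split=> [//|]; rewrite (_ : [set x | _] = set0) //.
  by rewrite -subset0 => x /=.
split=> [x xT|].
  by rewrite -[LHS]/(f x - g x) fT // gT // subrr.
apply: (@sub_finite_set _ _ ([set x | f x <> 0] `|` [set x | g x <> 0])).
  move=> x /= fg; have [fx|] := pselect (f x = 0); last by left.
  by right=> gx; apply: fg; rewrite -[LHS]/(f x - g x) fx gx subrr.
by rewrite finite_setU.
Qed.

HB.instance Definition _ := GRing.isZmodClosed.Build RS1 RS1_supported
  RS1_supported_zmod_closed.

(** H^1_T(G_m, K^MW_1, L), for a set [T] of closed points. The Rost-Schmid
    complex with supports in [T] is concentrated in degree 1, where it is the
    direct sum of the K^MW_0(k(x), (m_x/m_x^2)^v (x) L_x) for x in T: the
    generic point is not in T, and there are no points of codimension 2. *)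
Record H1supp := MkH1supp {
  h1val :> RS1;
  _ : RS1_supported h1val
}.

HB.instance Definition _ := [isSub for h1val].
HB.instance Definition _ := [Choice of H1supp by <:].
HB.instance Definition _ := [SubChoice_isSubZmodule of H1supp by <:].

End Cohomology.

(** The principal Cartier divisor on G_m with equation [div_eqn]. *)
Record prdivisor := PrDivisor {
  div_eqn : K;
  div_eqn_neq0 : div_eqn != 0
}.

Lemma OXdiv_subproof (D : prdivisor) : (div_eqn D)^-1 != 0.
Proof. by rewrite invr_eq0 div_eqn_neq0. Qed.

(** O_X(D), the submodule of k(t) generated by the inverse of the equation. *)
Definition OXdiv (D : prdivisor) : fracideal := FracIdeal (OXdiv_subproof D).

Definition div_support (D : prdivisor) : set Gm_point :=
  [set x | ~ local_unit x (div_eqn D)].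

Lemma finite_pt_dvd (p : {poly k}) :
  p != 0 -> finite_set [set x : Gm_point | pt_poly x %| p].
Proof.
have [n] := ubnP (size p); elim: n p => // n IHn p pn p0.
have [[x0 x0p]|nox] := pselect (exists x : Gm_point, pt_poly x %| p); last first.
  rewrite (_ : [set x | _] = set0) // -subset0 => x /= xp.
  by apply: nox; exists x.
have /dvdpP[q pE] := x0p; have x0_neq0 : pt_poly x0 != 0.
  by rewrite -tofrac_eq0 pt_ideal_subproof.
have q0 : q != 0 by apply: contraNneq p0 => q0; rewrite pE q0 mul0r.
have qn : (size q < n)%N.
  rewrite -ltnS (leq_trans _ pn) // ltnS pE size_mul // -ltnS prednK; last first.
    by rewrite addn_gt0 size_poly_gt0 q0.
  rewrite -addn2 leq_add2l.
  by have [[]] := pt_irr x0.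
apply: (@sub_finite_set _ _ ([set x0] `|` [set x : Gm_point | pt_poly x %| q])).
  move=> x /=; rewrite pE pt_dvdM => /orP[xq|xx0]; [by right|left].
  apply: Gm_point_inj; apply/eqP; rewrite -eqp_monic.
  - have [[_ x0irr] _] := pt_irr x0; apply: x0irr => //.
    by have [[]] := pt_irr x; case: (size _) => [|[]].
  - by case: (pt_irr x).
  - by case: (pt_irr x0).
by rewrite finite_setU; split=> //; exact: IHn.
Qed.

Lemma frac_numden (z : K) : z = (\n_(repr z))%:F / (\d_(repr z))%:F.
Proof.
have d0 : \d_(repr z) != 0 by exact: denom_ratioP.
apply: (mulIf (x := (\d_(repr z))%:F)); first by rewrite tofrac_eq0.
rewrite divfK ?tofrac_eq0 // -[in LHS](reprK z); unlock FracField.tofrac.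
rewrite -[LHS]FracField.pi_mul; apply/eqP; rewrite FracField.equivf_def.
by rewrite /FracField.mulf /= !numden_Ratio ?mulr1 ?oner_neq0 // reprK mulrC.
Qed.

Lemma finite_div_support (D : prdivisor) : finite_set (div_support D).
Proof.
set g := div_eqn D; pose n := \n_(repr g); pose d := \d_(repr g).
have gE : g = n%:F / d%:F by exact: frac_numden.
have d0 : d != 0 by exact: denom_ratioP.
have n0 : n != 0.
  by apply: contraNneq (div_eqn_neq0 D) => n0; rewrite -/g gE n0 tofrac0 mul0r.
have nd0 : n * d != 0 by rewrite mulf_neq0.
apply: sub_finite_set (finite_pt_dvd nd0) => x /=; apply: contra_notT.
rewrite pt_dvdM negb_or => /andP[xn xd].
have gx : local_frac x g (n, d) by split.
split; first exact: local_frac_localring gx.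
apply/negP => /maxidealP[_ /eqP]; rewrite (local_fracP gx).
by rewrite mulf_eq0 invr_eq0 !in_qpoly_eq0 (negPf xn) (negPf xd).
Qed.

(** The section x |-> ord_x(D) = d_x([g] (x) g^-1) of the Rost-Schmid complex,
    supported in |D|. *)
Definition div_section (D : prdivisor) : RS1 (OXdiv D) := fun x =>
  if `[< div_support D x >] then
    twresidue x (OXdiv D) (mwtens (mwsym1 (div_eqn D)) ((div_eqn D)^-1 : K^o))
  else 0.

Lemma div_section_supported (D : prdivisor) :
  RS1_supported (div_support D) (div_section D).
Proof.
apply/asboolP; split=> [x /asboolPn/negPf xD|]; first by rewrite /div_section xD.
apply: sub_finite_set (finite_div_support D) => x /=; apply: contra_notP.
by move=> /asboolPn/negPf xD; rewrite /div_section xD.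
Qed.

(** The class D.1 in H^1_|D|(G_m, K^MW_1, O(D)). *)
Definition div_class (D : prdivisor) : H1supp (div_support D) (OXdiv D) :=
  MkH1supp (div_section_supported D).

(** The trivialization O -> L, 1 |-> generator of L, on the fibre at x. *)
Definition fibre_triv (L : fracideal) (x : Gm_point) :
    'Hom(fibre x OX, fibre x L) :=
  fibre_mul x OX L (fgen L).

(** The isomorphism O(D) -> O -> omega on the fibre at x. *)
Definition fibre_chi (D : prdivisor) (x : Gm_point) :
    'Hom(fibre x (OXdiv D), fibre x omegaX) :=
  (fibre_triv omegaX x \o (fibre_triv (OXdiv D) x)^-1)%VF.

Definition chi_section (D : prdivisor) (z : RS1 (OXdiv D)) : RS1 omegaX :=
  fun x => twmap (fun l : normal_twist x (OXdiv D) =>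
    ((fibre_chi D x \o l)%VF : normal_twist x omegaX)) (z x).

Lemma chi_section0 (D : prdivisor) (z : RS1 (OXdiv D)) x :
  z x = 0 -> chi_section z x = 0.
Proof.
set f := fun l : normal_twist x (OXdiv D) =>
  ((fibre_chi D x \o l)%VF : normal_twist x omegaX).
have fB : zmod_morphism (@twmap _ 0 _ _ f).
  by apply: twmap_is_zmod_morphism => a l; rewrite /f comp_lfunZr.
by move=> z0; have := fB 0 0; rewrite /chi_section -/f z0 !subrr.
Qed.

Lemma chi_supported (D : prdivisor) (T : set Gm_point)
  (z : H1supp T (OXdiv D)) : RS1_supported T (chi_section (h1val z)).
Proof.
have /asboolP[zT fin_z] := valP z.
apply/asboolP; split=> [x /zT/chi_section0 //|].
apply: sub_finite_set fin_z => x /=; apply: contra_not; exact: chi_section0.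
Qed.

Definition chi (D : prdivisor) (T : set Gm_point) (z : H1supp T (OXdiv D)) :
    H1supp T omegaX :=
  MkH1supp (chi_supported z).

(** p_* for p : G_m -> Spec k. *)
Definition pushforward (T : set Gm_point) (z : H1supp T omegaX) : KMWdeg k 0 :=
  \sum_(x \in T) mw_transfer (untwist (h1val z x)).

Definition gfrac (n : nat) : K := ('X^(n.+1) - 1)%:F / ('X^(n.+1) - 'X)%:F.

Lemma gfrac_neq0 (n : nat) : (0 < n)%N -> gfrac n != 0.
Proof.
move=> n0; rewrite mulf_neq0 ?invr_eq0 ?tofrac_eq0 // subr_eq0.
  apply/eqP => /(congr1 (fun p : {poly k} => size p)).
  by rewrite size_polyXn size_poly1.
apply/eqP => /(congr1 (fun p : {poly k} => size p)).
by rewrite size_polyXn size_polyX => -[n1]; rewrite n1 in n0.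
Qed.

Definition gdiv (n : nat) (n_gt0 : (0 < n)%N) : prdivisor :=
  PrDivisor (gfrac_neq0 n_gt0).

End Points.

(** The usual definition: irreducible polynomials have no multiple roots. *)
Definition perfect_field (k : fieldType) : Prop :=
  forall p : {poly k}, irreducible_poly p -> separable_poly p.

(* Main.v *)
(** Let x be a closed point of G_m with monic generator pi, let m be the order of
    g at x, and write g / pi^m = w v^2 with w a polynomial and v a unit at x. The
    residue at x of [g] is m_eps <w(x)>, that is (m/2) h for m even and
    ((m-1)/2) h + <w(x)> for m odd. The passage from O(D) to omega twists it by
    1 / pi'(x), and by Euler's formula the trace form of <w(x) / pi'(x)> is the
    form (p, q) |-> res(w p q dX / pi) on k[X] / pi. Since X g is a square times
    the product F of the pi of odd multiplicity, w can be taken to be X F / pi;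
    by the Chinese remainder theorem these forms, together with the one at the
    point X, sum up to the form (p, q) |-> res(p q dX / (X F)) on k[X] / (X F).
    As X g has degree 1, X F has even degree 2M, and the polynomials of degree less
    than M form a Lagrangian: the total is M h. The contribution of the point X is
    <F(0)> = <1>, because X g has value 1 at 0, and counting degrees leaves
    (1 - M) h + M h - <1> = <-1>. *)

Require Import Defs.
From HB Require Import structures.
From mathcomp Require Import all_boot all_order all_algebra all_field.
From mathcomp Require Import boolp classical_sets cardinality fsbigop.
From mathcomp Require Import freeg finmap zify ring.

Set Implicit Arguments.
Unset Strict Implicit.
Unset Printing Implicit Defensive.

Import GRing.Theory Num.Theory.
Local Open Scope ring_scope.

(** * Milnor-Witt K-theory *)

(** The residue, the isomorphism K^MW_0 = GW and the transfer are each selected by [xget] from a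
    characterization, so nothing can be computed before existence is known, and for the residue
    uniqueness too. The obstacle is that [KMW] is a quotient of ring terms: a map out of it is
    obtained by letting terms act on an abelian group modulo a subgroup and checking the relations
    there. Residues come from an action on two copies of K^MW(k(x)), the second one carrying a
    formal symbol xi of the uniformizer. The map to GW comes from an action on GW x Z modulo (h, 0),
    where the rank restores the multiple of h that the Witt group forgets; its inverse diagonalizes
    a form, and independence of the diagonalization rests on Witt cancellation. Characteristic
    different from 2 serves to diagonalize, to reflect and to split metabolic forms. Perfectness
    gives pi'(x) <> 0, which makes m_x/m_x^2 -> omega_x an isomorphism and the trace nonzero.
    Factors of t^n - 1 may be repeated and may cancel against those of t^(n+1) - 1, hence the
    bookkeeping by parity of multiplicities instead of by simple zeros and poles. *)

Section MilnorWittRing.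
Variable F : fieldType.
Implicit Types a b : F.

Local Notation "[ a ]" := (mwsym a) (at level 0, format "[ a ]").
Local Notation "<[ a ]>" := (mwform a) (at level 0, format "<[ a ]>").
Local Notation eta := (@mweta F).

Lemma pi_mwadd (s u : mwterm F) :
  \pi_(KMW F)%qT (MWadd s u) = \pi_(KMW F)%qT s + \pi_(KMW F)%qT u.
Proof.
by apply/KMWP/mwcong_add; apply/KMWP; rewrite reprK.
Qed.

Lemma pi_mwmul (s u : mwterm F) :
  \pi_(KMW F)%qT (MWmul s u) = \pi_(KMW F)%qT s * \pi_(KMW F)%qT u.
Proof.
by apply/KMWP/mwcong_mul; apply/KMWP; rewrite reprK.
Qed.

Lemma pi_mwopp (s : mwterm F) :
  \pi_(KMW F)%qT (MWopp s) = - \pi_(KMW F)%qT s.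
Proof. by apply/KMWP/mwcong_opp; apply/KMWP; rewrite reprK. Qed.

Lemma pi_mw1 : \pi_(KMW F)%qT (MWone F) = 1.
Proof. by []. Qed.

Lemma pi_mw0 : \pi_(KMW F)%qT (MWzero F) = 0.
Proof. by []. Qed.

(** Every class has a representing term, on which one can induct. Closure under differences
    suffices: it yields 0 from 1, then opposites, then sums. *)
Lemma KMW_ind (P : KMW F -> Prop) :
  (forall a, P [a]) -> P eta -> P 1 -> (forall z w, P z -> P w -> P (z - w)) ->
  (forall z w, P z -> P w -> P (z * w)) -> forall z, P z.
Proof.
move=> Ps Pe P1 PB PM; have P0 : P 0 by rewrite -(subrr 1); exact: PB.
have PN z : P z -> P (- z) by move=> Pz; rewrite -sub0r; exact: PB.
have Pt (s : mwterm F) : P (\pi_(KMW F)%qT s).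
  elim: s => [a|||| s IH | s IHs u IHu | s IHs u IHu].
  - exact: Ps.
  - exact: Pe.
  - exact: P0.
  - exact: P1.
  - by rewrite pi_mwopp; exact: PN.
  - by rewrite pi_mwadd -[X in _ + X]opprK; apply: PB => //; exact: PN.
  - by rewrite pi_mwmul; exact: PM.
by move=> z; rewrite -(reprK z).
Qed.

Lemma mwsym0 : [0] = 0 :> KMW F.
Proof. exact/KMWP/mwcong_sym0. Qed.

Lemma mwsymM a b : a != 0 -> b != 0 -> [a * b] = [a] + [b] + eta * ([a] * [b]).
Proof.
move=> a0 b0; rewrite /mwsym /mweta -!pi_mwmul -!pi_mwadd.
exact/KMWP/mwcong_symM.
Qed.

Lemma mw_steinberg a : a != 0 -> a != 1 -> [a] * [1 - a] = 0.
Proof. by move=> a0 a1; rewrite /mwsym -pi_mwmul; apply/KMWP/mwcong_steinberg. Qed.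

Lemma mweta_sym a : [a] * eta = eta * [a].
Proof.
have [->|a0] := eqVneq a 0; first by rewrite mwsym0 mul0r mulr0.
by rewrite /mwsym /mweta -!pi_mwmul; apply/KMWP/mwcong_eta_sym.
Qed.

Definition mwhyp : KMW F := 1 + <[-1]>.
Definition mweps : KMW F := - <[-1]>.

Lemma mweta_hyp : eta * mwhyp = 0.
Proof.
have /KMWP := mwcong_eta_h F; rewrite pi_mwmul !pi_mwadd pi_mwmul pi_mw1 pi_mw0.
by move=> e; rewrite -[RHS]e /mwhyp /mwform [in LHS]addrA [in LHS]addrC.
Qed.

(** Expanding both sides of [ab] = [ba] and cancelling [a] + [b] leaves the two eta terms. *)
Lemma mwetaCs a b : a != 0 -> b != 0 -> eta * [a] * [b] = eta * [b] * [a].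
Proof.
move=> a0 b0; have := mwsymM a0 b0; rewrite mulrC mwsymM // [in LHS]addrC.
by rewrite [in RHS]addrC [[a] + _]addrC => /addIr; rewrite !mulrA.
Qed.

Lemma mwsym_one_hyp : [1] = mwhyp * [-1] :> KMW F.
Proof.
have N1 : -1 != 0 :> F by rewrite oppr_eq0 oner_eq0.
rewrite -[1 in LHS]mulr1 -mulrNN mwsymM // mulrA /mwhyp /mwform.
by rewrite !mulrDl !mul1r addrA.
Qed.

Lemma mwsym_one : [1] = 0 :> KMW F.
Proof.
(* With eta [1] = 0 the expansion of [1 * 1] reads [1] = [1] + [1]. *)
have e0 : eta * [1] = 0 by rewrite mwsym_one_hyp mulrA mweta_hyp mul0r.
have := mwsymM (oner_neq0 F) (oner_neq0 F).
by rewrite mulr1 mulrA e0 mul0r addr0 => /eqP; rewrite -subr_eq subrr => /eqP.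
Qed.

Lemma mwform1 : <[1]> = 1 :> KMW F.
Proof. by rewrite /mwform mwsym_one mulr0 addr0. Qed.

Lemma mwhyp_symN1 : mwhyp * [-1] = 0.
Proof. by rewrite -mwsym_one_hyp mwsym_one. Qed.

Lemma mwformM a b : a != 0 -> b != 0 -> <[a * b]> = <[a]> * <[b]>.
Proof.
move=> a0 b0; rewrite /mwform mwsymM // mulrDl mul1r !mulrDr mulr1.
rewrite !addrA -(addrA 1) [eta * [a] + _]addrC !addrA; congr (_ + _).
by rewrite -[eta * [a] * _]mulrA [[a] * (_ * _)]mulrA mweta_sym !mulrA.
Qed.

Lemma mwsymMl a b : a != 0 -> b != 0 -> [a * b] = [a] + <[a]> * [b].
Proof. by move=> a0 b0; rewrite mwsymM // /mwform mulrDl mul1r mulrA addrA. Qed.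

Lemma mwformC a b : <[a]> * [b] = [b] * <[a]>.
Proof.
have [->|a0] := eqVneq a 0.
  by rewrite /mwform mwsym0 mulr0 addr0 mul1r mulr1.
have [->|b0] := eqVneq b 0; first by rewrite mwsym0 mulr0 mul0r.
rewrite /mwform mulrDl mulrDr mul1r mulr1; congr (_ + _).
by rewrite mwetaCs // -mweta_sym mulrA.
Qed.

Lemma mwform_eta a : <[a]> * eta = eta * <[a]>.
Proof. by rewrite /mwform mulrDl mulrDr mul1r mulr1 -mulrA mweta_sym. Qed.

Lemma mwform_central a (z : KMW F) : <[a]> * z = z * <[a]>.
Proof.
elim/KMW_ind: z => [b|||z w IHz IHw|z w IHz IHw].
- exact: mwformC.
- exact: mwform_eta.
- by rewrite mulr1 mul1r.
- by rewrite mulrBr mulrBl IHz IHw.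
- by rewrite mulrA IHz -!mulrA IHw.
Qed.

Lemma mwhyp_central (z : KMW F) : mwhyp * z = z * mwhyp.
Proof. by rewrite /mwhyp mulrDl mulrDr mul1r mulr1 mwform_central. Qed.

Lemma mweps_central (z : KMW F) : mweps * z = z * mweps.
Proof. by rewrite /mweps mulrN mulNr mwform_central. Qed.

Lemma mwformV a : a != 0 -> <[a]> * <[a^-1]> = 1.
Proof. by move=> a0; rewrite -mwformM ?invr_eq0 // divff // mwform1. Qed.

Lemma mwsymV a : a != 0 -> [a] = - (<[a]> * [a^-1]).
Proof.
move=> a0; apply/eqP; rewrite -addr_eq0 -mwsymMl ?invr_eq0 // divff //.
by rewrite mwsym_one.
Qed.

Lemma mwsymN a : [a] * [- a] = 0.
Proof.
have [->|a0] := eqVneq a 0; first by rewrite mwsym0 mul0r.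
have [->|a1] := eqVneq a 1; first by rewrite mwsym_one mul0r.
(* The classical identity -a = (1 - a) / (1 - a^-1): the Steinberg relation for a^-1 gives [a][c] =
   0, and the one for a then leaves <c>[a][-a] = 0 with <c> invertible. *)
pose c := 1 - a^-1.
have c0 : c != 0 by rewrite subr_eq0 eq_sym invr_eq1.
have ac : 1 - a = - a * c.
  by rewrite /c mulrBr mulr1 mulNr divff // opprK addrC.
have e1 : [a] * [c] = 0.
  by rewrite (mwsymV a0) mulNr -mulrA mw_steinberg ?invr_eq0 ?invr_eq1 ?mulr0 ?oppr0.
have := mw_steinberg a0 a1.
rewrite ac mulrC mwsymMl ?oppr_eq0 ?oner_eq0 // mulrDr e1 add0r mwform_central mulrA => e2.
by rewrite -[LHS]mulr1 -(mwformV c0) mulrA e2 mul0r.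
Qed.

Lemma mwsymNl a : [- a] * [a] = 0.
Proof. by rewrite -[X in _ * [X]]opprK mwsymN. Qed.

Lemma mwsym_sqrr a : [a] * [a] = [a] * [-1].
Proof.
have [->|a0] := eqVneq a 0; first by rewrite mwsym0 !mul0r.
have N1 : -1 != 0 :> F by rewrite oppr_eq0 oner_eq0.
have -> : [a] * [a] = [a] * [- a * -1] by rewrite mulrNN mulr1.
rewrite mwsymM ?oppr_eq0 ?oner_eq0 // !mulrDr mwsymN add0r mulrA mweta_sym -mulrA.
by rewrite [[a] * (_ * _)]mulrA mwsymN mul0r mulr0 addr0.
Qed.

Lemma mwsym_sqrl a : [a] * [a] = [-1] * [a].
Proof.
have [->|a0] := eqVneq a 0; first by rewrite mwsym0 !mulr0.
have N1 : -1 != 0 :> F by rewrite oppr_eq0 oner_eq0.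
have {1}-> : [a] = [-1 * - a] by rewrite mulrNN mul1r.
by rewrite mwsymM ?oppr_eq0 ?oner_eq0 // !mulrDl -!mulrA !mwsymNl !mulr0 !addr0.
Qed.

Lemma mwform_sqr a : a != 0 -> <[a * a]> = 1.
Proof.
move=> a0; rewrite /mwform mwsymM // mwsym_sqrl mulrA.
have -> : [a] + [a] + eta * [-1] * [a] = mwhyp * [a].
  by rewrite /mwhyp /mwform !mulrDl !mul1r addrA.
by rewrite mulrA mweta_hyp mul0r addr0.
Qed.

Lemma mwformMsqr a b : a != 0 -> b != 0 -> <[a * (b * b)]> = <[a]>.
Proof. by move=> a0 b0; rewrite mwformM ?mulf_neq0 // mwform_sqr // mulr1. Qed.

Lemma mwform_inv a : a != 0 -> <[a^-1]> = <[a]>.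
Proof.
by move=> a0; rewrite -(mwformMsqr (b := a)) ?invr_eq0 // mulrA mulVf // mul1r.
Qed.

Lemma mwformN a : a != 0 -> <[- a]> = <[-1]> * <[a]>.
Proof.
by move=> a0; rewrite -mwformM ?mulN1r // oppr_eq0 oner_eq0.
Qed.

(** Expand [ba][-ba] = 0. The cross terms are <b>(<-1>[b][a] + [a][b]); the remaining terms sum to h
    [a][-1], which vanishes because h is central and h[-1] = [1] = 0. *)
Lemma mwsymC a b : [a] * [b] = mweps * ([b] * [a]).
Proof.
have [->|a0] := eqVneq a 0; first by rewrite mwsym0 mulr0 mul0r mulr0.
have [->|b0] := eqVneq b 0; first by rewrite mwsym0 mulr0 mul0r mulr0.
have N1 : -1 != 0 :> F by rewrite oppr_eq0 oner_eq0.
have Na : - a != 0 by rewrite oppr_eq0.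
have := mwsymN (b * a); rewrite -mulrN mwsymMl // [X in _ * [X]]mulrN.
rewrite -mulNr mwsymMl ?oppr_eq0 ?oner_eq0 // mulrDl !mulrDr mwsymN add0r.
have -> : [b] * (<[- b]> * [a]) = <[b]> * (<[-1]> * ([b] * [a])).
  by rewrite mulrA -mwform_central mwformN // [<[-1]> * _]mwform_central -!mulrA.
have -> : <[b]> * [a] * (<[- b]> * [a]) = <[-1]> * ([a] * [-1]).
  rewrite -mulrA (mulrA [a]) -mwform_central -!mulrA mwsym_sqrr !mulrA.
  by rewrite -mwformM ?oppr_eq0 ?oner_eq0 // mulrN -mulN1r mwformMsqr.
have -> : [- b] = [b] + <[b]> * [-1] by rewrite -mwsymMl // mulrN1.
rewrite mulrDr -!mulrA (mulrA [a] <[b]>) -mwform_central -!mulrA.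
rewrite (mulrA <[b]> <[b]>) -(mwformM b0 b0) mwform_sqr // mul1r -!addrA.
have -> : [a] * [-1] + <[-1]> * ([a] * [-1]) = 0.
  rewrite -[X in X + _]mul1r -mulrDl -/mwhyp mulrA mwhyp_central -mulrA.
  by rewrite mwhyp_symN1 mulr0.
rewrite addr0 -mulrDr => e0.
have {}e0 : <[-1]> * ([b] * [a]) + [a] * [b] = 0.
  by rewrite -[LHS]mul1r -(mwformV b0) [<[b]> * _]mwform_central -mulrA e0 mulr0.
by apply/eqP; rewrite /mweps mulNr -addr_eq0 addrC e0.
Qed.

Lemma mweta_eps : eta * mweps = eta.
Proof.
apply/eqP; rewrite /mweps mulrN -subr_eq0 -opprD oppr_eq0 addrC.
by rewrite -[X in X + _]mulr1 -mulrDr mweta_hyp.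
Qed.

Lemma mweps_sqr : mweps * mweps = 1.
Proof. by rewrite /mweps mulrNN -mwformM ?oppr_eq0 ?oner_eq0 // mulrNN mulr1 mwform1. Qed.

Lemma mwformN1_hyp : <[-1]> * mwhyp = mwhyp.
Proof.
rewrite /mwhyp mulrDr mulr1 -mwformM ?oppr_eq0 ?oner_eq0 //.
by rewrite mulrNN mulr1 mwform1 addrC.
Qed.

Lemma mwform_hyp a : <[a]> * mwhyp = mwhyp.
Proof.
by rewrite {1}/mwform mulrDl mul1r -mulrA -mwhyp_central mulrA mweta_hyp mul0r addr0.
Qed.

Lemma mwform_addN a : a != 0 -> <[a]> + <[- a]> = mwhyp.
Proof.
move=> a0; rewrite mwformN // -[X in X + _]mul1r -mulrDl -/mwhyp.
by rewrite mwhyp_central mwform_hyp.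
Qed.

Lemma mweps_hyp : mweps * mwhyp = - mwhyp.
Proof. by rewrite /mweps mulNr mwformN1_hyp. Qed.

Lemma mwform_steinberg a : a != 0 -> a != 1 ->
  <[a]> + <[1 - a]> = 1 + <[a * (1 - a)]>.
Proof.
move=> a0 a1; have a1' : 1 - a != 0 by rewrite subr_eq0 eq_sym.
by rewrite /mwform mwsymM // mw_steinberg // mulr0 addr0 mulrDr addrACA -addrA.
Qed.

Lemma mwformE a : <[a]> = 1 + eta * [a].
Proof. by []. Qed.

(** The Steinberg relation for a / (a + b), multiplied by <a + b>; squares drop out of the
    brackets. *)
Lemma mwform_add a b : a != 0 -> b != 0 -> a + b != 0 ->
  <[a]> + <[b]> = <[a + b]> + <[a * b * (a + b)]>.
Proof.
move=> a0 b0 ab0; set c := a + b; pose u := a / c.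
have u0 : u != 0 by rewrite mulf_neq0 ?invr_eq0.
have uE : 1 - u = b / c by rewrite -(divff ab0) -mulrBl /c addrAC subrr add0r.
have u1 : u != 1.
  by rewrite -subr_eq0 -oppr_eq0 opprB uE mulf_neq0 ?invr_eq0.
have := congr1 (fun z => <[c]> * z) (mwform_steinberg u0 u1).
rewrite /= uE mulrDr (mulrDr _ 1 <[u * _]>) mulr1 -!mwformM ?mulf_neq0 ?invr_eq0 //.
have cE z : c * (z / c) = z by rewrite mulrC divfK.
rewrite !cE /u => ->; congr (_ + _).
rewrite [c * _]mulrCA cE -(mwformMsqr (b := c)) ?mulf_neq0 ?invr_eq0 //.
by congr mwform; rewrite [a / c * b]mulrAC -!mulrA [c^-1 * _]mulrA mulVf // mul1r.
Qed.

End MilnorWittRing.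

(** * Modules over Milnor-Witt K-theory *)

Section MWModule.
Variables (F : fieldType) (M : zmodType) (H : zmodClosed M).
Variables (S : F -> M -> M) (E : M -> M).

(** The data of a left K^MW-module structure on [M / H]. *)
Record mw_module : Prop := MWModule {
  mwm_symB : forall a, zmod_morphism (S a);
  mwm_etaB : zmod_morphism E;
  mwm_symH : forall a x, x \in H -> S a x \in H;
  mwm_etaH : forall x, x \in H -> E x \in H;
  mwm_sym0 : forall x, S 0 x \in H;
  mwm_steinberg : forall a x, a != 0 -> a != 1 -> S a (S (1 - a) x) \in H;
  mwm_symM : forall a b x, a != 0 -> b != 0 ->
    S (a * b) x - (S a x + S b x + E (S a (S b x))) \in H;
  mwm_eta_sym : forall a x, a != 0 -> S a (E x) - E (S a x) \in H;
  mwm_eta_hyp : forall x, E (E (S (- 1) x) + (x + x)) \in H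
}.

Fixpoint mweval (s : mwterm F) (x : M) : M :=
  match s with
  | MWsym a => S a x
  | MWeta => E x
  | MWzero => 0
  | MWone => x
  | MWopp s => - mweval s x
  | MWadd s u => mweval s x + mweval u x
  | MWmul s u => mweval s (mweval u x)
  end.

(** The value depends on the chosen term, but only modulo [H]: by [mweval_cong], congruent terms act
    alike up to [H]. Hence all the laws below hold modulo [H]. *)
Definition mwaction (z : KMW F) : M -> M := mweval (repr z).

Hypothesis SE : mw_module.

Lemma mwevalB s : zmod_morphism (mweval s).
Proof.
elim: s => [a||||s IH|s IHs u IHu|s IHs u IHu] x y //=.
- exact: mwm_symB.
- exact: mwm_etaB.
- by rewrite subr0.
- by rewrite IH opprD.
- by rewrite IHs IHu opprD addrACA.
- by rewrite IHu IHs.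
Qed.

Lemma mwevalH s x : x \in H -> mweval s x \in H.
Proof.
elim: s x => [a||||s IH|s IHs u IHu|s IHs u IHu] x xH //=.
- exact: mwm_symH.
- exact: mwm_etaH.
- exact: rpred0.
- by rewrite rpredN IH.
- by rewrite rpredD ?IHs ?IHu.
- by rewrite IHs ?IHu.
Qed.

Let mwevalD s : {morph mweval s : x y / x + y}.
Proof.
move=> x y; have e0 : mweval s 0 = 0 by have := mwevalB s 0 0; rewrite !subrr.
have eN z : mweval s (- z) = - mweval s z by rewrite -sub0r mwevalB e0 sub0r.
by rewrite -[y in LHS]opprK mwevalB eN opprK.
Qed.

Lemma mweval_cong s u : mwcong s u -> forall x, mweval s x - mweval u x \in H.
Proof.
elim=> {s u} /=.
- by move=> s x; rewrite subrr rpred0.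
- by move=> s u _ IH x; rewrite -rpredN opprB.
- move=> u s v _ IH1 _ IH2 x.
  by rewrite -(subrK (mweval u x) (mweval s x)) -addrA rpredD.
- by move=> s u _ IH x; rewrite -opprD rpredN.
- by move=> s s' u u' _ IHs _ IHu x; rewrite opprD addrACA rpredD.
- move=> s s' u u' _ IHs _ IHu x.
  rewrite -(subrK (mweval s (mweval u' x)) (mweval s _)) -addrA rpredD //.
  by rewrite -mwevalB mwevalH.
- by move=> s u v x; rewrite addrA subrr rpred0.
- by move=> s u x; rewrite (addrC (mweval s x)) subrr rpred0.
- by move=> s x; rewrite add0r subrr rpred0.
- by move=> s x; rewrite addNr subr0 rpred0.
- by move=> s u v x; rewrite subrr rpred0.
- by move=> s x; rewrite subrr rpred0.
- by move=> s x; rewrite subrr rpred0.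
- by move=> s u v x; rewrite subrr rpred0.
- by move=> s u v x; rewrite mwevalD subrr rpred0.
- by move=> x; rewrite subr0 mwm_sym0.
- by move=> a a0 a1 x; rewrite subr0 mwm_steinberg.
- by move=> a b a0 b0 x; exact: mwm_symM.
- by move=> a a0 x; exact: mwm_eta_sym.
- by move=> x; rewrite subr0 mwm_eta_hyp.
Qed.

Lemma mwaction_pi s x : mwaction (\pi_(KMW F)%qT s) x - mweval s x \in H.
Proof. by apply: mweval_cong; apply/KMWP; rewrite reprK. Qed.

Lemma mwaction_sym a x : mwaction (mwsym a) x - S a x \in H.
Proof. exact: mwaction_pi (MWsym a) x. Qed.

Lemma mwaction_eta x : mwaction mweta x - E x \in H.
Proof. exact: mwaction_pi (MWeta F) x. Qed.

Lemma mwaction1 x : mwaction 1 x - x \in H.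
Proof. exact: mwaction_pi (MWone F) x. Qed.

Lemma mwactionM z w x : mwaction (z * w) x - mwaction z (mwaction w x) \in H.
Proof.
by have := mwaction_pi (MWmul (repr z) (repr w)) x; rewrite pi_mwmul !reprK.
Qed.

Lemma mwactionDl z w x : mwaction (z + w) x - (mwaction z x + mwaction w x) \in H.
Proof.
by have := mwaction_pi (MWadd (repr z) (repr w)) x; rewrite pi_mwadd !reprK.
Qed.

Lemma mwactionNl z x : mwaction (- z) x - (- mwaction z x) \in H.
Proof.
by have := mwaction_pi (MWopp (repr z)) x; rewrite pi_mwopp !reprK.
Qed.

End MWModule.

(** * Generators of the graded pieces *)

Section Degree.
Variable F : fieldType.
Implicit Types z w : KMW F.
Local Notation eta := (@mweta F).

Lemma mweta_prod_sym (us : seq F) :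
  eta * \prod_(u <- us) mwsym u = (\prod_(u <- us) mwsym u) * eta.
Proof.
elim: us => [|u us IH]; first by rewrite big_nil mulr1 mul1r.
by rewrite big_cons -mulrA -IH !mulrA mweta_sym.
Qed.

Lemma mwetaX_prod_sym m (us : seq F) :
  eta ^+ m * \prod_(u <- us) mwsym u = (\prod_(u <- us) mwsym u) * eta ^+ m.
Proof.
elim: m => [|m IH]; first by rewrite expr0 mulr1 mul1r.
by rewrite exprS -mulrA IH mulrA mweta_prod_sym -mulrA.
Qed.

Inductive mwspan (n : int) : KMW F -> Prop :=
| mwspan0 : mwspan n 0
| mwspan_gen m (us : seq F) : (size us)%:Z = n + m%:Z ->
    mwspan n (eta ^+ m * \prod_(u <- us) mwsym u)
| mwspanB z w : mwspan n z -> mwspan n w -> mwspan n (z - w).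

Lemma mwspanM m n z w : mwspan m z -> mwspan n w -> mwspan (m + n) (z * w).
Proof.
move=> mz; elim: mz w => {z} [|p us us_p|z z' _ IHz _ IHz'] w nw.
- by rewrite mul0r; exact: mwspan0.
- elim: nw => {w} [|q vs vs_q|w w' _ IHw _ IHw'].
  + by rewrite mulr0; exact: mwspan0.
  + have -> : eta ^+ p * \prod_(u <- us) mwsym u *
              (eta ^+ q * \prod_(u <- vs) mwsym u) =
              eta ^+ (p + q) * \prod_(u <- us ++ vs) mwsym u.
      rewrite big_cat /= exprD !mulrA -(mulrA _ _ (eta ^+ q)) -mwetaX_prod_sym.
      by rewrite !mulrA.
    apply: mwspan_gen; rewrite size_cat PoszD us_p vs_q PoszD.
    by rewrite !addrA; congr (_ + _); rewrite addrAC.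
  + by rewrite mulrBr; exact: mwspanB.
- by rewrite mulrBl; apply: mwspanB; [exact: IHz|exact: IHz'].
Qed.

Lemma mwhomog_span n z : mwhomog n z -> mwspan n z.
Proof.
elim=> {n z} [n||a||n z w _ IHz _ IHw|m n z w _ IHz _ IHw].
- exact: mwspan0.
- by have := @mwspan_gen 0 0 [::]; rewrite big_nil mulr1; apply.
- by have := @mwspan_gen 1 0 [:: a]; rewrite big_seq1 mul1r; apply.
- by have := @mwspan_gen (-1) 1 [::]; rewrite big_nil mulr1 expr1; apply.
- exact: mwspanB.
- exact: mwspanM.
Qed.

Lemma mwhomog_form (a : F) : mwhomog 0 (mwform a).
Proof. exact/asboolP/(valP (mwform0 a)). Qed.

Lemma mwhomogN n z : mwhomog n z -> mwhomog n (- z).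
Proof. by move=> nz; rewrite -sub0r; apply: mwhomogB => //; exact: mwhomog0. Qed.

Lemma mwhomogD n z w : mwhomog n z -> mwhomog n w -> mwhomog n (z + w).
Proof.
move=> nz nw; rewrite -[w]opprK; apply: mwhomogB => //.
exact: mwhomogN.
Qed.

Inductive mwform_span : KMW F -> Prop :=
| mwform_span_gen a : a != 0 -> mwform_span (mwform a)
| mwform_spanB z w : mwform_span z -> mwform_span w -> mwform_span (z - w).

Lemma mwform_span0 : mwform_span 0.
Proof.
have := mwform_span_gen (oner_neq0 F) => s1.
by rewrite -(subrr (mwform (1 : F))); exact: mwform_spanB.
Qed.

Lemma mwform_span_mul a z : a != 0 -> mwform_span z -> mwform_span (mwform a * z).
Proof.
move=> a0; elim=> {z} [b b0|z w _ IHz _ IHw].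
  by rewrite -mwformM //; apply: mwform_span_gen; rewrite mulf_neq0.
by rewrite mulrBr; exact: mwform_spanB.
Qed.

(** Each factor eta[u] equals <u> - 1 and eta commutes with symbols, so the element is a product of
    differences of forms. *)
Lemma mwform_span_etaX (us : seq F) :
  mwform_span (eta ^+ size us * \prod_(u <- us) mwsym u).
Proof.
elim: us => [|u us IH].
  by rewrite big_nil mulr1 expr0 -(mwform1 F); apply: mwform_span_gen (oner_neq0 F).
rewrite big_cons /= exprSr -mulrA (mulrA eta) !mulrA.
have [->|u0] := eqVneq u 0.
  by rewrite mwsym0 mulr0 mul0r; exact: mwform_span0.
have := mwetaX_prod_sym (size us) [:: u]; rewrite big_seq1 => uC.
rewrite -!mulrA mulrA -exprSr exprS -mulrA (mulrA _ (mwsym u)) uC.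
rewrite -mulrA mulrA.
have -> : eta * mwsym u = mwform u - 1 by rewrite mwformE addrAC subrr add0r.
rewrite mulrBl mul1r; apply: mwform_spanB => //; exact: mwform_span_mul.
Qed.

Lemma mwspan_form z : mwspan 0 z -> mwform_span z.
Proof.
elim=> {z} [|m us|z w _ IHz _ IHw]; first exact: mwform_span0.
  by rewrite add0r => -[<-]; exact: mwform_span_etaX.
exact: mwform_spanB.
Qed.

(** In degree 0 there are as many symbols as factors eta, so the <a> generate this piece as a group.
    Identities between additive maps out of K^MW_0 need only be tested on them. *)
Lemma KMWdeg0_ind (P : KMWdeg F 0 -> Prop) :
    (forall a, a != 0 -> P (mwform0 a)) ->
    (forall x y, P x -> P y -> P (x - y)) ->
  forall x, P x.
Proof.
move=> Pf PB x; have /asboolP/mwhomog_span/mwspan_form := valP x.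
suff IH z : mwform_span z -> exists2 y : KMWdeg F 0, P y & val y = z.
  by case/IH=> y Py /val_inj <-.
elim=> {z} [a a0|z w _ [y Py <-] _ [y' Py' <-]].
  by exists (mwform0 a); [exact: Pf|].
by exists (y - y'); [exact: PB|].
Qed.

End Degree.

Section ZeroPred.
Variable M : zmodType.

(** With this zero subgroup as [H], a module modulo [H] is a genuine module. *)
Definition zero_pred : {pred M} := fun x => x == 0.

Lemma zero_pred_zmod_closed : zmod_closed zero_pred.
Proof.
split=> [|x y]; rewrite !unfold_in; first exact: eqxx.
by move=> /eqP-> /eqP->; rewrite subrr.
Qed.

HB.instance Definition _ := GRing.isZmodClosed.Build M zero_pred
  zero_pred_zmod_closed.

Lemma zero_predB x y : (x - y \in zero_pred) = (x == y).
Proof. by rewrite unfold_in subr_eq0. Qed.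

End ZeroPred.

(** * The residue homomorphism of a discrete valuation *)

Section Residue.
Variable kappa : fieldType.
Implicit Types (u v : kappa) (z w : KMW kappa).
Local Notation eta := (@mweta kappa).
Local Notation h := (mwhyp kappa).
Local Notation eps := (mweps kappa).
Local Notation "[ a ]" := (mwsym a) (at level 0, format "[ a ]").
Local Notation "<[ a ]>" := (mwform a) (at level 0, format "<[ a ]>").

Lemma mwhypX_central (i : int) z : (h *~ i) * z = z * (h *~ i).
Proof. by rewrite mulrzAl mulrzAr mwhyp_central. Qed.

Lemma mweta_hypX (i : int) : eta * (h *~ i) = 0.
Proof. by rewrite mulrzAr mweta_hyp mul0rz. Qed.

(** [m_eps <u>], where [m_eps] is the sum of the first [m] terms of
    1, <-1>, 1, <-1>, ... for m >= 0. *)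
Definition mwint (m : int) u : KMW kappa :=
  h *~ (m %/ 2)%Z + (if (2 %| m)%Z then 0 else <[u]>).

Lemma mwint_central m u z : mwint m u * z = z * mwint m u.
Proof.
rewrite /mwint mulrDl mulrDr mwhypX_central; case: ifP => _.
  by rewrite mul0r mulr0.
by rewrite mwform_central.
Qed.

Lemma mwintE r (b : bool) u :
  mwint (r * 2 + b%:Z) u = h *~ r + (if b then <[u]> else 0).
Proof.
rewrite /mwint; have -> : (2 %| r * 2 + b%:Z)%Z = ~~ b by rewrite rpredDl ?dvdz_mull //; case: b.
rewrite divzMDl //; have -> : (b%:Z %/ 2)%Z = 0 by case: b.
by rewrite addr0 if_neg.
Qed.

Lemma int_parity (m : int) : exists r (b : bool), m = r * 2 + b%:Z.
Proof.
exists (m %/ 2)%Z; have := divz_eq m 2.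
have := modz_ge0 m (isT : 2 != 0 :> int); have := ltz_pmod m (isT : 0 < 2 :> int).
by case: (m %% 2)%Z => [[|[|i]]|i] // _ _ m2; [exists false|exists true].
Qed.

Lemma mweta_mwint r (b : bool) u :
  eta * mwint (r * 2 + b%:Z) u = if b then eta * <[u]> else 0.
Proof.
by rewrite mwintE mulrDr mweta_hypX add0r; case: b; rewrite ?mulr0.
Qed.

Lemma mwint_symN1 r (b : bool) u :
  mwint (r * 2 + b%:Z) u * [-1] = if b then <[u]> * [-1] else 0.
Proof.
rewrite mwintE mulrDl mulrzAl mwhyp_symN1 mul0rz add0r.
by case: b; rewrite ?mul0r.
Qed.

Lemma mweta_form u v : eta * <[u]> * [v] = <[u]> * <[v]> - <[u]>.
Proof.
rewrite -mwform_eta -mulrA -[X in _ - X]mulr1 -mulrBr.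
by rewrite [in RHS]mwformE addrAC subrr add0r.
Qed.

(** This is the xi-coefficient of [ab] = [a] + [b] + eta[a][b] for a = pi^m u and b = pi^n v,
    simplified by eta eps = eta. Since eta kills h, the eta terms depend only on the parities of m
    and n. *)
Lemma mwintD m n u v : u != 0 -> v != 0 ->
  mwint (m + n) (u * v) = mwint m u + mwint n v + eta * ([u] * mwint n v)
    + eta * (mwint m u * [v]) + eta * (mwint m u * ([-1] * mwint n v)).
Proof.
move=> u0 v0; have [r [b ->]] := int_parity m; have [s [d ->]] := int_parity n.
rewrite -2!(mwint_central _ v) !mulrA !mweta_mwint.
have -> : (if b then eta * <[u]> else 0) * mwint (s * 2 + d%:Z) v * [-1] =
          if b && d then <[u * v]> * <[-1]> - <[u * v]> else 0.
  rewrite -mulrA mwint_symN1; case: b; case: d => //=; rewrite ?mulr0 ?mul0r //.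
  by rewrite mulrA -mwform_eta -(mulrA <[u]>) -(mwform_eta v) mulrA -mwformM //
    mwform_eta mweta_form.
have fE (c : bool) (a a' : kappa) : (if c then eta * <[a]> else 0) * [a'] =
    if c then <[a]> * <[a']> - <[a]> else 0.
  by case: c; rewrite ?mul0r // mweta_form.
rewrite !fE -(mwform_central u) -!mwformM //.
(* Two odd exponents produce a carry, that is one more h, which is then written as <uv> + <-uv>. *)
have -> : r * 2 + b%:Z + (s * 2 + d%:Z) =
          (r + s + (b && d)%:Z) * 2 + (b (+) d)%:Z.
  by case: b; case: d; rewrite /= !mulrDl; lia.
rewrite !mwintE !mulrzDr; case: b; case: d => /=; rewrite ?addr0 ?add0r.
- have uv0 : u * v != 0 by rewrite mulf_neq0.
  rewrite (addrACA _ <[u]>) -!(addrA (h *~ r + h *~ s)); congr (_ + _).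
  rewrite mulr1z -(mwform_addN uv0) mulrN1.
  rewrite -(addrA <[u]>) [<[v]> + _]addrC subrK (addrC <[u]>) -addrA.
  by rewrite [_ - <[u]> + _]addrC subrKA [RHS]addrACA subrr addr0.
- move: <[u]> <[u * v]> => U W.
  by rewrite [_ + U + _]addrAC -[RHS]addrA [U + _]addrC subrK.
- move: <[v]> <[u * v]> => V W.
  by rewrite (addrA (h *~ r)) -[RHS]addrA [V + _]addrC subrK.
- by [].
- by rewrite mulf_neq0.
- by rewrite oppr_eq0 oner_eq0.
Qed.

(** This is the xi-coefficient of [a][-a] = 0 for a = pi^m u. *)
Lemma mwint_steinberg m u : u != 0 ->
  eps * ([u] * mwint m (- u)) + mwint m u * [- u]
    + mwint m u * ([-1] * mwint m (- u)) = 0.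
Proof.
move=> u0; have N1 : -1 != 0 :> kappa by rewrite oppr_eq0 oner_eq0.
have Nu : [- u] = [-1] - eps * [u].
  by have := mwsymMl N1 u0; rewrite mulN1r /mweps mulNr opprK.
have [r [b ->]] := int_parity m.
rewrite -2!(mwint_central _ (- u)) mwint_symN1.
have -> : mwint (r * 2 + b%:Z) u * (if b then <[- u]> * [-1] else 0) =
          if b then <[-1]> * [-1] else 0.
  case: b; rewrite ?mulr0 // mulrA mwint_central -mulrA (mwint_symN1 r true).
  by rewrite mulrA -mwformM ?oppr_eq0 // mulNr -mulN1r mwformMsqr.
rewrite !mwintE mulrA mulrDr mulrzAr mweps_hyp mulNrz.
rewrite (mulrDl _ _ [u]) (mulrDl _ _ [- u]) mulNr !mulrzAl.
have -> : h * [- u] = h * [u].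
  rewrite Nu mulrBr mwhyp_symN1 sub0r mulrA -mweps_central mweps_hyp mulNr.
  by rewrite opprK.
rewrite addrACA addNr add0r.
case: b; last by rewrite !mulr0 !mul0r !addr0.
have uN : <[- u]> * [u] = [u].
  by rewrite mwformE mulrDl mul1r -mulrA mwsymNl mulr0 addr0.
have Nuu : <[u]> * [- u] = [- u].
  by rewrite mwformE mulrDl mul1r -mulrA mwsymN mulr0 addr0.
rewrite -mulrA uN Nuu Nu [_ - _]addrC addrA subrr add0r.
by have := mwhyp_symN1 kappa; rewrite /mwhyp mulrDl mul1r.
Qed.

(** Multiplication by [m_u] = [pi^m u] in K^MW(kappa) (+) xi K^MW(kappa), where
    xi stands for the symbol of the uniformizer: xi^2 = xi[-1] and
    [u]xi = xi (eps [u]). *)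
Definition theta (m : int) u (p : KMW kappa * KMW kappa) : KMW kappa * KMW kappa :=
  ([u] * p.1, eps * [u] * p.2 + mwint m u * (p.1 + [-1] * p.2)).

Definition mweta2 (p : KMW kappa * KMW kappa) : KMW kappa * KMW kappa :=
  (eta * p.1, eta * p.2).

Lemma theta_is_zmod_morphism m u : zmod_morphism (theta m u).
Proof.
move=> [x y] [x' y']; congr pair; rewrite /= ?mulrBr //.
have -> : x - x' + ([-1] * y - [-1] * y') = x + [-1] * y - (x' + [-1] * y').
  by rewrite opprD addrACA.
by rewrite mulrBr opprD addrACA.
Qed.

Lemma theta1 p : theta 0 1 p = 0.
Proof.
rewrite /theta mwsym_one mulr0 !mul0r (mwintE 0 false) mulr0z addr0 mul0r add0r.
by [].
Qed.

Lemma thetaM m n u v p : u != 0 -> v != 0 ->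
  theta (m + n) (u * v) p =
  theta m u p + theta n v p + mweta2 (theta m u (theta n v p)).
Proof.
case: p => x y u0 v0; congr pair; rewrite /=.
  by rewrite mwsymM // !mulrDl !mulrA.
set X := x + _; rewrite mwintD //; move: (mwint m u) (mwint n v) => c e.
have e1 : eta * (eps * [u] * (eps * [v] * y)) = eps * (eta * ([u] * [v])) * y.
  rewrite -!mulrA (mulrA [u] eps) -mweps_central !mulrA -(mulrA eta) mweps_sqr.
  by rewrite mweps_central mweta_eps mulr1.
have e2 : eta * (eps * [u] * (e * X)) = eta * ([u] * e) * X.
  by rewrite !mulrA mweta_eps.
have e3 : c * [v] * x + c * [-1] * (eps * [v] * y) = c * [v] * X.
  rewrite /X mulrDr; congr (_ + _); rewrite -!mulrA; congr (c * _).
  by rewrite [RHS]mulrA mwsymC !mulrA -mweps_central.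
have -> : eta * (eps * [u] * (eps * [v] * y + e * X) +
                 c * ([v] * x + [-1] * (eps * [v] * y + e * X))) =
  eps * (eta * ([u] * [v])) * y + eta * ([u] * e) * X + eta * (c * [v]) * X +
  eta * (c * ([-1] * e)) * X.
  rewrite -e1 -e2 -[eta * (c * [v]) * X]mulrA -e3.
  rewrite -[eta * (c * ([-1] * e)) * X]mulrA -!mulrDr; congr (eta * _).
  by rewrite !mulrDr -!addrA !mulrA.
clearbody X; rewrite mwsymM //; move: (eta * ([u] * [v])) => d.
move: (eta * ([u] * e)) (eta * (c * [v])) (eta * (c * ([-1] * e))) => P Q R.
rewrite !mulrDr !mulrDl -!addrA; congr (_ + _).
rewrite [RHS]addrCA; congr (_ + _).
by rewrite addrCA; congr (_ + _); rewrite addrCA.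
Qed.

Lemma theta_steinberg m u p : u != 0 -> theta m u (theta m (- u) p) = 0.
Proof.
case: p => x y u0; congr pair; rewrite /=; first by rewrite mulrA mwsymN mul0r.
set X := x + _; have := mwint_steinberg m u0.
move: (mwint m u) (mwint m (- u)) => c e e0.
have e1 : eps * [u] * (eps * [- u] * y) = 0.
  by rewrite -!mulrA (mulrA [u]) -mweps_central -!mulrA (mulrA [u]) mwsymN mul0r !mulr0.
have e2 : c * ([- u] * x) + c * ([-1] * (eps * [- u] * y)) = c * [- u] * X.
  rewrite -[RHS]mulrA /X !mulrDr; congr (_ + c * _).
  by rewrite [RHS]mulrA mwsymC !mulrA -mweps_central.
rewrite -[RHS](mul0r X) -e0; clearbody X.
by rewrite !mulrDr !mulrDl e1 add0r (addrA (c * _)) e2 addrA !mulrA.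
Qed.

Lemma theta_steinberg0 u p : u != 0 -> u != 1 -> theta 0 u (theta 0 (1 - u) p) = 0.
Proof.
case: p => x y u0 u1; congr pair; rewrite /=; first by rewrite mulrA mw_steinberg ?mul0r.
rewrite !(mwintE 0 false) mulr0z addr0 !mul0r !addr0 -!mulrA.
by rewrite (mulrA [u]) -mweps_central -!mulrA (mulrA [u]) mw_steinberg // mul0r !mulr0.
Qed.

Lemma theta_eta m u p : theta m u (mweta2 p) = mweta2 (theta m u p).
Proof.
case: p => x y; congr pair => /=; first by rewrite mulrA mweta_sym -mulrA.
have -> : eps * [u] * (eta * y) = eta * (eps * [u] * y).
  by rewrite mulrA -(mulrA eps) mweta_sym !mulrA mweps_central.
have -> : [-1] * (eta * y) = eta * ([-1] * y) by rewrite mulrA mweta_sym -mulrA.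
by rewrite -(mulrDr eta x) (mulrA (mwint m u)) mwint_central -(mulrA eta (mwint m u)) -mulrDr.
Qed.

Lemma theta_eta_hyp p : mweta2 (mweta2 (theta 0 (-1) p) + (p + p)) = 0.
Proof.
have hE z : eta * (eta * ([-1] * z) + (z + z)) = 0.
  rewrite -[RHS](mul0r z) -(mweta_hyp kappa) -mulrA; congr (_ * _).
  by rewrite /mwhyp mulrDl mul1r mwformE mulrDl mul1r mulrA [RHS]addrA addrC.
case: p => x y; congr pair; rewrite /= ?hE //.
rewrite (mwintE 0 false) mulr0z addr0 mul0r addr0.
by have -> : eta * (eps * [-1] * y) = eta * ([-1] * y)
  by rewrite !mulrA mweta_eps.
Qed.

Section Valuation.
Variables (K : fieldType) (val : K -> int) (ang : K -> kappa).

(** [ang a] stands for the residue of [a / pi ^ val a]. *)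
Record angular_valuation : Prop := AngularValuation {
  ang_neq0 : forall a, a != 0 -> ang a != 0;
  valM : forall a b, a != 0 -> b != 0 -> val (a * b) = val a + val b;
  angM : forall a b, a != 0 -> b != 0 -> ang (a * b) = ang a * ang b;
  valN1 : val (-1) = 0;
  angN1 : ang (-1) = -1;
  val_gt0 : forall a, a != 0 -> a != 1 -> 0 < val a ->
    val (1 - a) = 0 /\ ang (1 - a) = 1;
  val_eq0 : forall a, a != 0 -> a != 1 -> val a = 0 ->
    ang a = 1 \/ val (1 - a) = 0 /\ ang (1 - a) = 1 - ang a
}.

Hypothesis va : angular_valuation.

Definition mwtheta (a : K) (p : KMW kappa * KMW kappa) :=
  if a == 0 then 0 else theta (val a) (ang a) p.

Lemma val1 : val 1 = 0.
Proof.
have N1 : -1 != 0 :> K by rewrite oppr_eq0 oner_eq0.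
by rewrite -(mulr1 1) -mulrNN (valM va) // (valN1 va).
Qed.

Lemma valV a : a != 0 -> val a^-1 = - val a.
Proof.
move=> a0; apply/eqP; rewrite -addr_eq0 -(valM va) ?invr_eq0 // mulVf //.
by rewrite val1.
Qed.

Lemma valN a : a != 0 -> val (- a) = val a.
Proof.
by move=> a0; rewrite -mulN1r (valM va) ?oppr_eq0 ?oner_eq0 // (valN1 va) add0r.
Qed.

Lemma angN a : a != 0 -> ang (- a) = - ang a.
Proof.
by move=> a0; rewrite -mulN1r (angM va) ?oppr_eq0 ?oner_eq0 // (angN1 va) mulN1r.
Qed.

Lemma mwtheta_module :
  mw_module (@zero_pred (KMW kappa * KMW kappa)%type : zmodClosed _) mwtheta mweta2.
Proof.
have etaB : zmod_morphism mweta2 by move=> x y; congr pair; rewrite /= mulrBr.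
have thB a : zmod_morphism (mwtheta a).
  by move=> x y; rewrite /mwtheta; case: eqP => _; rewrite ?subr0 ?theta_is_zmod_morphism.
split=> //.
- move=> a x; rewrite unfold_in => /eqP->.
  by have := thB a 0 0; rewrite !subrr unfold_in => ->.
- by move=> x; rewrite unfold_in => /eqP->; have := etaB 0 0; rewrite !subrr unfold_in => ->.
- by move=> x; rewrite /mwtheta eqxx unfold_in.
- move=> a x a0 a1; have a1' : 1 - a != 0 by rewrite subr_eq0 eq_sym.
  rewrite unfold_in /mwtheta (negPf a0) (negPf a1').
  have th0 m u : theta m u 0 = 0.
    by have := theta_is_zmod_morphism m u 0 0; rewrite !subrr.
  (* If val a > 0, then 1 - a has residue 1 and acts by zero. If val a < 0, then 1 - a = (-a)(1 -
     a^-1) acts like -a, and [a][-a] = 0 applies. If val a = 0, the relation is either trivial or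
     the Steinberg relation of the residue field. *)
  have [v_gt0|v_lt0|/esym v0] := ltrgtP 0 (val a).
  + by have [-> ->] := val_gt0 va a0 a1 v_gt0; rewrite theta1 th0.
  + have V0 : a^-1 != 0 by rewrite invr_eq0.
    have V1 : a^-1 != 1 by rewrite invr_eq1.
    have aV : a * a^-1 = 1 by rewrite divff.
    have V_gt0 : 0 < val a^-1 by rewrite valV // oppr_gt0.
    have [e1 e2] := val_gt0 va V0 V1 V_gt0.
    have aE : 1 - a = - a * (1 - a^-1) by rewrite mulrBr mulr1 mulNr aV opprK addrC.
    rewrite aE (valM va) ?(angM va) ?oppr_eq0 ?subr_eq0 1?[1 == _]eq_sym //.
    by rewrite e1 e2 addr0 mulr1 valN // angN // theta_steinberg // (ang_neq0 va).
  + have [e1|[e1 e2]] := val_eq0 va a0 a1 v0; first by rewrite v0 e1 theta1.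
    rewrite v0 e1 e2 theta_steinberg0 ?(ang_neq0 va) //.
    by rewrite -subr_eq0 -opprB -e2 oppr_eq0 (ang_neq0 va).
- move=> a b x a0 b0; rewrite zero_predB /mwtheta mulf_eq0 (negPf a0) (negPf b0) /=.
  by rewrite (valM va) // (angM va) // thetaM ?(ang_neq0 va).
- by move=> a x a0; rewrite zero_predB /mwtheta (negPf a0) theta_eta.
- move=> x; rewrite unfold_in /mwtheta oppr_eq0 oner_eq0 (valN1 va) (angN1 va).
  by rewrite theta_eta_hyp.
Qed.

Local Notation act := (mwaction mwtheta mweta2).

(** The coefficient of xi in z applied to 1; the first component is the corresponding
    specialization. *)
Definition valresidue (z : KMW K) : KMW kappa := (act z (1, 0)).2.

Let eqP0 (p q : KMW kappa * KMW kappa) :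
  p - q \in (@zero_pred (KMW kappa * KMW kappa)%type : zmodClosed _) -> p = q.
Proof. by rewrite zero_predB => /eqP. Qed.

Let act_sym a p : a != 0 -> act (mwsym a) p = theta (val a) (ang a) p.
Proof.
move=> a0; rewrite (eqP0 (mwaction_sym mwtheta_module a p)).
by rewrite /mwtheta (negPf a0).
Qed.
Let act_eta p : act mweta p = mweta2 p.
Proof. exact: eqP0 (mwaction_eta mwtheta_module p). Qed.
Let act1 p : act 1 p = p.
Proof. exact: eqP0 (mwaction1 mwtheta_module p). Qed.
Let actM (z w : KMW K) p : act (z * w) p = act z (act w p).
Proof. exact: eqP0 (mwactionM mwtheta_module z w p). Qed.
Let actD (z w : KMW K) p : act (z + w) p = act z p + act w p.
Proof. exact: eqP0 (mwactionDl mwtheta_module z w p). Qed.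
Let actN (z : KMW K) p : act (- z) p = - act z p.
Proof. exact: eqP0 (mwactionNl mwtheta_module z p). Qed.

Lemma valresidueD (z w : KMW K) : valresidue (z + w) = valresidue z + valresidue w.
Proof. by rewrite /valresidue actD. Qed.

Lemma valresidue_eta (z : KMW K) : valresidue (mweta * z) = mweta * valresidue z.
Proof. by rewrite /valresidue actM act_eta. Qed.

Lemma valresidue_sym a : a != 0 -> valresidue (mwsym a) = mwint (val a) (ang a).
Proof.
by move=> a0; rewrite /valresidue act_sym //= !mulr0 add0r addr0 mulr1.
Qed.

Lemma mwint0 u : mwint 0 u = 0.
Proof. by rewrite (mwintE 0 false) mulr0z addr0. Qed.

Lemma mwint1 u : mwint 1 u = <[u]>.
Proof. by rewrite (mwintE 0 true) mulr0z add0r. Qed.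

Let act_units (us : seq K) : {in us, forall a, a != 0 /\ val a = 0} ->
  act (\prod_(a <- us) mwsym a) (1, 0) = (\prod_(a <- us) [ang a], 0).
Proof.
elim: us => [_|a us IH usU]; first by rewrite !big_nil act1.
have [u0 v0] := usU a (mem_head _ _).
rewrite !big_cons actM IH => [|w w_us]; last by apply: usU; rewrite inE w_us orbT.
by rewrite act_sym // v0; congr pair; rewrite /= !mulr0 mwint0 mul0r addr0.
Qed.

Lemma valresidue_units (us : seq K) :
  {in us, forall a, a != 0 /\ val a = 0} ->
  valresidue (\prod_(a <- us) mwsym a) = 0.
Proof. by move=> usU; rewrite /valresidue act_units. Qed.

Lemma valresidue_unif (pi : K) (us : seq K) :
    pi != 0 -> val pi = 1 -> ang pi = 1 ->
    {in us, forall a, a != 0 /\ val a = 0} ->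
  valresidue (mwsym pi * \prod_(a <- us) mwsym a) = \prod_(a <- us) [ang a].
Proof.
move=> pi0 vpi apu usU; rewrite /valresidue actM act_units // act_sym // vpi apu /=.
by rewrite !mulr0 add0r addr0 mwint1 mwform1 mul1r.
Qed.

Lemma mwhomog_hyp : mwhomog 0 h.
Proof. by apply: mwhomogD; [exact: mwhomog1|exact: mwhomog_form]. Qed.

Lemma mwhomog_mwint m u : mwhomog 0 (mwint m u).
Proof.
have hX (i : nat) : mwhomog 0 (h *+ i).
  elim: i => [|i IH]; first by rewrite mulr0n; exact: mwhomog0.
  by rewrite mulrS; apply: mwhomogD => //; exact: mwhomog_hyp.
apply: mwhomogD.
  by case: (m %/ 2)%Z => i; [exact: hX|exact: mwhomogN (hX _)].
by case: ifP => _; [exact: mwhomog0|exact: mwhomog_form].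
Qed.

Lemma valresidue_homog n (z : KMW K) : mwhomog n z -> mwhomog (n - 1) (valresidue z).
Proof.
(* As a symbol, xi has degree 1, so its coefficient sits one degree lower. *)
pose hom2 n (p : KMW kappa * KMW kappa) := mwhomog n p.1 /\ mwhomog (n - 1) p.2.
have hom20 m : hom2 m 0 by split; exact: mwhomog0.
have act0 p : act 0 p = 0.
  by apply: (@addrI _ (act 0 p)); rewrite -actD !addr0.
suff IH : mwhomog n z -> forall m p, hom2 m p -> hom2 (n + m) (act z p).
  move=> /IH/(_ 0 (1, 0)); rewrite addr0 => -[|//].
  by split; [exact: mwhomog1|exact: mwhomog0].
elim=> {n z} [n||a||n z w _ IHz _ IHw|n n' z w _ IHz _ IHw] m p hp.
- by rewrite act0.
- by rewrite act1 add0r.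
- have [->|a0] := eqVneq a 0; first by rewrite mwsym0 act0.
  case: hp => p1 p2; rewrite act_sym //; split=> /=.
    by apply: mwhomogM => //; exact: mwhomog_sym.
  have em : 1 + m - 1 = m by rewrite addrAC subrr add0r.
  have p2' c : mwhomog m ([c] * p.2).
    have := mwhomogM (mwhomog_sym c) p2.
    by rewrite addrCA subrr addr0.
  rewrite em; apply: mwhomogD.
    rewrite -mulrA -[m]add0r; apply: mwhomogM => //.
    by apply: mwhomogN; exact: mwhomog_form.
  rewrite -[m]add0r; apply: mwhomogM; first exact: mwhomog_mwint.
  exact: mwhomogD.
- case: hp => p1 p2; rewrite act_eta; split=> /=.
    by apply: mwhomogM => //; exact: mwhomog_eta.
  by rewrite -addrA; apply: mwhomogM => //; exact: mwhomog_eta.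
- have [z1 z2] := IHz m p hp; have [w1 w2] := IHw m p hp.
  by rewrite actD actN; split; apply: mwhomogB.
- by rewrite actM -addrA; apply/IHz/IHw.
Qed.

End Valuation.

End Residue.

Lemma divf_cancel2 (F : fieldType) (a b p q : F) : a != 0 -> b != 0 -> q != 0 ->
  a * p / (b * q) / (a / b) = p / q.
Proof. by move=> a0 b0 q0; field; rewrite a0 b0 q0. Qed.

(** * Residues at closed points of G_m *)

Section ResidueSpan.
Variables (K : fieldType) (unitp : K -> Prop) (pi : K).
Hypotheses (unitp1 : unitp 1) (N1U : unitp (-1)) (pi0 : pi != 0).
Hypothesis decomp : forall a, a != 0 -> exists m : int, unitp (a / pi ^ m).
Implicit Types (z w : KMW K) (a b u : K).

Let expz_neq0 (m : int) : pi ^ m != 0.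
Proof. by rewrite expfz_neq0. Qed.

(** The elements on which Morel's conditions prescribe the residue. That they exhaust K^MW(K) is the
    uniqueness of the residue. *)
Inductive residue_span : KMW K -> Prop :=
| residue_span_unif i (us : seq K) : {in us, forall u, unitp u} ->
    residue_span (mweta ^+ i * (mwsym pi * \prod_(u <- us) mwsym u))
| residue_span_unit i (us : seq K) : {in us, forall u, unitp u} ->
    residue_span (mweta ^+ i * \prod_(u <- us) mwsym u)
| residue_spanB z w : residue_span z -> residue_span w -> residue_span (z - w).

Let rspan1 : residue_span 1.
Proof. by have := @residue_span_unit 0 [::]; rewrite big_nil mulr1; apply. Qed.

Let rspanN z : residue_span z -> residue_span (- z).
Proof.
move=> sz; rewrite -(sub0r z) -[X in X - _](subrr 1).
by apply: residue_spanB => //; apply: residue_spanB.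
Qed.

Let rspanD z w : residue_span z -> residue_span w -> residue_span (z + w).
Proof. by move=> sz sw; rewrite -[w]opprK; apply/residue_spanB/rspanN. Qed.

Let rspan_eta z : residue_span z -> residue_span (mweta * z).
Proof.
elim=> {z} [i us usU|i us usU|z w _ IHz _ IHw].
- by rewrite mulrA -exprS; exact: residue_span_unif.
- by rewrite mulrA -exprS; exact: residue_span_unit.
- by rewrite mulrBr; exact: residue_spanB.
Qed.

Let etaX_sym i (a : K) z : mwsym a * (mweta ^+ i * z) = mweta ^+ i * (mwsym a * z).
Proof.
by have := mwetaX_prod_sym i [:: a]; rewrite big_seq1 !mulrA => ->.
Qed.

Let consU u (us : seq K) : unitp u -> {in us, forall u, unitp u} ->
  {in u :: us, forall u, unitp u}.
Proof. by move=> uU usU w; rewrite inE => /orP[/eqP->|/usU]. Qed.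

Definition rspan_stable a := forall z, residue_span z -> residue_span (mwsym a * z).

Let stable_unit u : unitp u -> rspan_stable u.
Proof.
move=> uU z; elim=> {z} [i us usU|i us usU|z w _ IHz _ IHw].
(* Moving [u] past [pi] costs eps = -(1 + eta[-1]); the resulting [-1] on the left is carried past
   [pi] by [-1][pi] = [pi][pi] = [pi][-1]. *)
- rewrite etaX_sym (mulrA (mwsym u)) mwsymC /mweps mwformE !mulNr mulrN.
  apply: rspanN; rewrite !mulrDl mul1r mulrDr; apply: rspanD.
    have := residue_span_unif i (consU uU usU).
    by rewrite big_cons (mulrA (mwsym pi)).
  have := residue_span_unif i.+1 (consU N1U (consU uU usU)).
  rewrite !big_cons exprSr -!mulrA [mwsym pi * (_ * _)]mulrA -mwsym_sqrr.
  by rewrite mwsym_sqrl -!mulrA.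
- have := residue_span_unit i (consU uU usU); rewrite big_cons etaX_sym //.
- by rewrite mulrBr; exact: residue_spanB.
Qed.

Let stable_unif : rspan_stable pi.
Proof.
move=> z; elim=> {z} [i us usU|i us usU|z w _ IHz _ IHw].
- have := residue_span_unif i (consU N1U usU).
  by rewrite big_cons etaX_sym !(mulrA (mwsym pi)) mwsym_sqrr.
- by rewrite etaX_sym; exact: residue_span_unif.
- by rewrite mulrBr; exact: residue_spanB.
Qed.

Let stableM a b : a != 0 -> b != 0 -> rspan_stable a -> rspan_stable b ->
  rspan_stable (a * b).
Proof.
move=> a0 b0 sa sb z sz; rewrite mwsymM // !mulrDl -!mulrA.
by apply: rspanD; [apply: rspanD; [exact: sa|exact: sb]|apply/rspan_eta/sa/sb].
Qed.

Let stableV a : a != 0 -> rspan_stable a -> rspan_stable a^-1.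
Proof.
move=> a0 sa z sz; rewrite mwsymV ?invr_eq0 // invrK mwform_inv // mulNr.
apply: rspanN; rewrite mwformE mulrDl mul1r mulrDl -!mulrA.
by apply: rspanD; [exact: sa|apply/rspan_eta/sa/sa].
Qed.

(** The span contains 1 and is stable under left multiplication by eta, by units and by pi.
    Stability passes to products and inverses, hence to every a = pi^m u. *)
Lemma residue_span_full z : residue_span z.
Proof.
have stableX i : rspan_stable (pi ^+ i).
  elim: i => [|i IH]; first by rewrite expr0; apply/stable_unit/unitp1.
  by rewrite exprS; apply: stableM => //; rewrite ?expf_neq0 ?pi0.
have stableZ (m : int) : rspan_stable (pi ^ m).
  case: m => i; first by rewrite -exprnP.
  by rewrite NegzE -exprnN; apply: stableV => //; rewrite expf_neq0 ?pi0.
suff IH w : residue_span w -> residue_span (z * w) by rewrite -(mulr1 z); exact: IH.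
elim/KMW_ind: z w => [a|||z z' IH IH'|z z' IH IH'] w sw.
- have [->|a0] := eqVneq a 0.
    by rewrite mwsym0 mul0r -(subrr 1); exact: residue_spanB.
  have [m am] := decomp a0; rewrite -(divfK (expz_neq0 m) a).
  apply: stableM => //; rewrite ?expz_neq0 ?mulf_neq0 ?invr_eq0 ?expz_neq0 //.
  exact/stable_unit.
- exact: rspan_eta.
- by rewrite mul1r.
- by rewrite mulrBl; apply: residue_spanB; [exact: IH|exact: IH'].
- by rewrite -mulrA; apply/IH/IH'.
Qed.

Variables (kappa : fieldType) (red : K -> kappa) (d d' : KMW K -> KMW kappa).

Let residue_map (d : KMW K -> KMW kappa) : Prop :=
  [/\ {morph d : z w / z + w},
      forall z, d (mweta * z) = mweta * d z,
      forall us : seq K, {in us, forall u, unitp u} ->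
        d (mwsym pi * \prod_(u <- us) mwsym u) = \prod_(u <- us) mwsym (red u)
    & forall us : seq K, {in us, forall u, unitp u} ->
        d (\prod_(u <- us) mwsym u) = 0].

Lemma residue_map_uniq : residue_map d -> residue_map d' -> d =1 d'.
Proof.
move=> [dD deta dpi dU] [dD' deta' dpi' dU'] z.
have addB (e : KMW K -> KMW kappa) : {morph e : z w / z + w} -> zmod_morphism e.
  by move=> eD a b; apply: (@addIr _ (e b)); rewrite -eD !subrK.
elim: (residue_span_full z) => {z} [i us usU|i us usU|z w _ IHz _ IHw].
- elim: i => [|i IH]; first by rewrite !mul1r dpi ?dpi'.
  by rewrite exprS -mulrA deta deta' IH.
- elim: i => [|i IH]; first by rewrite !mul1r dU ?dU'.
  by rewrite exprS -mulrA deta deta' IH.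
- by rewrite !addB // IHz IHw.
Qed.

End ResidueSpan.

(** * Valuation and angular component at a closed point *)

Section LocalRing.
Variables (k : fieldType) (x : Gm_point k).
Local Notation K := {fraction {poly k}}.
Local Notation "p %:F" := (FracField.tofrac p).
Local Notation pi := ((pt_poly x)%:F : K).
Implicit Types z w a : K.

Lemma local_unitE z : local_unit x z <-> z \in localring x /\ red x z != 0.
Proof.
split=> -[zO zU]; split=> //.
  by apply: contraNneq zU => rz; apply/maxidealP.
by apply: contraNN zU => /maxidealP[_ ->].
Qed.

Lemma localring1 : 1 \in localring x.
Proof. by rewrite -tofrac1 localring_poly. Qed.

Lemma red1 : red x 1 = 1.
Proof. by rewrite -tofrac1 red_poly in_qpoly1. Qed.

Lemma local_unit1 : local_unit x 1.
Proof. by apply/local_unitE; rewrite localring1 red1 oner_eq0. Qed.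

Lemma local_unitN1 : local_unit x (-1).
Proof.
apply/local_unitE; rewrite -tofrac1 -rmorphN localring_poly red_poly.
by rewrite raddfN /= in_qpoly1 oppr_eq0 oner_eq0.
Qed.

Lemma local_unit_neq0 z : local_unit x z -> z != 0.
Proof.
move/local_unitE => [_]; apply: contraNneq => ->.
by rewrite -tofrac0 red_poly raddf0.
Qed.

Lemma local_unitM z w : local_unit x z -> local_unit x w -> local_unit x (z * w).
Proof.
move=> /local_unitE[zO rz] /local_unitE[wO rw]; apply/local_unitE.
by rewrite localringM // redM // mulf_neq0.
Qed.

Lemma local_unit_poly (p : {poly k}) : ~~ (pt_poly x %| p) -> local_unit x p%:F.
Proof.
by move=> xp; apply/local_unitE; rewrite localring_poly red_poly in_qpoly_eq0.
Qed.

Lemma local_unit_frac (p q : {poly k}) :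
  ~~ (pt_poly x %| p) -> ~~ (pt_poly x %| q) -> local_unit x (p%:F / q%:F).
Proof.
move=> xp xq; have zpq : local_frac x (p%:F / q%:F) (p, q) by split.
apply/local_unitE; rewrite (local_frac_localring zpq) (local_fracP zpq).
by split=> //; rewrite mulf_neq0 ?invr_eq0 ?in_qpoly_eq0.
Qed.

Lemma local_unitV z : local_unit x z -> local_unit x z^-1.
Proof.
move=> /local_unitE[/local_frac_exists[p [q zpq]] rz].
move: rz; rewrite (local_fracP zpq) mulf_eq0 invr_eq0 !in_qpoly_eq0 negb_or.
by case/andP=> xp xq; case: zpq => /= _ ->; rewrite invf_div; exact: local_unit_frac.
Qed.

Lemma pt_poly_neq0 : pi != 0.
Proof. exact: pt_ideal_subproof. Qed.

Lemma red_pt_poly : red x pi = 0.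
Proof. by apply/eqP; rewrite red_poly in_qpoly_eq0 dvdpp. Qed.

Lemma red_exprS_pt (i : nat) : red x (pi ^+ i.+1) = 0.
Proof.
rewrite exprS -tofracXn redM ?localring_poly //.
by rewrite red_pt_poly mul0r.
Qed.

Lemma local_unit_exp_pt (m : int) : local_unit x (pi ^ m) -> m = 0.
Proof.
have aux i : ~ local_unit x (pi ^+ i.+1).
  by move=> /local_unitE[_]; rewrite red_exprS_pt eqxx.
case: m => [[|i]|i] //.
  by rewrite -exprnP => /aux.
by rewrite NegzE -exprnN => /local_unitV; rewrite invrK => /aux.
Qed.

Lemma pt_poly_decomp (p : {poly k}) : p != 0 ->
  exists (i : nat) q, p = pt_poly x ^+ i * q /\ ~~ (pt_poly x %| q).
Proof.
have [n] := ubnP (size p); elim: n p => // n IHn p pn p0.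
have [/dvdpP[q pE]|xp] := boolP (pt_poly x %| p); last first.
  by exists 0, p; rewrite mul1r.
have x0 : pt_poly x != 0 by rewrite -tofrac_eq0 pt_poly_neq0.
have q0 : q != 0 by apply: contraNneq p0 => q0; rewrite pE q0 mul0r.
have qn : (size q < n)%N.
  rewrite -ltnS (leq_trans _ pn) // ltnS pE size_mul // -ltnS prednK; last first.
    by rewrite addn_gt0 size_poly_gt0 q0.
  rewrite -addn2 leq_add2l.
  by have [[]] := pt_irr x.
have [i [r [qE xr]]] := IHn q qn q0.
by exists i.+1, r; split=> //; rewrite pE qE exprSr mulrAC.
Qed.

Lemma frac_decomp a : a != 0 -> exists m : int, local_unit x (a / pi ^ m).
Proof.
move=> a0; have aE := frac_numden a.
move: aE; set n := (\n_ _)%Q; set d := (\d_ _)%Q => aE.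
have d0 : d != 0 by exact: denom_ratioP.
have n0 : n != 0 by apply: contraNneq a0 => n0; rewrite aE n0 tofrac0 mul0r.
have [i [p [nE xp]]] := pt_poly_decomp n0.
have [j [q [dE xq]]] := pt_poly_decomp d0.
exists (i%:Z - j%:Z).
have -> : a / pi ^ (i%:Z - j%:Z) = p%:F / q%:F.
  rewrite aE nE dE !tofracM !tofracXn expfzDr ?pt_poly_neq0 //.
  rewrite -invr_expz -!exprnP.
  have pin l : pi ^+ l != 0 by rewrite expf_neq0 ?pt_poly_neq0.
  exact: divf_cancel2 (pin _) (pin _) (pt_ndvd_tofrac xq).
exact: local_unit_frac.
Qed.

(** For nonzero [a] the exponent exists by [frac_decomp], and it is unique because no nontrivial
    power of pi is a unit. For a = 0 the set is empty and the default is taken. *)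
Definition pt_val a : int := xget 0 [set m : int | local_unit x (a / pi ^ m)]%classic.
Definition pt_ang a : resfield x := red x (a / pi ^ pt_val a).

Lemma pt_valP a : a != 0 -> local_unit x (a / pi ^ pt_val a).
Proof.
move=> /frac_decomp aE.
exact: (@xgetPex _ 0 [set m : int | local_unit x (a / pi ^ m)]%classic aE).
Qed.

Lemma expz_pt_neq0 (m : int) : pi ^ m != 0.
Proof. by rewrite expfz_neq0 ?pt_poly_neq0. Qed.

Lemma pt_valE a m : local_unit x (a / pi ^ m) -> pt_val a = m.
Proof.
move=> am; have a0 : a != 0.
  by have := local_unit_neq0 am; apply: contraNneq => ->; rewrite mul0r.
have := local_unitM (local_unitV (pt_valP a0)) am.
have -> : (a / pi ^ pt_val a)^-1 * (a / pi ^ m) = pi ^ (pt_val a - m).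
  by rewrite invf_div expfzDr ?pt_poly_neq0 // -invr_expz mulrA divfK.
by move/local_unit_exp_pt => /eqP; rewrite subr_eq0 => /eqP.
Qed.

Lemma pt_angE a m : local_unit x (a / pi ^ m) -> pt_ang a = red x (a / pi ^ m).
Proof. by move=> am; rewrite /pt_ang (pt_valE am). Qed.

Lemma pt_val_unit a : local_unit x a -> pt_val a = 0.
Proof. by move=> aU; apply: pt_valE; rewrite expr0z divr1. Qed.

Lemma pt_ang_unit a : local_unit x a -> pt_ang a = red x a.
Proof. by move=> aU; rewrite (@pt_angE a 0) expr0z divr1. Qed.

Lemma pt_val_pt : pt_val pi = 1.
Proof. by apply: pt_valE; rewrite expr1z divff ?pt_poly_neq0 //; exact: local_unit1. Qed.

Lemma pt_ang_pt : pt_ang pi = 1.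
Proof. by rewrite /pt_ang pt_val_pt expr1z divff ?pt_poly_neq0 // red1. Qed.

Lemma pt_val_gt0 a : a != 0 -> 0 < pt_val a -> a \in localring x /\ red x a = 0.
Proof.
move=> a0; have /local_unitE[] := pt_valP a0; case: (pt_val a) => [[|i]|i] // aO _ _.
rewrite -(divfK (expz_pt_neq0 i.+1) a) -exprnP -tofracXn.
rewrite localringM ?localring_poly ?tofracXn // redM ?localring_poly //.
  by rewrite red_exprS_pt mulr0.
by rewrite -tofracXn localring_poly.
Qed.

Lemma pt_angular : angular_valuation pt_val pt_ang.
Proof.
have N1U := local_unitN1.
have abE a b : a != 0 -> b != 0 -> a * b / pi ^ (pt_val a + pt_val b) =
    a / pi ^ pt_val a * (b / pi ^ pt_val b).
  by move=> a0 b0; rewrite expfzDr ?pt_poly_neq0 // invfM mulrACA.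
have abU a b : a != 0 -> b != 0 -> local_unit x (a * b / pi ^ (pt_val a + pt_val b)).
  by move=> a0 b0; rewrite (abE _ _ a0 b0); exact: local_unitM (pt_valP a0) (pt_valP b0).
split.
- by move=> a /pt_valP/local_unitE[].
- by move=> a b a0 b0; exact: (pt_valE (abU _ _ a0 b0)).
- move=> a b a0 b0; rewrite (pt_angE (abU _ _ a0 b0)) (abE _ _ a0 b0).
  by have [aO _] := pt_valP a0; have [bO _] := pt_valP b0; exact: redM.
- exact: pt_val_unit.
- rewrite pt_ang_unit // -tofrac1 -rmorphN red_poly raddfN /=.
  by rewrite in_qpoly1.
- move=> a a0 a1 /(pt_val_gt0 a0)[aO ra].
  have r1a : red x (1 - a) = 1 by rewrite redB ?localring1 // red1 ra subr0.
  have aU : local_unit x (1 - a).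
    by apply/local_unitE; rewrite localringB ?localring1 // r1a oner_eq0.
  by rewrite pt_val_unit // pt_ang_unit.
- move=> a a0 a1 va; have := pt_valP a0; rewrite va expr0z divr1 => aU.
  have [aO _] := aU; have r1a : red x (1 - a) = 1 - red x a.
    by rewrite redB ?localring1 // red1.
  rewrite pt_ang_unit //; have [->|ra] := eqVneq (red x a) 1; [by left|right].
  have a1U : local_unit x (1 - a).
    by apply/local_unitE; rewrite localringB ?localring1 // r1a subr_eq0 eq_sym.
  by rewrite pt_val_unit // pt_ang_unit.
Qed.

Lemma pt_residueP : is_mwresidue pi (valresidue pt_val pt_ang).
Proof.
have unit_val (us : seq K) : {in us, forall u, local_unit x u} ->
    {in us, forall u, u != 0 /\ pt_val u = 0}.
  by move=> usU u /usU uU; rewrite pt_val_unit //; split=> //; exact: local_unit_neq0.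
split.
- exact: valresidueD pt_angular.
- exact: valresidue_homog pt_angular.
- exact: valresidue_eta pt_angular.
- move=> us usU.
  rewrite (valresidue_unif pt_angular pt_poly_neq0 pt_val_pt pt_ang_pt (unit_val _ usU)).
  by apply: eq_big_seq => u /usU uU; rewrite (pt_ang_unit uU).
- by move=> us /unit_val usU; exact: (valresidue_units pt_angular usU).
Qed.

Lemma mwresidueP : is_mwresidue pi (mwresidue x pi).
Proof.
apply: (@xgetPex _ (fun=> 0) [set d | is_mwresidue pi d]%classic).
by exists (valresidue pt_val pt_ang); exact: pt_residueP.
Qed.

Lemma is_mwresidue_uniq (d d' : KMW K -> KMW (resfield x)) :
  is_mwresidue pi d -> is_mwresidue pi d' -> d =1 d'.
Proof.
move=> [dD _ deta dpi dU] [dD' _ deta' dpi' dU'].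
exact: (residue_map_uniq local_unit1 local_unitN1 pt_poly_neq0 frac_decomp
  (And4 dD deta dpi dU) (And4 dD' deta' dpi' dU')).
Qed.

(** By uniqueness the residue selected by [xget] is [valresidue], whose value on symbols is
    explicit. *)
Lemma mwresidue_sym a : a != 0 -> mwresidue x pi (mwsym a) = mwint (pt_val a) (pt_ang a).
Proof.
move=> a0; rewrite (is_mwresidue_uniq mwresidueP pt_residueP).
exact: (valresidue_sym pt_angular a0).
Qed.

End LocalRing.

(** * Isometry classes and Witt cancellation *)

Section Presented.
Variables (X : choiceType) (R : {freeg X / int} -> Prop).

Lemma pi_presentedB (r s : {freeg X / int}) :
  \pi_(presented R)%qT (r - s) = \pi_(presented R)%qT r - \pi_(presented R)%qT s.
Proof. exact: raddfB. Qed.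

Lemma presented_ind (P : presented R -> Prop) :
    P 0 -> (forall x, P (pgen R x)) -> (forall z w, P z -> P w -> P (z - w)) ->
  forall z, P z.
Proof.
move=> P0 Pg PB.
have PN z : P z -> P (- z) by move=> Pz; rewrite -sub0r; exact: PB.
have PD z w : P z -> P w -> P (z + w) by move=> Pz Pw; rewrite -[w]opprK; apply/PB/PN.
have Pn x (n : nat) : P (pgen R x *+ n).
  by elim: n => [|n IH]; rewrite ?mulr0n // mulrS; exact: PD.
move=> z; rewrite -(reprK z) -(freeg_sumE (repr z)).
elim: (dom _) => [|x s IH]; first by rewrite big_nil raddf0.
rewrite big_cons raddfD; apply: PD => //.
have -> : << coeff x (repr z) *g x >> = << x >> *~ coeff x (repr z) :> {freeg X / int}.
  by rewrite freegU_mulz; congr (<< _ *g _ >>); lia.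
case: (coeff _ _) => n.
  by rewrite -pmulrn raddfMn; exact: Pn.
by rewrite NegzE mulrNz -pmulrn raddfN raddfMn; apply/PN/Pn.
Qed.

Lemma pi_relator r : R r -> \pi_(presented R)%qT r = 0.
Proof.
move=> Rr; rewrite -(raddf0 \pi_(presented R)%qT).
by apply/eqP; rewrite -Quotient.idealrBE subr0; apply/asboolP/relator_spanR.
Qed.

End Presented.

Section Congruence.
Variable F : fieldType.

Definition sym_unit n (A : 'M[F]_n) := (A^T == A) && (A \in unitmx).

Definition mxcongr n (A B : 'M[F]_n) := exists2 P, P \in unitmx & A = P *m B *m P^T.

Lemma mxcongr_refl n (A : 'M_n) : mxcongr A A.
Proof. by exists 1%:M; rewrite ?unitmx1 // trmx1 mul1mx mulmx1. Qed.

Lemma mxcongr_sym n (A B : 'M_n) : mxcongr A B -> mxcongr B A.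
Proof.
move=> [P Pu ->]; exists (invmx P); first by rewrite unitmx_inv.
by rewrite trmx_inv -!mulmxA mulmxV ?unitmx_tr // mulmx1 mulKmx.
Qed.

Lemma mxcongr_trans n (A B C : 'M_n) : mxcongr A B -> mxcongr B C -> mxcongr A C.
Proof.
move=> [P Pu ->] [Q Qu ->]; exists (P *m Q); first by rewrite unitmx_mul Pu.
by rewrite trmx_mul !mulmxA.
Qed.

Lemma mxcongr_unit n (A B P : 'M_n) :
  A \in unitmx -> A = P *m B *m P^T -> mxcongr A B.
Proof.
by move=> Au e; exists P => //; move: Au; rewrite e !unitmx_mul => /andP[/andP[]].
Qed.

Lemma mxcongr_block m n (A A' : 'M_m) (B B' : 'M_n) :
  mxcongr A A' -> mxcongr B B' -> mxcongr (block_mx A 0 0 B) (block_mx A' 0 0 B').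
Proof.
move=> [P Pu ->] [Q Qu ->]; exists (block_mx P 0 0 Q).
  by rewrite unitmxE det_ublock unitrM -!unitmxE Pu.
by rewrite tr_block_mx !trmx0 !mulmx_block !(mulmx0, mul0mx, addr0, add0r).
Qed.

Lemma mxcongr_sym_unit n (A B : 'M_n) : mxcongr A B -> sym_unit A -> sym_unit B.
Proof.
move=> /mxcongr_sym[P Pu ->] /andP[/eqP sA Au]; apply/andP; split.
  by rewrite !trmx_mul trmxK sA mulmxA.
by rewrite !unitmx_mul Pu Au unitmx_tr.
Qed.

Lemma sym_unit_block m n (A : 'M_m) (B : 'M_n) :
  sym_unit (block_mx A 0 0 B) = sym_unit A && sym_unit B.
Proof.
rewrite /sym_unit tr_block_mx !trmx0 unitmxE det_ublock unitrM -!unitmxE.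
rewrite [RHS]andbACA; congr (_ && _).
apply/eqP/andP => [/eq_block_mx[-> _ _ ->]|[/eqP-> /eqP->]] //.
Qed.

Lemma sym_unit_scalar a : sym_unit (a%:M : 'M_1) = (a != 0).
Proof. by rewrite /sym_unit tr_scalar_mx eqxx unitmxE det_scalar1 unitfE. Qed.

Hypothesis char2 : 2 != 0 :> F.

(** Polarization: if every v A v^T vanished, then so would 2 v A w^T, hence A, against its
    invertibility in positive size. *)
Lemma sym_unit_anisotropic n (A : 'M_n.+1) : sym_unit A ->
  exists v : 'rV_n.+1, v *m A *m v^T != 0.
Proof.
move=> /andP[/eqP sA Au]; apply: contrapT => noV.
have A0 (v : 'rV_n.+1) : v *m A *m v^T = 0.
  by apply/eqP; apply: contrapT => /negP vA; apply: noV; exists v.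
have b0 (v w : 'rV_n.+1) : v *m A *m w^T = 0.
  have := A0 (v + w); rewrite linearD /= !mulmxDl !mulmxDr !A0 add0r addr0.
  have -> : w *m A *m v^T = v *m A *m w^T.
    have <- : (w *m A *m v^T)^T = v *m A *m w^T.
      by rewrite !trmx_mul trmxK sA mulmxA.
    by rewrite [in RHS](mx11_scalar (w *m A *m v^T)) tr_scalar_mx -mx11_scalar.
  by rewrite -mulr2n -scaler_nat => /eqP; rewrite scaler_eq0 (negPf char2) => /eqP.
have : A = 0.
  apply/matrixP => i j; rewrite mxE.
  have := congr1 (fun M : 'M_1 => M 0 0) (b0 (delta_mx 0 i) (delta_mx 0 j)).
  by rewrite -rowE trmx_delta -colE !mxE.
by move=> Az; move: Au; rewrite Az unitmxE det0 unitr0.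
Qed.

Lemma gram_entry m n (P : 'M[F]_(m, n)) (A : 'M_n) i j :
  (P *m A *m P^T) i j = (row i P *m A *m (row j P)^T) 0 0.
Proof. by rewrite -row_mul !mxE; apply: eq_bigr => l _; rewrite !mxE. Qed.

Lemma mxcongr_split n (A : 'M_(1 + n)) : sym_unit A ->
  exists a (B : 'M_n), mxcongr A (block_mx a%:M 0 0 B).
Proof.
move=> sA; have [v vA] := @sym_unit_anisotropic n A sA.
(* Completes v to a basis: the first row of this invertible matrix is proportional to v. *)
pose P := row_ebase v; have Pu : P \in unitmx by exact: row_ebase_unit.
have v0 : v != 0 by apply: contraNneq vA => ->; rewrite !mul0mx.
pose c := (col_ebase v) 0 0.
have vE : v = c *: row 0 P.
  rewrite -[LHS]mulmx_ebase rank_rV v0 [col_ebase v]mx11_scalar -/c.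
  rewrite -mulmxA mul_scalar_mx; congr (_ *: _).
  rewrite rowE; congr (_ *m _); apply/matrixP => i j; rewrite !mxE !ord1 /=.
  by rewrite andbT eq_sym.
pose A' := P *m A *m P^T.
have AA' : mxcongr A A' by apply: mxcongr_sym; exists P.
have sA' : sym_unit A' := mxcongr_sym_unit AA' sA.
have [sA't _] := andP sA'.
pose a := A' 0 0; pose r := ursubmx (A' : 'M_(1 + n)).
have a0 : a != 0.
  apply: contraNneq vA => a0; rewrite vE linearZ /= -scalemxAl -scalemxAr -scalemxAl.
  have -> : row 0 P *m A *m (row 0 P)^T = 0.
    apply/matrixP => i j; rewrite !ord1 -gram_entry -/A' [RHS]mxE; exact: a0.
  by rewrite !scaler0.
have ulE : ulsubmx (A' : 'M_(1 + n)) = a%:M.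
  have l0 : lshift n 0 = 0 :> 'I_(1 + n) by apply/val_inj.
  by rewrite [LHS]mx11_scalar /a; congr (_%:M); rewrite !mxE l0.
have dlE : dlsubmx (A' : 'M_(1 + n)) = r^T by rewrite /r trmx_ursub (eqP sA't).
have [B A'E] : exists B, A' = block_mx a%:M r r^T B.
  by exists (drsubmx (A' : 'M_(1 + n))); rewrite -ulE -dlE submxK.
(* Projects the other basis vectors to the orthogonal complement of the first one, whose norm [a] is
   nonzero. *)
pose L : 'M_(1 + n) := block_mx 1%:M 0 (- (a^-1 *: r^T)) 1%:M.
exists a, (B - a^-1 *: (r^T *m r)).
apply: (mxcongr_trans AA'); apply: mxcongr_sym; exists L.
  by rewrite unitmxE det_lblock !det1 mulr1 unitr1.
rewrite A'E /L tr_block_mx !mulmx_block.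
rewrite !(trmx1, trmx0, mul1mx, mulmx1, mul0mx, mulmx0, addr0, add0r).
have -> : (- (a^-1 *: r^T))^T = - (a^-1 *: r) by rewrite linearN linearZ /= trmxK.
rewrite !mulNmx !mulmxN mul_scalar_mx -!scalemxAl mul_mx_scalar !scalerA.
by rewrite mulVf // mulfV // !scale1r !addNr mul0mx oppr0 add0r addrC.
Qed.

Lemma row_mx_neq0 n (a : F) (d : 'rV_n) : a != 0 -> (forall i, d 0 i != 0) ->
  forall i : 'I_(1 + n), row_mx a%:M d 0 i != 0.
Proof.
move=> a0 d0 i; case: (split_ordP i) => j ->; last by rewrite row_mxEr.
by rewrite row_mxEl !ord1 mxE.
Qed.

Lemma mxcongr_diag n (A : 'M[F]_n) : sym_unit A ->
  exists2 d : 'rV_n, mxcongr A (diag_mx d) & forall i, d 0 i != 0.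
Proof.
elim: n A => [|n IHn] A sA.
  exists 0; last by case.
  by rewrite (flatmx0 (diag_mx 0)) (flatmx0 A); exact: mxcongr_refl.
have [a [B AB]] := @mxcongr_split n A sA.
have := mxcongr_sym_unit AB sA; rewrite sym_unit_block sym_unit_scalar.
case/andP=> a0 /IHn[d Bd d0]; exists (row_mx a%:M d : 'rV_(1 + n)).
  rewrite -[n.+1]/(1 + n)%N diag_mx_row; apply: (mxcongr_trans AB).
  apply: mxcongr_block => //.
  suff -> : diag_mx a%:M = a%:M by exact: mxcongr_refl.
  by apply/matrixP => i j; rewrite !ord1 !mxE.
exact: row_mx_neq0.
Qed.

End Congruence.

Section WittCancellation.
Variable F : fieldType.
Hypothesis char2 : 2 != 0 :> F.

(** Vectors are rows and isometries act on the right: v is sent to v - 2 b(v,u)/b(u,u) u, where b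
    has Gram matrix [G]. *)
Definition reflection_mx n (G : 'M[F]_n) (u : 'rV_n) : 'M_n :=
  1%:M - (2 / (u *m G *m u^T) 0 0) *: (G *m u^T *m u).

Lemma reflection_mx_isom n (G : 'M[F]_n) (u : 'rV_n) : G^T = G ->
  (u *m G *m u^T) 0 0 != 0 ->
  reflection_mx G u *m G *m (reflection_mx G u)^T = G.
Proof.
move=> sG q0; rewrite /reflection_mx; set q := (_ *m u^T) 0 0 in q0 *.
have qE : u *m G *m u^T = q%:M by exact: mx11_scalar.
pose N := G *m u^T *m u *m G.
have N1 : G *m (G *m u^T *m u)^T = N by rewrite !trmx_mul trmxK sG !mulmxA.
have NN : G *m u^T *m u *m (G *m (G *m u^T *m u)^T) = q *: N.
  rewrite N1 /N -!mulmxA [u *m (G *m _)]mulmxA (mulmxA (u *m G)) qE mul_scalar_mx.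
  by rewrite -!scalemxAr.
move: N1 NN; rewrite -/N; set M := G *m u^T *m u => N1 NN.
have MG : M *m G = N by [].
have -> : (1%:M - (2 / q) *: M)^T = 1%:M - (2 / q) *: M^T.
  by rewrite [LHS]linearB /= [X in _ - X]linearZ /= trmx1.
rewrite mulmxBl mul1mx -scalemxAl MG mulmxBr mulmx1 -scalemxAr mulmxBl.
have NMt : N *m M^T = q *: N by rewrite -[LHS]mulmxA.
rewrite N1 -scalemxAl NMt scalerA divfK //.
have -> : N - 2 *: N = - N by rewrite scaler_nat mulr2n opprD addrA subrr add0r.
by rewrite scalerN opprK subrK.
Qed.

Lemma reflection_mx_swap n (G : 'M[F]_n) (v w : 'rV_n) : G^T = G ->
  v *m G *m v^T = w *m G *m w^T ->
  ((v - w) *m G *m (v - w)^T) 0 0 != 0 ->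
  v *m reflection_mx G (v - w) = w.
Proof.
move=> sG vw; rewrite /reflection_mx; set u := v - w; set q := (_ *m u^T) 0 0 => q0.
have wv : w *m G *m v^T = v *m G *m w^T.
  have <- : (w *m G *m v^T)^T = v *m G *m w^T by rewrite !trmx_mul trmxK sG mulmxA.
  by rewrite [in RHS](mx11_scalar (w *m G *m v^T)) tr_scalar_mx -mx11_scalar.
have qE : u *m G *m u^T = 2 *: (v *m G *m u^T).
  rewrite /u linearB /= !mulmxBl !mulmxBr wv -vw opprB scaler_nat mulr2n.
  by rewrite addrACA.
rewrite mulmxBr mulmx1 -scalemxAr !mulmxA.
have -> : v *m G *m u^T = (q / 2)%:M.
  apply: (scalerI char2); rewrite -qE [LHS]mx11_scalar -/q scale_scalar_mx.
  by rewrite mulrC divfK.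
rewrite mul_scalar_mx scalerA.
have -> : 2 / q * (q / 2) = 1 by field; rewrite q0 char2.
by rewrite scale1r /u opprB addrC subrK.
Qed.

(** The isometry P moves the first vector e to a vector w of the same norm a. Composing with a
    reflection that brings w back to e or -e gives an isometry preserving the line of e. It is then
    block diagonal, and its lower block relates A to B. *)
Lemma witt_cancel n (a : F) (A B : 'M_n) : a != 0 -> B^T = B -> A \in unitmx ->
  mxcongr (block_mx a%:M 0 0 A : 'M_(1 + n)) (block_mx a%:M 0 0 B) -> mxcongr A B.
Proof.
move=> a0 sB Au [P Pu AB]; pose G : 'M_(1 + n) := block_mx a%:M 0 0 B.
have sG : G^T = G by rewrite /G tr_block_mx sB !trmx0 tr_scalar_mx.
pose e : 'rV[F]_(1 + n) := row_mx 1%:M 0; pose w := e *m P.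
have eG : e *m G *m e^T = a%:M.
  rewrite /e /G mul_row_block tr_row_mx trmx1 trmx0 mul_row_col !mul1mx.
  by rewrite !mul0mx !mulmx0 !mulmx1 !addr0.
have wG : w *m G *m w^T = a%:M.
  rewrite /w trmx_mul mulmxA -(mulmxA e) -(mulmxA e) -/G -AB.
  rewrite /e mul_row_block tr_row_mx trmx1 trmx0 mul_row_col !mul1mx.
  by rewrite !mul0mx !mulmx0 !mulmx1 !addr0.
have [S [sgn [SG wS sgn2]]] : exists S (sgn : F),
    [/\ S *m G *m S^T = G, w *m S = sgn *: e & sgn != 0].
  (* One of w - e and w + e is anisotropic, since their norms sum to 4a, which is nonzero. *)
  have [q0|q0] := eqVneq (((w - e) *m G *m (w - e)^T) 0 0) 0; last first.
    exists (reflection_mx G (w - e)), 1.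
    rewrite reflection_mx_isom // reflection_mx_swap ?wG ?eG // scale1r oner_eq0.
    by split.
  have q1 : ((w - - e) *m G *m (w - - e)^T) 0 0 != 0.
    rewrite opprK; apply: contraNneq a0 => q1.
    have : ((w - e) *m G *m (w - e)^T) 0 0 + ((w + e) *m G *m (w + e)^T) 0 0 = 4 * a.
      have -> : (w - e)^T = w^T - e^T by rewrite linearB.
      have -> : (w + e)^T = w^T + e^T by rewrite linearD.
      rewrite !mulmxBl !mulmxBr !mulmxDl !mulmxDr wG eG.
      move: (w *m G *m e^T) (e *m G *m w^T) => X Y.
      by rewrite !mxE /= !mulr1n; ring.
    rewrite q0 q1 addr0 => /esym/eqP; rewrite mulf_eq0 => /orP[|/eqP->//].
    by rewrite (natrM F 2 2) mulf_eq0 (negPf char2).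
  exists (reflection_mx G (w - - e)), (-1).
  rewrite reflection_mx_isom // reflection_mx_swap ?scaleN1r //.
    by rewrite oppr_eq0 oner_eq0.
  by rewrite wG linearN /= !mulNmx !mulmxN opprK eG.
pose T := P *m S.
have TG : T *m G *m T^T = block_mx a%:M 0 0 A.
  by rewrite /T trmx_mul mulmxA -!(mulmxA P) SG mulmxA -AB.
have eT : e *m T = sgn *: e by rewrite /T mulmxA.
have TE : T = block_mx (ulsubmx T) (ursubmx T) (dlsubmx T) (drsubmx T) by rewrite submxK.
have [ulT urT] : ulsubmx T = sgn%:M /\ ursubmx T = 0.
  move: eT; rewrite {1}TE /e mul_row_block !mul1mx !mul0mx !addr0 scale_row_mx scaler0.
  by rewrite scale_scalar_mx mulr1 => /eq_row_mx.
move: TG; rewrite TE ulT urT /G tr_block_mx !mulmx_block.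
rewrite !(mul0mx, mulmx0, addr0, add0r, trmx0) => /eq_block_mx[_ _ dl dr].
have dlT0 : dlsubmx T = 0.
  move: dl; rewrite tr_scalar_mx !mul_mx_scalar scalerA => /eqP.
  by rewrite scaler_eq0 mulf_eq0 (negPf a0) (negPf sgn2) => /eqP.
move: dr; rewrite dlT0 !mul0mx add0r => /esym dr; exact: mxcongr_unit Au dr.
Qed.

End WittCancellation.

(** * Classes in the Grothendieck-Witt group *)

Section GWClass.
Variable F : fieldType.

Lemma symform_ofE m (A : 'M[F]_m) : sym_unit A ->
  exists2 p, symform_of A = Some p & val p = Tagged (fun m => 'M[F]_m) A.
Proof.
move=> sA; rewrite /symform_of; case: insubP => [p _ pA|]; first by exists p.
by case/negP.
Qed.

Lemma gwclass_nonsym m (A : 'M[F]_m) : ~~ sym_unit A -> gwclass A = 0.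
Proof. by move=> sA; rewrite /gwclass /symform_of insubN. Qed.

Lemma gwclass_val (p : symform F) : gwclass (tagged (val p)) = pgen _ p.
Proof.
rewrite /gwclass; case: p => [[m A] /= sA]; rewrite /symform_of.
by rewrite insubT /=; congr (pgen _ _); apply: val_inj.
Qed.

Lemma sym_unit_val (p : symform F) : sym_unit (tagged (val p)).
Proof. exact: (valP p). Qed.

Lemma gwclass_congr m (A B : 'M[F]_m) : mxcongr A B -> gwclass A = gwclass B.
Proof.
move=> AB; have [sA|nA] := boolP (sym_unit A); last first.
  rewrite !gwclass_nonsym //; apply: contraNN nA => sB.
  exact: mxcongr_sym_unit (mxcongr_sym AB) sB.
have sB := mxcongr_sym_unit AB sA; case: AB => P Pu AB.
have [p pA _] := symform_ofE sA; have [q qB _] := symform_ofE sB.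
rewrite /gwclass pA qB /= /pgen; apply/eqP; rewrite -subr_eq0 -pi_presentedB.
by rewrite (pi_relator (gw_relator_isom Pu AB pA qB)).
Qed.

Lemma gwclass_block m n (A : 'M[F]_m) (B : 'M[F]_n) : sym_unit A -> sym_unit B ->
  gwclass (block_mx A 0 0 B) = gwclass A + gwclass B.
Proof.
move=> sA sB; have sAB : sym_unit (block_mx A 0 0 B) by rewrite sym_unit_block sA.
have [p pA _] := symform_ofE sA; have [q qB _] := symform_ofE sB.
have [r rAB _] := symform_ofE sAB.
rewrite /gwclass pA qB rAB /= /pgen; apply/eqP; rewrite -subr_eq0 opprD addrA.
by rewrite -!pi_presentedB (pi_relator (gw_relator_sum pA qB rAB)).
Qed.

(** [P] is rectangular because [m] and [n] need not be definitionally equal. *)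
Lemma gwclass_rect m n (A : 'M[F]_m) (B : 'M[F]_n) (P : 'M_(m, n)) (Q : 'M_(n, m)) :
  P *m Q = 1%:M -> Q *m P = 1%:M -> A = P *m B *m P^T -> gwclass A = gwclass B.
Proof.
move=> PQ QP AB; have mn : m = n.
  by apply/eqP; rewrite eqn_leq (mulmx1_min PQ) (mulmx1_min QP).
case: n / mn in B P Q PQ QP AB *; apply: gwclass_congr; exists P => //.
by have [] := mulmx1_unit PQ.
Qed.

(** The empty form is its own orthogonal double, so its class z satisfies z = z + z. *)
Lemma gwclass0 (A : 'M[F]_0) : gwclass A = 0.
Proof.
have sA : sym_unit A.
  by rewrite /sym_unit unitmxE det_mx00 unitr1 andbT; apply/eqP/matrixP; case.
have := gwclass_block sA sA; rewrite (_ : gwclass (block_mx A 0 0 A) = gwclass A).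
  by move=> e; apply: (addrI (gwclass A)); rewrite addr0 -e.
by congr gwclass; apply/matrixP; case.
Qed.

Lemma GW_ind (P : GW F -> Prop) :
    (forall m (A : 'M[F]_m), sym_unit A -> P (gwclass A)) ->
    (forall z w, P z -> P w -> P (z - w)) ->
  forall z, P z.
Proof.
move=> PA PB; apply: presented_ind => //.
  have s0 : sym_unit (1%:M : 'M[F]_0).
    by rewrite /sym_unit trmx1 eqxx unitmx1.
  by rewrite -(gwclass0 1%:M); exact: PA.
by move=> p; rewrite -gwclass_val; apply: PA; exact: sym_unit_val.
Qed.

Section Lift.
Variables (M : zmodType) (f : forall m, 'M[F]_m -> M).
Hypotheses
  (f_congr : forall m (A B : 'M[F]_m), sym_unit A -> mxcongr A B -> f A = f B)
  (f_block : forall m n (A : 'M[F]_m) (B : 'M[F]_n), sym_unit A -> sym_unit B ->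
     f (block_mx A 0 0 B) = f A + f B).

Definition gwlift : GW F -> M := plift (fun p : symform F => f (tagged (val p))).

Let gw_relator0 r : gw_relator r ->
  fglift ((fun p : symform F => f (tagged (val p))) : _ -> zmodule M) r = 0.
Proof.
have ofE m (A : 'M[F]_m) p : symform_of A = Some p ->
    sym_unit A /\ f (tagged (val p)) = f A.
  by rewrite /symform_of; case: insubP => // q sA qA [<-]; split=> //; rewrite qA.
have gB : {morph fglift ((fun p : symform F => f (tagged (val p))) : _ -> zmodule M)
    : r s / r - s} by exact: lift_is_additive.
case=> [m A B P p q Pu AB /ofE[sA pA] /ofE[sB qB]|m n A B p q s].
  rewrite gB !liftU !scale1r pA qB (f_congr (B := B)) ?subrr //.
  by exists P.
move=> /ofE[sA pA] /ofE[sB qB] /ofE[sC rC]; rewrite !gB !liftU !scale1r pA qB rC.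
by rewrite f_block // -addrA -opprD subrr.
Qed.

Lemma gwliftB : zmod_morphism gwlift.
Proof. exact: plift_is_zmod_morphism gw_relator0. Qed.

Lemma gwlift_class m (A : 'M[F]_m) : sym_unit A -> gwlift (gwclass A) = f A.
Proof.
move=> sA; have [p pA pE] := symform_ofE sA.
by rewrite /gwclass pA /= /gwlift (plift_gen gw_relator0) pE.
Qed.

End Lift.

Definition gwhyp : GW F := gwclass (1%:M : 'M_1) + gwclass ((-1)%:M : 'M_1).

End GWClass.

(** * The isomorphism of K^MW_0 with the Grothendieck-Witt group *)

Section Diagonal.
Variable F : fieldType.
Hypothesis char2 : 2 != 0 :> F.

Definition mwdiag n (d : 'rV[F]_n) : KMWdeg F 0 := \sum_i mwform0 (d 0 i).

Lemma mwdiag_row n (a : F) (d : 'rV_n) :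
  mwdiag (row_mx a%:M d : 'rV_(1 + n)) = mwform0 a + mwdiag d.
Proof.
rewrite /mwdiag big_split_ord big_ord1 /= row_mxEl mxE mulr1n; congr (_ + _).
by apply: eq_bigr => i _; rewrite row_mxEr.
Qed.

Lemma diag_mx_row1 n (a : F) (d : 'rV_n) :
  diag_mx (row_mx a%:M d : 'rV_(1 + n)) = block_mx a%:M 0 0 (diag_mx d).
Proof.
rewrite diag_mx_row; congr block_mx.
by apply/matrixP => i j; rewrite !ord1 !mxE.
Qed.

Lemma rV_split n (d : 'rV[F]_(1 + n)) : d = row_mx (d 0 0)%:M (rsubmx d).
Proof.
rewrite -[LHS]hsubmxK; congr row_mx; rewrite [LHS]mx11_scalar !mxE.
by congr (d _ _)%:M; apply/val_inj.
Qed.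

Lemma mwform0_sqr (a b : F) : a != 0 -> b != 0 -> mwform0 (a * (b * b)) = mwform0 a.
Proof. by move=> a0 b0; apply/val_inj; exact: mwformMsqr. Qed.

Lemma mwform0_add (a b : F) : a != 0 -> b != 0 -> a + b != 0 ->
  mwform0 a + mwform0 b = mwform0 (a + b) + mwform0 (a * b * (a + b)).
Proof. by move=> a0 b0 ab0; apply/val_inj; exact: mwform_add. Qed.

Lemma mxcongr_binary (a s w : F) : a * (w * w) + s != 0 -> a != 0 -> s != 0 ->
  mxcongr (block_mx (a * (w * w) + s)%:M 0 0 (a * s * (a * (w * w) + s))%:M
             : 'M_(1 + 1))
          (block_mx a%:M 0 0 s%:M).
Proof.
move=> b0 a0 s0; set b := _ + s in b0 *.
have su : sym_unit (block_mx b%:M 0 0 (a * s * b)%:M : 'M_(1 + 1)).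
  by rewrite !sym_unit_block !sym_unit_scalar b0 !mulf_neq0.
have [_ u] := andP su.
(* The first row (w, 1) has norm a w^2 + s; the second row (-s, a w) spans its orthogonal complement
   for the form <a> + <s>. *)
apply: (mxcongr_unit (P := block_mx w%:M 1%:M (- s)%:M (a * w)%:M)) u _.
rewrite !tr_block_mx !mulmx_block !tr_scalar_mx ?(mul0mx, mulmx0, addr0, add0r).
rewrite -!scalar_mxM -!raddfD /= /b.
congr block_mx; first by congr (_%:M); ring.
- by rewrite -[LHS](raddf0 (@scalar_mx F 1)); congr (_%:M); ring.
- by rewrite -[LHS](raddf0 (@scalar_mx F 1)); congr (_%:M); ring.
- by congr (_%:M); ring.
Qed.

Lemma mxcongr_blockA n (p q a s : F) (B : 'M[F]_n) :
  mxcongr (block_mx p%:M 0 0 q%:M : 'M_(1 + 1)) (block_mx a%:M 0 0 s%:M) ->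
  mxcongr (block_mx p%:M 0 0 (block_mx q%:M 0 0 B) : 'M_(1 + (1 + n)))
          (block_mx a%:M 0 0 (block_mx s%:M 0 0 B)).
Proof.
move=> pq; have := mxcongr_block pq (mxcongr_refl B).
have E (x y : F) : (block_mx x%:M 0 0 (block_mx y%:M 0 0 B) : 'M_(1 + (1 + n))) =
    (block_mx (block_mx x%:M 0 0 y%:M : 'M_(1 + 1)) 0 0 B : 'M_(1 + 1 + n)) :> 'M_(n.+2).
  have := @block_mxA F 1 1 n 1 1 n x%:M 0 0 0 y%:M 0 0 0 B.
  rewrite /= !row_mx0 !col_mx0 => ->; apply/matrixP => i j; rewrite castmxE.
  by congr (fun_of_matrix _ _ _); apply/val_inj.
by move=> e; rewrite -[mxcongr _ _]/(@mxcongr F n.+2 _ _) !E.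
Qed.

Lemma diag_mx_neq0_sym_unit n (d : 'rV[F]_n) : (forall i, d 0 i != 0) ->
  sym_unit (diag_mx d).
Proof.
move=> d0; rewrite /sym_unit tr_diag_mx eqxx unitmxE det_diag.
by rewrite rpred_prod // => i _; rewrite unitfE.
Qed.

Lemma diag_quad n (d w : 'rV[F]_n) :
  (w *m diag_mx d *m w^T) 0 0 = \sum_i d 0 i * (w 0 i * w 0 i).
Proof.
rewrite mxE; apply: eq_bigr => i _; rewrite !mxE mulrC.
rewrite (bigD1 i) //= big1 ?addr0 => [|j ji].
  by rewrite mxE eqxx mulr1n mulrCA mulrA mulrC !mulrA.
by rewrite mxE (negPf ji) mulr0n mulr0.
Qed.

Lemma diag_rep n (c w : 'rV[F]_(1 + n)) : (forall i, c 0 i != 0) ->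
  let b := \sum_i c 0 i * (w 0 i * w 0 i) in b != 0 ->
  exists c' : 'rV[F]_n,
    [/\ forall i, c' 0 i != 0,
        mxcongr (block_mx b%:M 0 0 (diag_mx c') : 'M_(1 + n)) (diag_mx c)
      & mwdiag c = mwform0 b + mwdiag c'].
Proof.
elim: n c w => [|n IHn] c w c0 b b0.
all: pose a := c 0 0; pose cr := rsubmx c; pose v := w 0 0; pose wr := rsubmx w.
all: have cE : c = row_mx a%:M cr by exact: rV_split.
all: have wE : w = row_mx v%:M wr by exact: rV_split.
all: pose s := \sum_i cr 0 i * (wr 0 i * wr 0 i).
all: have bE : b = a * (v * v) + s.
1,3: rewrite /b cE wE big_split_ord big_ord1 /= !row_mxEl !mxE !mulr1n; congr (_ + _).
1,2: by apply: eq_bigr => i _; rewrite !row_mxEr.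
all: have a0 : a != 0 by exact: c0.
all: have cr0 i : cr 0 i != 0 by rewrite mxE c0.
all: rewrite cE diag_mx_row1 mwdiag_row.
all: have [s0|s0] := eqVneq s 0.
2: by move: s0; rewrite /s big_ord0 eqxx.
1,2: have v0 : v != 0 by apply: contraNneq b0 => v0; rewrite bE s0 v0 !mul0r mulr0 addr0.
1,2: exists cr; split=> //; last by rewrite bE s0 addr0 mwform0_sqr.
1,2: apply: mxcongr_block; last exact: mxcongr_refl.
1,2: exists v%:M; first by rewrite unitmxE det_scalar1 unitfE.
1,2: by rewrite tr_scalar_mx -!scalar_mxM bE s0 addr0; congr (_%:M); ring.
have [c' [c'0 c'E Kc]] := IHn cr wr cr0 s0.
exists (row_mx (a * s * b)%:M c' : 'rV_(1 + n)); split.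
- by apply: row_mx_neq0 => //; rewrite !mulf_neq0.
- rewrite diag_mx_row1; apply: mxcongr_trans (mxcongr_block (mxcongr_refl _) c'E).
  apply: mxcongr_blockA; rewrite bE; apply: mxcongr_binary => //; by rewrite -bE.
- rewrite Kc mwdiag_row !addrA; congr (_ + _).
  have [v0|v0] := eqVneq v 0.
    rewrite bE v0 !mul0r mulr0 add0r addrC -mulrA mwform0_sqr //.
  have av0 : a * (v * v) != 0 by rewrite !mulf_neq0.
  rewrite -(mwform0_sqr a0 v0) mwform0_add // -?bE //; congr (_ + _).
  rewrite -(mwform0_sqr (a := a * s * b) (b := v)) ?mulf_neq0 //; congr mwform0; rewrite -/s; ring.
Qed.

(** The first entry of d is a value of the form c, attained at the first row of P, so [diag_rep]
    splits it off from c. Witt cancellation makes the remaining diagonal forms congruent, and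
    induction applies. *)
Lemma mwdiag_congr n (c d : 'rV[F]_n) : (forall i, c 0 i != 0) ->
  (forall i, d 0 i != 0) -> mxcongr (diag_mx d) (diag_mx c) -> mwdiag d = mwdiag c.
Proof.
elim: n c d => [|n IHn] c d c0 d0 dc; first by rewrite /mwdiag !big_ord0.
have [P Pu dE] := dc; pose w := row 0 P.
have wE : \sum_i c 0 i * (w 0 i * w 0 i) = d 0 0.
  by rewrite -diag_quad -gram_entry -dE mxE eqxx.
have := @diag_rep n c w c0; rewrite wE => /(_ (d0 0))[c' [c'0 c'E ->]].
have dS : d = row_mx (d 0 0)%:M (rsubmx (d : 'rV_(1 + n))) by exact: (@rV_split n).
set d' := rsubmx _ in dS.
have d'0 i : d' 0 i != 0 by rewrite mxE d0.
rewrite [in LHS]dS mwdiag_row; congr (_ + _); apply: IHn => //.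
have /andP[_ d'u] := diag_mx_neq0_sym_unit d'0.
have /andP[/eqP sc' _] := diag_mx_neq0_sym_unit c'0.
apply: (witt_cancel char2 (d0 0) sc' d'u).
rewrite -diag_mx_row1 -dS; exact: mxcongr_trans dc (mxcongr_sym c'E).
Qed.

End Diagonal.

Section KMW0GW.
Variable F : fieldType.
Hypothesis char2 : 2 != 0 :> F.

Lemma gwclass_diag n (d : 'rV[F]_n) : (forall i, d 0 i != 0) ->
  gwclass (diag_mx d) = \sum_i gwclass ((d 0 i)%:M : 'M_1).
Proof.
elim: n d => [|n IHn] d d0; first by rewrite gwclass0 big_ord0.
have dS : d = row_mx (d 0 0)%:M (rsubmx (d : 'rV_(1 + n))) by exact: (@rV_split _ n).
have d'0 i : rsubmx (d : 'rV_(1 + n)) 0 i != 0 by rewrite mxE d0.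
rewrite [in LHS]dS -[n.+1]/(1 + n)%N diag_mx_row1.
rewrite gwclass_block ?sym_unit_scalar ?diag_mx_neq0_sym_unit // big_ord_recl.
congr (_ + _); rewrite IHn //; apply: eq_bigr => i _; rewrite mxE.
by congr (gwclass (fun_of_matrix d _ _)%:M); apply/val_inj.
Qed.

Lemma gw_gen_ind (P : GW F -> Prop) :
    (forall a, a != 0 -> P (gwclass (a%:M : 'M_1))) ->
    (forall z w, P z -> P w -> P (z - w)) ->
  forall z, P z.
Proof.
move=> Pf PB; have P0 : P 0.
  by rewrite -(subrr (gwclass (1%:M : 'M_1))); apply: PB; exact: Pf (oner_neq0 _).
have PD z w : P z -> P w -> P (z + w).
  by move=> Pz Pw; rewrite -[w]opprK -[- w]sub0r; apply/PB => //; exact: PB.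
apply: GW_ind => // m A sA; have [d Ad d0] := mxcongr_diag char2 sA.
by rewrite (gwclass_congr Ad) gwclass_diag //; elim/big_ind: _ => // i _; exact: Pf.
Qed.

Lemma sym_unit_scale n (a : F) (A : 'M_n) : a != 0 -> sym_unit A -> sym_unit (a *: A).
Proof.
move=> a0 /andP[/eqP sA Au]; apply/andP; split; first by rewrite linearZ /= sA.
by rewrite unitmxE detZ unitrM -unitmxE Au andbT unitrX // unitfE.
Qed.

Lemma mxcongr_scale n (a : F) (A B : 'M_n) : mxcongr A B -> mxcongr (a *: A) (a *: B).
Proof. by case=> P Pu ->; exists P => //; rewrite -scalemxAr -scalemxAl. Qed.

Definition gwscale (a : F) : GW F -> GW F := gwlift (fun m (A : 'M_m) => gwclass (a *: A)).

Let scale_congr (a : F) m (A B : 'M_m) : sym_unit A -> mxcongr A B ->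
  gwclass (a *: A) = gwclass (a *: B).
Proof. by move=> _ AB; apply/gwclass_congr/mxcongr_scale. Qed.

Let scale_block (a : F) (a0 : a != 0) m n (A : 'M_m) (B : 'M_n) :
  sym_unit A -> sym_unit B ->
  gwclass (a *: block_mx A 0 0 B) = gwclass (a *: A) + gwclass (a *: B).
Proof.
by move=> sA sB; rewrite scale_block_mx !scaler0 gwclass_block // sym_unit_scale.
Qed.

Lemma gwscaleB a : a != 0 -> zmod_morphism (gwscale a).
Proof. by move=> a0; apply: gwliftB; [exact: scale_congr|exact: scale_block]. Qed.

Lemma gwscale_class a m (A : 'M_m) : a != 0 -> sym_unit A ->
  gwscale a (gwclass A) = gwclass (a *: A).
Proof.
by move=> a0; apply: gwlift_class; [exact: scale_congr|exact: scale_block].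
Qed.

Definition gwrank : GW F -> int := gwlift (fun m (_ : 'M[F]_m) => m%:Z).

Let rank_congr m (A B : 'M[F]_m) : sym_unit A -> mxcongr A B -> m%:Z = m%:Z.
Proof. by []. Qed.

Let rank_block m n (A : 'M[F]_m) (B : 'M[F]_n) : sym_unit A -> sym_unit B ->
  (m + n)%N%:Z = m%:Z + n%:Z.
Proof. by rewrite PoszD. Qed.

Lemma gwrankB : zmod_morphism gwrank.
Proof. by apply: gwliftB; [exact: rank_congr|exact: rank_block]. Qed.

Lemma gwrank_class m (A : 'M_m) : sym_unit A -> gwrank (gwclass A) = m%:Z.
Proof. by apply: gwlift_class; [exact: rank_congr|exact: rank_block]. Qed.

HB.instance Definition _ := GRing.isZmodMorphism.Build (GW F) int gwrank gwrankB.

Lemma gwscaleM a b z : a != 0 -> b != 0 -> gwscale a (gwscale b z) = gwscale (a * b) z.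
Proof.
move=> a0 b0; have ab0 : a * b != 0 by rewrite mulf_neq0.
elim/GW_ind: z => [m A sA|z w IHz IHw]; last by rewrite !gwscaleB // IHz IHw.
by rewrite !gwscale_class ?sym_unit_scale // scalerA.
Qed.

Lemma gwclass_hyp (a : F) : a != 0 ->
  gwclass (a%:M : 'M_1) + gwclass ((- a)%:M : 'M_1) = gwhyp F.
Proof.
move=> a0; have N1 : -1 != 0 :> F by rewrite oppr_eq0 oner_eq0.
rewrite /gwhyp -!gwclass_block ?sym_unit_scalar ?oppr_eq0 ?oner_eq0 //.
have su : sym_unit (block_mx a%:M 0 0 (- a)%:M : 'M[F]_(1 + 1)).
  by rewrite sym_unit_block !sym_unit_scalar oppr_eq0 a0.
have [_ u] := andP su; apply: gwclass_congr.
(* Chosen so that p^2 - q^2 = a: for <1> + <-1> the vectors (p, q) and (q, p) are orthogonal of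
   norms a and -a. *)
pose p := (a + 1) / 2; pose q := (a - 1) / 2.
apply: (mxcongr_unit (P := block_mx p%:M q%:M q%:M p%:M)) u _.
rewrite tr_block_mx !mulmx_block !tr_scalar_mx ?(mul0mx, mulmx0, addr0, add0r).
rewrite -!scalar_mxM -!raddfD /= /p /q.
congr block_mx.
- by congr (_%:M); field; exact: char2.
- by rewrite -[LHS](raddf0 (@scalar_mx F 1)); congr (_%:M); field; exact: char2.
- by rewrite -[LHS](raddf0 (@scalar_mx F 1)); congr (_%:M); field; exact: char2.
- by congr (_%:M); field; exact: char2.
Qed.

Lemma gwclass_addN m (A : 'M[F]_m) : sym_unit A ->
  gwclass A + gwclass (- A) = gwhyp F *+ m.
Proof.
move=> sA; have [d Ad d0] := mxcongr_diag char2 sA.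
have N1 : -1 != 0 :> F by rewrite oppr_eq0 oner_eq0.
have AN : mxcongr (- A) (- diag_mx d).
  by rewrite -scaleN1r -[X in mxcongr _ X]scaleN1r; exact: mxcongr_scale.
rewrite (gwclass_congr Ad) (gwclass_congr AN).
have -> : - diag_mx d = diag_mx (- d) by rewrite linearN.
rewrite !gwclass_diag // => [|i]; last by rewrite mxE oppr_eq0.
rewrite -big_split /= -[in RHS](card_ord m) -sumr_const; apply: eq_bigr => i _.
rewrite mxE; have {d0} := d0 i; move: (d 0 i) => a a0.
exact: gwclass_hyp.
Qed.

Lemma gwclass_steinberg m (A : 'M[F]_m) (a : F) : a != 0 -> 1 - a != 0 ->
    sym_unit A ->
  gwclass A + gwclass ((a * (1 - a)) *: A) = gwclass (a *: A) + gwclass ((1 - a) *: A).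
Proof.
move=> a0 b0 sA; set b := 1 - a in b0 *.
have ab0 : a * b != 0 by rewrite mulf_neq0.
rewrite -!gwclass_block ?sym_unit_scale //.
have su : sym_unit (block_mx A 0 0 ((a * b) *: A)).
  by rewrite sym_unit_block sA sym_unit_scale.
have [_ u] := andP su; apply: gwclass_congr.
(* As a + b = 1, in <a> + <b> the vector (1, 1) has norm 1, and (-b, a) is orthogonal to it with
   norm ab. *)
apply: (mxcongr_unit (P := block_mx 1%:M 1%:M (- b)%:M a%:M)) u _.
rewrite tr_block_mx !mulmx_block !tr_scalar_mx ?(mul0mx, mulmx0, addr0, add0r).
rewrite !mul_scalar_mx !mul_mx_scalar !scale1r !scalerA -!scalerDl.
congr block_mx; rewrite /b.
- by rewrite -[LHS]scale1r; congr (_ *: _); ring.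
- by rewrite -[LHS](scale0r A); congr (_ *: _); ring.
- by rewrite -[LHS](scale0r A); congr (_ *: _); ring.
- by congr (_ *: _); ring.
Qed.

Lemma gwscale_steinberg (a : F) z : a != 0 -> 1 - a != 0 ->
  gwscale (a * (1 - a)) z + z = gwscale a z + gwscale (1 - a) z.
Proof.
move=> a0 b0; have ab0 : a * (1 - a) != 0 by rewrite mulf_neq0.
elim/GW_ind: z => [m A sA|z w IHz IHw].
  by rewrite !gwscale_class // addrC gwclass_steinberg.
by rewrite !gwscaleB // addrACA -opprD IHz IHw opprD addrACA.
Qed.

Definition gwhyp_pred : {pred (GW F * int)%type} :=
  fun p => `[< exists m : int, p = (gwhyp F *~ m, 0) >].

Lemma gwhyp_pred_zmod_closed : zmod_closed gwhyp_pred.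
Proof.
split=> [|p q /asboolP[m ->] /asboolP[n ->]]; apply/asboolP; first by exists 0.
by exists (m - n); rewrite mulrzBr; congr pair; rewrite /= subrr.
Qed.

HB.instance Definition _ := GRing.isZmodClosed.Build (GW F * int)%type gwhyp_pred
  gwhyp_pred_zmod_closed.

(** K^MW acts on GW x Z modulo the subgroup generated by (h, 0), which is W x Z:
    eta is 1 on the Witt group, and acts by zero on the ranks. *)
Definition gwsym (a : F) (p : GW F * int) : GW F * int :=
  if a == 0 then 0 else (gwscale a p.1 - p.1, 0).

Definition gweta (p : GW F * int) : GW F * int := (p.1, 0).

Lemma gwscale_hyp a : a != 0 -> gwscale a (gwhyp F) = gwhyp F.
Proof.
move=> a0; have N1 : -1 != 0 :> F by rewrite oppr_eq0 oner_eq0.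
have sD z w : gwscale a (z + w) = gwscale a z + gwscale a w.
  by apply: (@addIr _ (- gwscale a w)); rewrite -gwscaleB // !addrK.
rewrite /gwhyp sD !gwscale_class ?sym_unit_scalar ?oner_eq0 //.
by rewrite !scale_scalar_mx mulr1 mulrN1 gwclass_hyp.
Qed.

(** With [a] acting as <a> - 1, the product rule is the expansion of <a><b>, the Steinberg relation
    becomes <a> + <1 - a> = 1 + <a(1 - a)>, and eta h = 0 holds because z + <-1>z is a multiple of
    h. *)
Lemma gw_module : mw_module gwhyp_pred gwsym gweta.
Proof.
have pE (z : GW F) (H : exists m : int, z = gwhyp F *~ m) : (z, 0) \in gwhyp_pred.
  by case: H => m ->; apply/asboolP; exists m.
have H0 : (0 : GW F * int) \in gwhyp_pred by exact: rpred0.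
have sD a z w : a != 0 -> gwscale a (z + w) = gwscale a z + gwscale a w.
  by move=> a0; apply: (@addIr _ (- gwscale a w)); rewrite -gwscaleB // !addrK.
have sN a z : a != 0 -> gwscale a (- z) = - gwscale a z.
  by move=> a0; rewrite -[- z]sub0r gwscaleB // -[in X in X - _](subrr z) gwscaleB // subrr sub0r.
have sX a m : a != 0 -> gwscale a (gwhyp F *~ m) = gwhyp F *~ m.
  move=> a0; have sXn n : gwscale a (gwhyp F *+ n) = gwhyp F *+ n.
    elim: n => [|n IH]; first by rewrite mulr0n -[X in gwscale _ X](subrr 0) gwscaleB // subrr.
    by rewrite !mulrS sD // IH gwscale_hyp.
  by case: m => n; [exact: sXn|rewrite NegzE !mulrNz sN // -!pmulrn sXn].
split.
- move=> a p q; rewrite /gwsym; case: eqP => [_|/eqP a0]; first by rewrite subr0.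
  by congr pair; rewrite /= ?subr0 // gwscaleB // opprD addrACA -opprD.
- by move=> p q; congr pair; rewrite /= subr0.
- move=> a p /asboolP[m ->]; rewrite /gwsym; case: eqP => [//|/eqP a0] /=.
  by rewrite sX // subrr.
- by move=> p /asboolP[m ->]; apply: pE; exists m.
- by move=> p; rewrite /gwsym eqxx.
- move=> a p a0 a1; have b0 : 1 - a != 0 by rewrite subr_eq0 eq_sym.
  rewrite /gwsym (negPf a0) (negPf b0) /=; apply: pE; exists 0; rewrite mulr0z.
  rewrite gwscaleB // gwscaleM // opprB addrACA -opprD.
  by rewrite gwscale_steinberg // subrr.
- move=> a b p a0 b0; have ab0 : a * b != 0 by rewrite mulf_neq0.
  rewrite /gwsym (negPf a0) (negPf b0) (negPf ab0) /=.
  rewrite gwscaleB // gwscaleM //.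
  move: (gwscale (a * b) _) (gwscale a _) (gwscale b _) => s u v.
  rewrite (_ : _ - _ = 0) //; congr pair; rewrite /= ?addr0 ?subr0 //.
  by rewrite -(addrA (u - _)) (addrC (v - _)) subrK (addrC (u - _)) addrA subrK subrr.
- move=> a p a0; rewrite /gwsym (negPf a0) (_ : _ - _ = 0) //.
  by congr pair; rewrite /= ?subrr.
- move=> p; have N1 : -1 != 0 :> F by rewrite oppr_eq0 oner_eq0.
  rewrite /gwsym (negPf N1); apply: pE => /=; rewrite addrA subrK.
  elim/GW_ind: p.1 => [m A sA|z w [i zi] [j wj]].
    by exists m; rewrite gwscale_class // scaleN1r addrC gwclass_addN.
  by exists (i - j); rewrite gwscaleB // mulrzBr -zi -wj opprD addrACA.
Qed.

Local Notation act := (mwaction gwsym gweta).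
Local Notation base := (gwclass (1%:M : 'M[F]_1), 1 : int).

Let H_trans (x y z : GW F * int) :
  x - y \in gwhyp_pred -> y - z \in gwhyp_pred -> x - z \in gwhyp_pred.
Proof. by move=> xy yz; rewrite -(subrK y x) -addrA rpredD. Qed.

Lemma gw_module_form a : a != 0 ->
  act (mwform a) base - (gwclass (a%:M : 'M_1), 1) \in gwhyp_pred.
Proof.
move=> a0; have M := gw_module; rewrite mwformE.
apply: H_trans (mwactionDl M _ _ _) _.
have -> : (gwclass (a%:M : 'M_1), 1 : int) = base + gweta (gwsym a base).
  rewrite /gwsym (negPf a0) /gweta /=; congr pair; rewrite /= ?addr0 //.
  by rewrite gwscale_class ?sym_unit_scalar ?oner_neq0 // scale_scalar_mx mulr1 addrC subrK.
rewrite opprD addrACA rpredD //; first exact: mwaction1 M _.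
apply: H_trans (mwactionM M _ _ _) _; apply: H_trans (mwaction_eta M _) _.
rewrite -(mwm_etaB M); apply: (mwm_etaH M); exact: mwaction_sym M _ _.
Qed.

(** Since h has rank 2, the rank detects the multiple of h that is lost modulo (h, 0): a class is
    determined by its image in the Witt group and its rank. *)
Lemma gw_module_rank (w : GW F) (i : int) :
  (w, i) \in gwhyp_pred -> i = gwrank w -> w = 0.
Proof.
move=> /asboolP[m [-> ->]]; have N1 : -1 != 0 :> F by rewrite oppr_eq0 oner_eq0.
rewrite raddfMz /gwhyp raddfD /= !gwrank_class ?sym_unit_scalar ?oner_eq0 //.
by rewrite -mulr2n -mulrzr => /esym/eqP; rewrite mulf_eq0 /= intz => /eqP->.
Qed.

Lemma KMW0_to_GW_subproof (z : KMWdeg F 0) :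
  exists w : GW F, act (val z) base - (w, gwrank w) \in gwhyp_pred.
Proof.
elim/KMWdeg0_ind: z => [a a0|z w [u zu] [v wv]].
  exists (gwclass (a%:M : 'M_1)).
  by rewrite gwrank_class ?sym_unit_scalar //; exact: gw_module_form.
exists (u - v); have M := gw_module.
apply: H_trans (mwactionDl M _ _ _) _; rewrite raddfB.
have -> : (u - v, gwrank u - gwrank v) = (u, gwrank u) - (v, gwrank v) by [].
rewrite opprD addrACA rpredD //; apply: H_trans (mwactionNl M _ _) _.
by rewrite -opprD rpredN.
Qed.

(** The action on (<1>, 1) gives a Witt class together with an integer; this is the lift to GW whose
    rank is that integer, unique by [gw_module_rank]. *)
Definition KMW0_to_GW (z : KMWdeg F 0) : GW F := projT1 (cid (KMW0_to_GW_subproof z)).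

Lemma KMW0_to_GWP z w :
  act (val z) base - (w, gwrank w) \in gwhyp_pred -> KMW0_to_GW z = w.
Proof.
rewrite /KMW0_to_GW; case: cid => u /= zu zw; apply/eqP; rewrite -subr_eq0.
apply/eqP; apply: (@gw_module_rank _ (gwrank u - gwrank w)); last by rewrite raddfB.
have -> : (u - w, gwrank u - gwrank w) = (u, gwrank u) - (w, gwrank w) by [].
by apply: H_trans zw; rewrite -opprB rpredN.
Qed.

Lemma KMW0_to_GWB : zmod_morphism KMW0_to_GW.
Proof.
move=> z w; apply: KMW0_to_GWP; have M := gw_module.
rewrite /KMW0_to_GW; case: cid => u zu; case: cid => v wv /=.
apply: H_trans (mwactionDl M _ _ _) _; rewrite raddfB.
have -> : (u - v, gwrank u - gwrank v) = (u, gwrank u) - (v, gwrank v) by [].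
rewrite opprD addrACA rpredD //; apply: H_trans (mwactionNl M _ _) _.
by rewrite -opprD rpredN.
Qed.

Lemma KMW0_to_GW_form a : a != 0 -> KMW0_to_GW (mwform0 a) = gwclass (a%:M : 'M_1).
Proof.
move=> a0; apply: KMW0_to_GWP.
by rewrite gwrank_class ?sym_unit_scalar //; exact: gw_module_form.
Qed.

(** For symmetric invertible [A] a diagonalization exists, and by [mwdiag_congr] the choice does not
    matter. It induces the inverse of [KMW0_to_GW]. *)
Definition mwdiagonalization n (A : 'M[F]_n) : KMWdeg F 0 :=
  mwdiag (xget 0 [set d : 'rV_n | mxcongr A (diag_mx d) /\ forall i, d 0 i != 0]%classic).

Lemma mwdiagonalizationE n (A : 'M[F]_n) (d : 'rV_n) : mxcongr A (diag_mx d) ->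
  (forall i, d 0 i != 0) -> mwdiagonalization A = mwdiag d.
Proof.
move=> Ad d0; rewrite /mwdiagonalization; set e := xget _ _.
have [Ae e0] : mxcongr A (diag_mx e) /\ forall i, e 0 i != 0.
  by apply: (@xgetPex _ 0 [set d : 'rV_n | mxcongr A (diag_mx d) /\ _]%classic); exists d.
by apply: mwdiag_congr => //; exact: mxcongr_trans (mxcongr_sym Ae) Ad.
Qed.

Let diag_congr m (A B : 'M[F]_m) : sym_unit A -> mxcongr A B ->
  mwdiagonalization A = mwdiagonalization B.
Proof.
move=> sA AB; have [d Ad d0] := mxcongr_diag char2 sA.
rewrite (mwdiagonalizationE Ad d0) (mwdiagonalizationE _ d0) //.
exact: mxcongr_trans (mxcongr_sym AB) Ad.
Qed.

Let diag_block m n (A : 'M[F]_m) (B : 'M[F]_n) : sym_unit A -> sym_unit B ->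
  mwdiagonalization (block_mx A 0 0 B) = mwdiagonalization A + mwdiagonalization B.
Proof.
move=> sA sB; have [d Ad d0] := mxcongr_diag char2 sA.
have [e Be e0] := mxcongr_diag char2 sB.
rewrite (mwdiagonalizationE Ad d0) (mwdiagonalizationE Be e0).
rewrite (@mwdiagonalizationE _ _ (row_mx d e)).
- rewrite /mwdiag big_split_ord /=; congr (_ + _); apply: eq_bigr => i _.
    by rewrite row_mxEl.
  by rewrite row_mxEr.
- by rewrite diag_mx_row; exact: mxcongr_block.
- by move=> i; case: (split_ordP i) => j ->; rewrite ?row_mxEl ?row_mxEr.
Qed.

Definition GW_to_KMW0 : GW F -> KMWdeg F 0 := gwlift mwdiagonalization.

Lemma GW_to_KMW0_form a : a != 0 -> GW_to_KMW0 (gwclass (a%:M : 'M_1)) = mwform0 a.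
Proof.
move=> a0; rewrite /GW_to_KMW0 gwlift_class ?sym_unit_scalar //.
rewrite (@mwdiagonalizationE _ _ a%:M).
- by rewrite /mwdiag big_ord1 mxE.
- suff -> : diag_mx a%:M = a%:M :> 'M_1 by exact: mxcongr_refl.
  by apply/matrixP => i j; rewrite !ord1 !mxE.
- by move=> i; rewrite !ord1 mxE.
Qed.

Lemma GW_to_KMW0B : zmod_morphism GW_to_KMW0.
Proof. exact: gwliftB. Qed.

Lemma is_KMW0_GW_exists : exists f : KMWdeg F 0 -> GW F, is_KMW0_GW f.
Proof.
exists KMW0_to_GW; split; last exact: KMW0_to_GW_form.
  by move=> z w; apply: (@addIr _ (- KMW0_to_GW w)); rewrite -KMW0_to_GWB !addrK.
exists GW_to_KMW0 => [z|z].
  elim/KMWdeg0_ind: z => [a a0|z w IHz IHw].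
    by rewrite KMW0_to_GW_form // GW_to_KMW0_form.
  by rewrite KMW0_to_GWB GW_to_KMW0B IHz IHw.
elim/gw_gen_ind: z => [a a0|z w IHz IHw].
  by rewrite GW_to_KMW0_form // KMW0_to_GW_form.
by rewrite GW_to_KMW0B KMW0_to_GWB IHz IHw.
Qed.

Lemma KMW0_GWP : is_KMW0_GW (@KMW0_GW F).
Proof. exact: (@xgetPex _ (fun=> 0) _ is_KMW0_GW_exists). Qed.

End KMW0GW.

(** * Transfers and residue forms *)

Section TraceForm.
Variables (k : fieldType) (L : fieldExtType k).
Local Notation tr := (@field_trace k L).
Local Notation emb := (map_mx (in_alg L)).
Local Notation d := (\dim {:L}).
Local Notation beta := (vbasis {:L}).

Lemma field_trace_is_linear : linear_for *%R tr.
Proof.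
move=> a u v; rewrite /field_trace mulr_sumr -big_split; apply: eq_bigr => i _ /=.
by rewrite mulrDl -scalerAl linearP.
Qed.

HB.instance Definition _ := GRing.isLinear.Build k L k *%R tr field_trace_is_linear.

(** The trace of an endomorphism may be read off from any family with coordinate functionals: expand
    in both systems and exchange the sums. This gives access to the power basis in place of
    [vbasis]. *)
Lemma field_traceE n (e : 'I_n -> L) (phi : 'I_n -> L -> k) :
  (forall i, linear_for *%R (phi i)) ->
  (forall v, v = \sum_i phi i v *: e i) ->
  forall a, tr a = \sum_i phi i (a * e i).
Proof.
move=> phiL phiE a.
have phiS i I (r : seq I) (c : I -> k) (f : I -> L) :
    phi i (\sum_(j <- r) c j *: f j) = \sum_(j <- r) c j * phi i (f j).
  elim: r => [|j r IH]; rewrite ?big_nil ?big_cons ?phiL ?IH //.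
  by have := phiL i (-1) 0 0; rewrite scaler0 addr0 mulN1r addNr.
rewrite /field_trace.
have E i : coord beta i (a * beta`_i) = \sum_j phi j (a * beta`_i) * coord beta i (e j).
  by rewrite [in LHS](phiE (a * _)) linear_sum; apply: eq_bigr => j _; rewrite linearZ.
under eq_bigr do rewrite E; rewrite exchange_big; apply: eq_bigr => j _ /=.
rewrite [in RHS](coord_vbasis (memvf (e j))) mulr_sumr.
under [in RHS]eq_bigr do rewrite -scalerAr.
by rewrite phiS; apply: eq_bigr => i _; rewrite mulrC.
Qed.

(** The rows of [C] are N vectors of L^m, and this is the Gram matrix over k of the trace of the
    form [A] on them. It generalizes [trace_mx] to an arbitrary k-basis of L^m. *)
Definition tgram N m (C : 'M[L]_(N, m)) (A : 'M[L]_m) : 'M[k]_N :=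
  map_mx tr (C *m A *m C^T).

Lemma map_trM N M' N' M (Q : 'M[k]_(N', N)) (X : 'M[L]_(N, M)) (Q' : 'M[k]_(M', M)) :
  map_mx tr (emb Q *m X *m (emb Q')^T) = Q *m map_mx tr X *m Q'^T.
Proof.
have left p q r (B : 'M[k]_(p, q)) (Y : 'M[L]_(q, r)) :
    map_mx tr (emb B *m Y) = B *m map_mx tr Y.
  apply/matrixP => i j; rewrite !mxE linear_sum; apply: eq_bigr => l _ /=.
  by rewrite !mxE mulr_algl linearZ.
have right p q r (Y : 'M[L]_(p, q)) (B : 'M[k]_(q, r)) :
    map_mx tr (Y *m emb B) = map_mx tr Y *m B.
  apply/matrixP => i j; rewrite !mxE linear_sum; apply: eq_bigr => l _ /=.
  by rewrite !mxE mulr_algr linearZ mulrC.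
by rewrite map_trmx right left.
Qed.

Definition kbasis N m (C : 'M[L]_(N, m)) : Prop :=
  (forall v : 'rV_m, exists q : 'rV[k]_N, v = emb q *m C) /\
  (forall q : 'rV[k]_N, emb q *m C = 0 -> q = 0).

Lemma kbasis_span N m M (C : 'M[L]_(N, m)) (V : 'M[L]_(M, m)) : kbasis C ->
  exists Q : 'M[k]_(M, N), V = emb Q *m C.
Proof.
move=> [Cs _]; pose q i := projT1 (cid (Cs (row i V))).
exists (\matrix_i q i); apply/row_matrixP => i.
by rewrite row_mul -map_row rowK /q; case: cid.
Qed.

Lemma kbasis_free N m M (C : 'M[L]_(N, m)) (Q : 'M[k]_(M, N)) : kbasis C ->
  emb Q *m C = 0 -> Q = 0.
Proof.
move=> [_ Cf] QC; apply/row_matrixP => i; rewrite row0; apply: Cf.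
by rewrite map_row -row_mul QC row0.
Qed.

Lemma kbasis_mul N m (C : 'M[L]_(N, m)) (P : 'M_m) : P \in unitmx ->
  kbasis C -> kbasis (C *m P).
Proof.
move=> Pu [Cs Cf]; split=> [v|q].
  by have [q qE] := Cs (v *m invmx P); exists q; rewrite mulmxA -qE mulmxKV.
by rewrite mulmxA => qCP; apply: Cf; rewrite -(mulmxK Pu (_ *m C)) qCP mul0mx.
Qed.

Lemma kbasis_base_change N N' m (C : 'M[L]_(N, m)) (C' : 'M[L]_(N', m)) :
  kbasis C -> kbasis C' ->
  exists (Q : 'M[k]_(N, N')) (Q' : 'M_(N', N)),
    [/\ Q *m Q' = 1%:M, Q' *m Q = 1%:M & C = emb Q *m C'].
Proof.
move=> bC bC'; have [Q QE] := kbasis_span C bC'; have [Q' QE'] := kbasis_span C' bC.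
exists Q, Q'; split=> //; apply/eqP; rewrite -subr_eq0; apply/eqP.
  apply: (kbasis_free bC); rewrite map_mxB map_mxM map_mx1 mulmxBl mul1mx.
  by rewrite -mulmxA -QE' -QE subrr.
apply: (kbasis_free bC'); rewrite map_mxB map_mxM map_mx1 mulmxBl mul1mx.
by rewrite -mulmxA -QE -QE' subrr.
Qed.

(** A congruence over L turns the k-basis [C] into another one, and matrices over k pass through the
    trace, so both changes are congruences over k. *)
Lemma gwclass_tgram N N' m (C : 'M[L]_(N, m)) (C' : 'M[L]_(N', m)) (A B : 'M_m) :
  kbasis C -> kbasis C' -> mxcongr A B -> gwclass (tgram C A) = gwclass (tgram C' B).
Proof.
move=> bC bC' [P Pu ->].
have [Q [Q' [QQ' Q'Q CE]]] := kbasis_base_change (kbasis_mul Pu bC) bC'.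
apply: (gwclass_rect QQ' Q'Q); rewrite -map_trM /tgram; congr (map_mx _ _).
have -> : emb Q *m (C' *m B *m C'^T) *m (emb Q)^T = (emb Q *m C') *m B *m (emb Q *m C')^T.
  by rewrite trmx_mul !mulmxA.
by rewrite -CE trmx_mul !mulmxA.
Qed.

Lemma kbasis_block N m N' m' (C : 'M[L]_(N, m)) (C' : 'M[L]_(N', m')) :
  kbasis C -> kbasis C' -> kbasis (block_mx C 0 0 C').
Proof.
move=> [Cs Cf] [Cs' Cf']; split=> [v|q].
  have [q qE] := Cs (lsubmx v); have [q' qE'] := Cs' (rsubmx v).
  exists (row_mx q q'); rewrite map_row_mx mul_row_block !mulmx0 addr0 add0r.
  by rewrite -qE -qE' hsubmxK.
rewrite -(hsubmxK q) map_row_mx mul_row_block !mulmx0 addr0 add0r -row_mx0.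
by move=> /eq_row_mx[/Cf-> /Cf'->]; rewrite row_mx0.
Qed.

Lemma tgram_block N m N' m' (C : 'M[L]_(N, m)) (C' : 'M[L]_(N', m')) A B :
  tgram (block_mx C 0 0 C') (block_mx A 0 0 B) =
  block_mx (tgram C A) 0 0 (tgram C' B).
Proof.
rewrite /tgram tr_block_mx !trmx0 !mulmx_block !(mulmx0, mul0mx, addr0, add0r).
by rewrite map_block_mx !map_mx0.
Qed.

Definition std_kbasis m : 'M[L]_(\sum_(i < m) d, m) :=
  \matrix_(s, j) (if tagnat.sig1 s == j then beta`_(tagnat.sig2 s) else 0).

Lemma sum_tagnat m n (V : nmodType) (G : 'I_m -> 'I_n -> V) :
  \sum_(s < \sum_(i < m) n) G (tagnat.sig1 s) (tagnat.sig2 s) = \sum_i \sum_j G i j.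
Proof.
by rewrite [RHS]sig_big_dep /= (reindex _ (@tagnat.sig_bij_on m (fun=> n))).
Qed.

Lemma std_kbasisP m : kbasis (std_kbasis m).
Proof.
have comb (G : 'I_m -> 'I_d -> k) (q : 'rV_(\sum_(i < m) d)) j :
    (forall s, q 0 s = G (tagnat.sig1 s) (tagnat.sig2 s)) ->
    (emb q *m std_kbasis m) 0 j = \sum_a G j a *: beta`_a.
  move=> qG; rewrite mxE.
  transitivity (\sum_(s < \sum_(i < m) d)
      (fun i (a : 'I_d) => if i == j then G i a *: beta`_a else 0)
      (tagnat.sig1 s) (tagnat.sig2 s)).
    apply: eq_bigr => s _; rewrite !mxE qG mulr_algl.
    by case: eqP; rewrite ?scaler0.
  rewrite (sum_tagnat (fun i (a : 'I_d) => if i == j then G i a *: beta`_a else 0)).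
  rewrite (bigD1 j) //= [X in _ + X]big1 => [|i /negPf ij]; last first.
    by rewrite big1 // => a _; rewrite ij.
  by rewrite addr0; apply: eq_bigr => a _; rewrite eqxx.
split=> [v|q qC].
  exists (\row_s coord beta (tagnat.sig2 s) (v 0 (tagnat.sig1 s))).
  apply/rowP => j.
  rewrite (comb (fun i a => coord beta a (v 0 i))) => [|s]; last by rewrite mxE.
  by rewrite -coord_vbasis // memvf.
apply/rowP => s; rewrite mxE.
pose G i (a : 'I_d) := q 0 (@tagnat.Rank m (fun=> d) i a).
have qG s' : q 0 s' = G (tagnat.sig1 s') (tagnat.sig2 s').
  by rewrite /G tagnat.sig2K.
have := comb G q (tagnat.sig1 s) qG; rewrite qC mxE => /esym e0.
have /freeP/(_ _ e0) := basis_free (vbasisP {:L}).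
by move=> /(_ (tagnat.sig2 s)); rewrite -qG.
Qed.

Lemma trace_mxE m (A : 'M[L]_m) : trace_mx A = tgram (std_kbasis m) A.
Proof.
have e1 s j : (std_kbasis m *m A) s j = beta`_(tagnat.sig2 s) * A (tagnat.sig1 s) j.
  rewrite [LHS]mxE [LHS](bigD1 (tagnat.sig1 s)) //= [X in _ + X = _]big1 => [|i js]; last first.
    by rewrite mxE eq_sym (negPf js) mul0r.
  by rewrite addr0 mxE eqxx.
apply/matrixP => s t; rewrite [LHS]mxE [LHS]mxE [RHS]mxE; congr tr.
rewrite [RHS]mxE [RHS](bigD1 (tagnat.sig1 t)) //= [X in _ = _ + X]big1 => [|j jt]; last first.
  by rewrite [X in _ * X]mxE [X in _ * X]mxE eq_sym (negPf jt) mulr0.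
by rewrite addr0 e1 [in RHS]mxE [in RHS]mxE eqxx [beta`_ _ * A _ _]mulrC.
Qed.

Hypothesis tr_neq0 : exists c, tr c != 0.

(** A single c of nonzero trace is enough: if y has a nonzero coordinate y_j, pairing y with (c /
    y_j) e_j has trace tr c, so y cannot lie in the radical. *)
Lemma tgram_sym_unit N m (C : 'M[L]_(N, m)) (A : 'M_m) : kbasis C -> sym_unit A ->
  sym_unit (tgram C A).
Proof.
move=> bC /andP[/eqP sA Au]; apply/andP; split.
  by rewrite /tgram map_trmx !trmx_mul trmxK sA mulmxA.
rewrite -row_free_unit; apply: inj_row_free => q qT.
have [_ Cf] := bC; apply: Cf.
set w := emb q *m C; suff : w *m A = 0.
  by move=> wA; rewrite -(mulmxK Au w) wA mul0mx.
have trw (v : 'rV_m) : tr ((w *m A *m v^T) 0 0) = 0.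
  have [q' ->] := bC.1 v.
  have := map_trM q (C *m A *m C^T) q'; rewrite -/(tgram C A) qT mul0mx.
  move/(congr1 (fun M : 'M_1 => M 0 0)); rewrite [LHS]mxE [RHS]mxE => <-.
  by rewrite trmx_mul !mulmxA.
move: (w *m A) trw => y try0.
have [c c0] := tr_neq0; apply/rowP => j; rewrite [RHS]mxE.
apply: contraNeq c0 => yj; have := try0 ((c / y 0 j) *: delta_mx 0 j).
by rewrite linearZ /= -scalemxAr trmx_delta -colE !mxE divfK // => ->.
Qed.

Let transfer_congr m (A B : 'M[L]_m) : sym_unit A -> mxcongr A B ->
  gwclass (trace_mx A) = gwclass (trace_mx B).
Proof. by move=> _ AB; rewrite !trace_mxE; apply: gwclass_tgram => //; exact: std_kbasisP. Qed.

Let transfer_block m n (A : 'M[L]_m) (B : 'M[L]_n) : sym_unit A -> sym_unit B ->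
  gwclass (trace_mx (block_mx A 0 0 B)) = gwclass (trace_mx A) + gwclass (trace_mx B).
Proof.
move=> sA sB; have bm := std_kbasisP m; have bn := std_kbasisP n.
rewrite !trace_mxE -gwclass_block ?tgram_sym_unit // -tgram_block.
by apply: gwclass_tgram; [exact: std_kbasisP|exact: kbasis_block|exact: mxcongr_refl].
Qed.

Lemma gw_transferB : zmod_morphism (@gw_transfer k L).
Proof. exact: gwliftB transfer_congr transfer_block. Qed.

Lemma gw_transfer_class N m (C : 'M[L]_(N, m)) (A : 'M_m) : kbasis C -> sym_unit A ->
  gw_transfer (gwclass A) = gwclass (tgram C A).
Proof.
move=> bC sA; rewrite [LHS](gwlift_class transfer_congr transfer_block sA) trace_mxE.
by apply: gwclass_tgram => //; [exact: std_kbasisP|exact: mxcongr_refl].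
Qed.

End TraceForm.

(** * Residue forms on k[X] / f *)

Section ResidueForm.
Variable k : fieldType.
Implicit Types f u p q w a b : {poly k}.

(** For monic [f], up to sign the residue at infinity of p dX / f. *)
Definition reslin f p : k := (p %% f)`_(size f).-2.

Lemma reslin_is_linear f : linear_for *%R (reslin f).
Proof. by move=> c p q; rewrite /reslin modpD modpZl coefD coefZ. Qed.

HB.instance Definition _ f := GRing.isLinear.Build k {poly k} k *%R (reslin f)
  (@reslin_is_linear f).

Lemma reslin_small f p : (size p < size f)%N -> reslin f p = p`_(size f).-2.
Proof. by move=> pf; rewrite /reslin modp_small. Qed.

Lemma reslin_mull f p : reslin f (p * f) = 0.
Proof. by rewrite /reslin modp_mull coef0. Qed.

Lemma reslin_eqmod f p q : p %% f = q %% f -> reslin f p = reslin f q.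
Proof. by rewrite /reslin => ->. Qed.

(** Gram matrix of (p, q) |-> res(u p q dX / f) on the monomials of degree less than d. Keeping [d]
    apart from the size of [f] allows sizes such as m + n without casts. *)
Definition resform d f u : 'M[k]_d := \matrix_(i, j) reslin f (u * 'X^(i + j)).

Lemma poly_sum_coef p n : (size p <= n)%N -> p = \sum_(i < n) p`_i *: 'X^i.
Proof. by move=> pn; rewrite -poly_def -[LHS](take_poly_id pn). Qed.

Lemma resform_gram N d f u (p : 'I_N -> {poly k}) : (forall i, size (p i) <= d)%N ->
  let P := \matrix_(i < N, j < d) (p i)`_j in
  P *m resform d f u *m P^T = \matrix_(i, j) reslin f (u * (p i * p j)).
Proof.
move=> pd P; apply/matrixP => i j; rewrite [RHS]mxE [LHS]mxE.
rewrite [in RHS](poly_sum_coef (pd j)) !mulr_sumr linear_sum; apply: eq_bigr => t _ /=.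
rewrite [X in _ * X]mxE [X in _ * X]mxE mulrC -!scalerAr linearZ /=; congr (_ * _).
rewrite mxE [in RHS](poly_sum_coef (pd i)) mulr_suml mulr_sumr linear_sum.
apply: eq_bigr => r _ /=; rewrite [in LHS]mxE [X in _ * X]mxE.
by rewrite -scalerAl -scalerAr linearZ /= exprD.
Qed.

(** If u p has a nonzero remainder z modulo f, a power of X shifts the leading coefficient of z to
    degree d - 1, where [reslin] reads it. So the radical consists of the p with f dividing u p,
    hence of 0. *)
Lemma resform_sym_unit d f u : size f = d.+1 -> coprimep u f -> sym_unit (resform d f u).
Proof.
move=> fd uf; apply/andP; split.
  by apply/eqP/matrixP => i j; rewrite !mxE addnC.
have f0 : f != 0 by rewrite -size_poly_eq0 fd.
rewrite -row_free_unit; apply: inj_row_free => v vB.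
pose p := rVpoly v; have ps : (size p <= d)%N by exact: size_poly.
have pv i : p`_i = if insub i is Some j then v 0 j else 0.
  by rewrite /p coef_rVpoly.
have vE : v = \row_j p`_j by apply/rowP => j; rewrite mxE pv valK.
have res0 j : (j < d)%N -> reslin f (u * p * 'X^j) = 0.
  (* The off-diagonal entry of the Gram matrix of p and X^j expresses [vB] as the vanishing of one
     residue. *)
  move=> jd; pose q (i : 'I_2) : {poly k} := if i == 0 then p else 'X^j.
  have qd i : (size (q i) <= d)%N by rewrite /q; case: eqP => _ //; rewrite size_polyXn.
  have := resform_gram f u qd; set Q := \matrix_(_, _) _ => Qe.
  have rQ : row 0 Q = v by rewrite vE; apply/rowP => l; rewrite !mxE.
  have := congr1 (fun M : 'M_2 => M 0 1) Qe.
  by rewrite gram_entry rQ vB mul0mx !mxE /q /= mulrA.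
suff z0 : (u * p) %% f = 0.
  have : f %| u * p by rewrite /dvdp z0.
  rewrite Gauss_dvdpr 1?coprimep_sym // => fp; apply/rowP => j; rewrite vE !mxE.
  have [->|p0] := eqVneq p 0; first by rewrite coef0.
  by have := dvdp_leq p0 fp; rewrite fd ltnNge ps.
apply: contrapT => /eqP z0; set z := _ %% _ in z0.
have zf : (size z <= d)%N by rewrite -ltnS -fd ltn_modp.
have sz : (0 < size z)%N by rewrite size_poly_gt0.
have := res0 (d - size z)%N; rewrite ltn_subrL sz (leq_trans sz zf) => /(_ isT).
have -> : reslin f (u * p * 'X^(d - size z)) = reslin f (z * 'X^(d - size z)).
  by apply: reslin_eqmod; rewrite [z * _]mulrC modp_mul mulrC.
rewrite reslin_small; last first.
  by rewrite size_mulXn // fd subnK.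
rewrite fd /= coefMXn.
have d1 : d = (d.-1).+1 by rewrite prednK // (leq_trans sz zf).
have -> : (d.-1 < d - size z)%N = false by lia.
have -> : (d.-1 - (d - size z) = (size z).-1)%N by lia.
by move/eqP; rewrite -/(lead_coef z) lead_coef_eq0 (negPf z0).
Qed.

Lemma coef_monicM_pred b p m n : b \is monic -> size b = n.+1 -> (size p <= m)%N ->
  (b * p)`_(m + n).-1 = p`_m.-1.
Proof.
move=> bm bn pm; case: m pm => [|m] pm.
  by move: pm; rewrite leqn0 size_poly_eq0 => /eqP->; rewrite mulr0 !coef0.
rewrite addSn /=; pose b' := b - 'X^n; have b'n : (size b' <= n)%N.
  apply/leq_sizeP => j; rewrite leq_eqVlt => /orP[/eqP<-|nj].
    rewrite coefB coefXn eqxx; have := monicP bm; rewrite /lead_coef bn /= => ->.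
    by rewrite subrr.
  by rewrite coefB coefXn gtn_eqF // subr0 nth_default // bn.
have -> : b = b' + 'X^n by rewrite subrK.
rewrite mulrDl coefD coefXnM /= [X in X + _]nth_default ?add0r.
  by rewrite ltnNge leq_addl /= addnK.
rewrite (leq_trans (size_polyMleq _ _)) //.
by have := leq_add b'n pm; rewrite addnS addnC; lia.
Qed.

(** Cancellation of b in b w dX / (a b): the remainder of b w modulo a b is b times that of w modulo
    a, and a monic b preserves the top coefficient. *)
Lemma reslin_mulr a b w : a \is monic -> b \is monic ->
  reslin (a * b) (b * w) = reslin a w.
Proof.
move=> am bm; have a0 := monic_neq0 am; have b0 := monic_neq0 bm.
have am1 : size a = (size a).-1.+1 by rewrite prednK // size_poly_gt0.
have bm1 : size b = (size b).-1.+1 by rewrite prednK // size_poly_gt0.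
have rs : (size (w %% a)%R <= (size a).-1)%N by rewrite -ltnS -am1 ltn_modp.
have abE : size (a * b) = ((size a).-1 + (size b).-1).+1.
  by rewrite size_mul // am1 bm1 /= addnS.
have -> : reslin (a * b) (b * w) = (b * (w %% a))`_(size (a * b)).-2.
  rewrite /reslin; suff -> : (b * w) %% (a * b) = b * (w %% a) by []; apply: esym; apply: (@modpP _ _ (w %/ a)).
    by rewrite [in LHS](divp_eq w a) mulrDr; congr (_ + _); ring.
  have [->|r0] := eqVneq (w %% a) 0; first by rewrite mulr0 size_poly0 size_poly_gt0 mulf_neq0.
  by rewrite [a * b]mulrC !size_mul //; move: rs bm1 am1; move: (size _) (size _) (size _) => i j l; lia.
by rewrite abE /reslin (coef_monicM_pred bm bm1 rs).
Qed.

Definition resclass f u : GW k := gwclass (resform (size f).-1 f u).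

Lemma resclassE d f u : size f = d.+1 -> gwclass (resform d f u) = resclass f u.
Proof. by move=> fd; rewrite /resclass fd. Qed.

(** Modulo ab, the multiples of b and the multiples of a are orthogonal, as a product of the two is
    divisible by ab. On the former, u (b p)(b q) / (ab) = u b p q / a, which explains the new factor
    b. *)
Lemma resclass_mul a b u : a \is monic -> b \is monic -> coprimep a b ->
    coprimep u (a * b) ->
  resclass (a * b) u = resclass a (u * b) + resclass b (u * a).
Proof.
move=> am bm ab; rewrite coprimepMr => /andP[ua ub].
have a0 := monic_neq0 am; have b0 := monic_neq0 bm.
pose m := (size a).-1; pose n := (size b).-1.
have am1 : size a = m.+1 by rewrite /m prednK // size_poly_gt0.
have bn1 : size b = n.+1 by rewrite /n prednK // size_poly_gt0.
have abE : size (a * b) = (m + n).+1 by rewrite size_mul // am1 bn1 addnS.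
rewrite -(resclassE u abE) -(resclassE _ am1) -(resclassE _ bn1).
have sa : sym_unit (resform m a (u * b)).
  by apply: resform_sym_unit => //; rewrite coprimepMl ua coprimep_sym.
have sb : sym_unit (resform n b (u * a)).
  by apply: resform_sym_unit => //; rewrite coprimepMl ub.
rewrite -gwclass_block //; apply/esym/gwclass_congr.
pose p (i : 'I_(m + n)) : {poly k} :=
  match fintype.split i with inl i => b * 'X^i | inr j => a * 'X^j end.
have ps i : (size (p i) <= m + n)%N.
  by rewrite /p; case: (fintype.split i) => j; have := ltn_ord j;
    rewrite size_mulXn // ?bn1 ?am1; clear; lia.
have /andP[_ bu] : sym_unit (block_mx (resform m a (u * b)) 0 0 (resform n b (u * a))).
  by rewrite sym_unit_block sa.
pose P := \matrix_(i < m + n, j < m + n) (p i)`_j.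
(* Invertibility of the orthogonal sum forces that of [P], so the linear independence of the [p i]
   comes for free. *)
apply: (mxcongr_unit (P := P) bu); rewrite /P resform_gram //.
have res0 v : reslin (a * b) (u * (a * (b * v))) = 0.
  by rewrite (_ : u * (a * (b * v)) = u * v * (a * b)) ?reslin_mull //; ring.
have pl i : p (lshift n i) = b * 'X^i.
  by rewrite /p -[lshift n i]/(unsplit (inl i)) unsplitK.
have pr i : p (rshift m i) = a * 'X^i.
  by rewrite /p -[rshift m i]/(unsplit (inr i)) unsplitK.
apply/matrixP => i j; rewrite [RHS]mxE.
case: (split_ordP i) => i' ->; case: (split_ordP j) => j' ->.
- rewrite block_mxEul mxE !pl.
  rewrite -(reslin_mulr (u * b * 'X^(i' + j')) am bm); congr reslin; rewrite exprD; ring.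
- rewrite block_mxEur mxE ?pl ?pr.
  rewrite -[LHS](res0 ('X^i' * 'X^j')); congr reslin; ring.
- rewrite block_mxEdl mxE ?pl ?pr.
  rewrite -[LHS](res0 ('X^i' * 'X^j')); congr reslin; ring.
- rewrite block_mxEdr mxE !pr [a * b]mulrC.
  rewrite -(reslin_mulr (u * a * 'X^(i' + j')) bm am); congr reslin; rewrite exprD; ring.
Qed.

Lemma resclass_prod (T : eqType) (pt : T -> {poly k}) (s : seq T) u :
    (forall x, pt x \is monic) ->
    {in s &, forall x y, x != y -> coprimep (pt x) (pt y)} -> uniq s ->
    coprimep u (\prod_(x <- s) pt x) ->
  resclass (\prod_(x <- s) pt x) u =
  \sum_(x <- s) resclass (pt x) (u * \prod_(y <- s | y != x) pt y).
Proof.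
move=> ptm; elim: s u => [|x s IHs] u cop.
  by move=> _ _; rewrite !big_nil /resclass size_poly1 gwclass0.
move=> /= /andP[xs us]; rewrite !big_cons coprimepMr => /andP[ux usp].
have cxs : coprimep (pt x) (\prod_(y <- s) pt y).
  rewrite big_seq; elim/big_rec: _ => [|y q ys IH]; first exact: coprimep1.
  rewrite coprimepMr IH andbT; apply: cop; rewrite ?mem_head ?inE ?ys ?orbT //.
  by apply: contraNneq xs => ->.
rewrite resclass_mul ?monic_prod // ?coprimepMr ?ux //; congr (_ + _).
  rewrite eqxx; congr (resclass _ (_ * _)); rewrite [LHS]big_seq [RHS]big_seq_cond.
  by apply: eq_bigl => y; case: (boolP (y \in s)) => //= ys; apply/esym; apply: contraNneq xs => <-.
rewrite IHs //; first last.
- by rewrite coprimepMl usp.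
- by move=> y z ys zs; apply: cop; rewrite inE ?ys ?zs orbT.
apply: eq_big_seq => y ys; have xy : x != y by apply: contraNneq xs => ->.
by rewrite big_cons xy mulrA.
Qed.

Hypothesis char2 : 2 != 0 :> k.

(** A metabolic form is hyperbolic because 2 is invertible: normalize X to 1 and subtract half of C
    from the second half of the basis. The same halving identifies the hyperbolic form with m copies
    of <1> + <-1>. *)
Lemma gwclass_lagrangian m (X C : 'M[k]_m) : X \in unitmx -> C^T = C ->
  gwclass (block_mx 0 X X^T C) = gwhyp k *+ m.
Proof.
move=> Xu sC; have half : 2^-1 + 2^-1 = 1 :> k by field.
pose Y := invmx X.
have XY : X *m Y = 1%:M by rewrite mulmxV.
have YX : Y *m X = 1%:M by rewrite mulVmx.
have s1 : sym_unit (1%:M : 'M[k]_m) by rewrite /sym_unit trmx1 eqxx unitmx1.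
have sN1 : sym_unit (- 1%:M : 'M[k]_m).
  by rewrite -scaleN1r sym_unit_scale ?oppr_eq0 ?oner_eq0.
have <- := gwclass_addN char2 s1; rewrite -gwclass_block //.
apply/esym/gwclass_congr; pose H : 'M[k]_(m + m) := block_mx 0 1%:M 1%:M 0.
apply: (@mxcongr_trans _ _ _ H).
  have /andP[_ bu] : sym_unit (block_mx 1%:M 0 0 (- 1%:M) : 'M[k]_(m + m)).
    by rewrite sym_unit_block s1.
  apply: (mxcongr_unit (P := block_mx 1%:M (2^-1)%:M 1%:M (- 2^-1)%:M) bu).
  rewrite /H tr_block_mx !mulmx_block !tr_scalar_mx.
  rewrite !(mul0mx, mulmx0, addr0, add0r, mul1mx, mulmx1).
  by rewrite -!raddfD /= half addNr subrr raddf0 (raddfN (@scalar_mx k m) 1).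
apply: mxcongr_sym; apply: mxcongr_sym.
exists (block_mx Y 0 (- (2^-1 *: (C *m Y))) 1%:M).
  by rewrite unitmxE det_lblock det1 mulr1 -unitmxE unitmx_inv.
rewrite tr_block_mx !mulmx_block !trmx0 !trmx1.
rewrite !(mul0mx, mulmx0, addr0, add0r, mul1mx, mulmx1).
have -> : (- (2^-1 *: (C *m Y)))^T = - (2^-1 *: (Y^T *m C)).
  by rewrite linearN linearZ /= trmx_mul sC.
have XtYt : X^T *m Y^T = 1%:M by rewrite -trmx_mul YX trmx1.
rewrite /H !mulNmx !mulmxN -!scalemxAl -!scalemxAr -[C *m Y *m X]mulmxA YX mulmx1.
rewrite !mulmxA XtYt mul1mx; congr block_mx.
by rewrite addrA -opprD -scalerDl half scale1r addNr.
Qed.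

Lemma resclass_even f m : f \is monic -> size f = (m + m).+1 ->
  resclass f 1 = gwhyp k *+ m.
Proof.
move=> fm fs; rewrite -(resclassE _ fs).
have /andP[/eqP sA Au] : sym_unit (resform (m + m) f 1).
  by apply: resform_sym_unit => //; exact: coprime1p.
set A : 'M_(m + m) := resform _ _ _ in sA Au *.
(* For i, j < m the exponent i + j is at most 2m - 2, just below the index 2m - 1 that [reslin]
   reads. *)
have ul0 : ulsubmx A = 0.
  apply/matrixP => i j; rewrite !mxE mul1r reslin_small.
    rewrite fs coefXn /=; have := ltn_ord i; have := ltn_ord j.
    by case: eqP => //; lia.
  by rewrite size_polyXn fs /=; have := ltn_ord i; have := ltn_ord j; lia.
have AE : A = block_mx 0 (ursubmx A) (ursubmx A)^T (drsubmx A).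
  by rewrite -{1}(submxK A) ul0 trmx_ursub sA.
rewrite AE; apply: gwclass_lagrangian; last by rewrite trmx_drsub sA.
(* A kernel vector of the off-diagonal block, padded by zeros, is a kernel vector of the invertible
   [A]. *)
rewrite -row_free_unit; apply: inj_row_free => v vX.
have : row_mx v 0 *m A = 0.
  by rewrite AE mul_row_block mulmx0 !mul0mx add0r addr0 vX row_mx0.
move=> vA; have : row_mx v (0 : 'rV_m) = 0 by rewrite -(mulmxK Au (row_mx v 0)) vA mul0mx.
by rewrite -[X in _ = X -> _]row_mx0 => /eq_row_mx[].
Qed.

End ResidueForm.

(** * Euler's formula for the trace *)

Section EulerTrace.
Variables (k : fieldType) (x : Gm_point k).
Local Notation pi := (pt_poly x).
Local Notation kappa := (resfield x).
Local Notation d := (size pi).-1.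
Local Notation "[ p ]" := (in_qpoly pi p : kappa) (at level 0, format "[ p ]").

Lemma pt_monic : pi \is monic.
Proof. by case: (pt_irr x). Qed.

Lemma pt_size_gt1 : (1 < size pi)%N.
Proof. by have [[]] := pt_irr x. Qed.

Lemma pt_size : size pi = d.-1.+2.
Proof. by have := pt_size_gt1; case: (size pi) => [|[]]. Qed.

Lemma qpoly_lin c (p q : {poly k}) : [c *: p + q] = c *: [p] + [q].
Proof. by rewrite in_qpolyD in_qpolyZ. Qed.

Lemma qpoly_val (p : {poly k}) : ([p] : {poly k}) = p %% pi.
Proof. by rewrite /= (mk_monicE (pt_irr x)) -Pdiv.IdomainMonic.modpE // pt_monic. Qed.

Definition ptlin (a : kappa) : k := reslin pi (a : {poly k}).

Lemma ptlinE (p : {poly k}) : ptlin [p] = reslin pi p.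
Proof. by rewrite /ptlin qpoly_val; apply: reslin_eqmod; rewrite modp_id. Qed.

Lemma ptlin_is_linear : linear_for *%R ptlin.
Proof.
move=> c a b; rewrite -(resfieldK a) -(resfieldK b) -qpoly_lin !ptlinE.
by rewrite linearP.
Qed.

HB.instance Definition _ := GRing.isLinear.Build k kappa k *%R ptlin ptlin_is_linear.

(** For j <= i the product is already reduced, and its coefficient of degree d - 1 is the leading
    one of pi exactly when i = j. For j > i, subtracting X^(j-i-1) pi leaves a polynomial of degree
    less than j, which has no such coefficient. *)
Lemma reslin_dual (i j : nat) : (i < d)%N -> (j < d)%N ->
  reslin pi ('X^j * drop_poly i.+1 pi) = (i == j)%:R.
Proof.
have [s ds] : exists s, size pi = s.+2 by exists d.-1; exact: pt_size.
have : pi`_d = 1 by exact/monicP/pt_monic.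
rewrite ds /= => pd id jd.
have [ij|ij] := leqP j i.
  rewrite reslin_small; last first.
    rewrite mulrC ds; apply: leq_ltn_trans (size_polyMleq _ _) _.
    by rewrite size_polyXn size_drop_poly ds; move: id ij; clear; lia.
  rewrite coefXnM coef_drop_poly ds /=.
  have [e|ne] := eqVneq i j.
    rewrite e ifF; last by apply/negbTE; move: jd; clear; lia.
    by rewrite (_ : (s - j + j.+1)%N = s.+1) //; move: jd; clear; lia.
  rewrite ifF; last by apply/negbTE; move: jd; clear; lia.
  by rewrite nth_default // ds; move: jd id ij ne; clear; lia.
have -> : 'X^j * drop_poly i.+1 pi =
    'X^(j - i.+1) * pi - 'X^(j - i.+1) * take_poly i.+1 pi.
  rewrite -mulrBr -{2}(poly_take_drop i.+1 pi) addrAC subrr add0r mulrA mulrAC -exprD.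
  by rewrite subnK.
have ts := size_take_poly i.+1 pi.
rewrite raddfB /= reslin_mull sub0r ltn_eqF // reslin_small; last first.
  apply: leq_ltn_trans (size_polyMleq _ _) _.
  by rewrite size_polyXn ds; move: jd ij ts; move: (size _) => t; clear; lia.
rewrite nth_default ?oppr0 // ds /=.
apply: leq_trans (size_polyMleq _ _) _.
by rewrite size_polyXn; move: jd ij ts; move: (size _) => t; clear; lia.
Qed.

(** The coefficient p_(l+1) contributes to X^l once for each i <= l, which is the factor l + 1 of
    the derivative. *)
Lemma deriv_sum_drop (p : {poly k}) n : (size p <= n.+1)%N ->
  \sum_(i < n) 'X^i * drop_poly i.+1 p = p^`().
Proof.
move=> pn; apply/polyP => l; rewrite coef_sum coef_deriv.
under eq_bigr do rewrite coefXnM coef_drop_poly.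
have [ln|nl] := leqP n l.
  rewrite nth_default ?mul0rn; last by rewrite (leq_trans pn).
  rewrite big1 // => i _; rewrite nth_default ?if_same //.
  by rewrite (leq_trans pn) //; have := ltn_ord i; move: ln; lia.
rewrite (bigID (fun i : 'I_n => i <= l)%N) /= [X in _ + X]big1 => [|i]; last first.
  by rewrite -ltnNge => ->.
rewrite addr0 (eq_bigr (fun=> p`_l.+1)) => [|i il]; last first.
  rewrite ltnNge il /=; congr (_`_ _); lia.
rewrite sumr_const; congr (_ *+ _).
rewrite -(card_ord l.+1) -!sum1_card (big_ord_widen_cond n xpredT (fun=> 1%N) nl).
by apply: eq_bigl => i; rewrite ltnS.
Qed.

Lemma qpoly_size (a : kappa) : (size (a : {poly k}) <= d)%N.
Proof.
have : (size (a : {poly k}) < size pi)%N.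
  by apply: leq_trans (size_mk_monic _) _; rewrite (mk_monicE (pt_irr x)).
by move=> h; rewrite -ltnS prednK // (leq_trans _ h).
Qed.

Lemma qpoly_coef (a : kappa) : a = \sum_(i < d) (a : {poly k})`_i *: ['X^i].
Proof.
have sa := qpoly_size a.
rewrite -[LHS]resfieldK [in LHS](poly_sum_coef sa) linear_sum.
by apply: eq_bigr => i _; rewrite /= in_qpolyZ.
Qed.

(** Euler's formula: the basis dual to (X^i) for the residue functional is given
    by the coefficients of pi / (X - theta), whose value at theta is pi'. *)
Lemma field_trace_ptlin (a : kappa) : field_trace a = ptlin (a * [pi^`()]).
Proof.
pose phi (i : 'I_d) (v : kappa) := ptlin (v * [drop_poly i.+1 pi]).
have phiL i : linear_for *%R (phi i).
  by move=> c v w; rewrite /phi mulrDl -scalerAl linearP.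
have phiE v : v = \sum_i phi i v *: ['X^i].
  rewrite [LHS]qpoly_coef; apply: eq_bigr => i _; congr (_ *: _).
  rewrite /phi {2}(qpoly_coef v) mulr_suml linear_sum /=.
  rewrite (bigD1 i) //= big1 ?addr0 => [|j ji].
    by rewrite -scalerAl linearZ /= -in_qpolyM ptlinE reslin_dual // eqxx mulr1.
  have ij : (i == j :> nat) = false by rewrite eq_sym; exact: negPf ji.
  by rewrite -scalerAl linearZ /= -in_qpolyM ptlinE reslin_dual // ij mulr0.
rewrite (field_traceE phiL phiE) -(@deriv_sum_drop pi d); last by rewrite prednK // ltnW // pt_size_gt1.
rewrite linear_sum /= mulr_sumr linear_sum; apply: eq_bigr => i _.
by rewrite /phi -mulrA -in_qpolyM.
Qed.

Hypothesis sep : [pi^`()] != 0.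

Lemma field_trace_neq0 : exists c : kappa, field_trace c != 0.
Proof.
(* Euler's formula cancels pi', and the residue functional takes the value 1 on X^(d-1). *)
exists (['X^(d.-1)] / [pi^`()]); rewrite field_trace_ptlin divfK // ptlinE.
by rewrite reslin_small ?size_polyXn pt_size // coefXn eqxx oner_eq0.
Qed.

Lemma pt_kbasis : kbasis (\matrix_(i < d, j < 1) ['X^i] : 'M[kappa]_(d, 1)).
Proof.
have E (q : 'rV[k]_d) : (map_mx (in_alg kappa) q *m
    (\matrix_(i < d, j < 1) ['X^i] : 'M[kappa]_(d, 1))) 0 0 = [rVpoly q].
  have sq : (size (rVpoly q) <= d)%N := size_poly _ _.
  rewrite mxE [in RHS](poly_sum_coef sq) linear_sum /=.
  apply: eq_bigr => i _; rewrite !mxE mulr_algl in_qpolyZ.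
  by rewrite coef_rVpoly_ord.
split=> [v|q /matrixP/(_ 0 0)].
  exists (\row_i ((v 0 0 : kappa) : {poly k})`_i); apply/matrixP => i j.
  rewrite !ord1 E -[LHS]resfieldK; congr in_qpoly.
  rewrite -[LHS](take_poly_id (qpoly_size (v 0 0))).
  by apply/polyP => l; rewrite coef_poly coef_rVpoly; case: insubP => [m lm <-|/negPf->] //; rewrite mxE (ltn_ord m).
rewrite E mxE => /eqP; rewrite in_qpoly_eq0 => qd.
have [q0|q0] := eqVneq (rVpoly q) 0; first by rewrite -(rVpolyK q) q0 linear0.
have := leq_trans (dvdp_leq q0 qd) (size_poly _ _ : (size (rVpoly q) <= d)%N).
by rewrite -ltnS prednK ?ltnn // ltnW // pt_size_gt1.
Qed.

Lemma gw_transfer_resclass (w : {poly k}) : coprimep w pi ->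
  gw_transfer (gwclass (([w] / [pi^`()])%:M : 'M[kappa]_1)) = resclass pi w.
Proof.
move=> wx; have w0 : [w] != 0.
  rewrite in_qpoly_eq0; apply/negP => xw; have := pt_size_gt1.
  by rewrite -(eqp_size (dvdp_gcd_idr xw)) (eqP wx).
have s1 : sym_unit (([w] / [pi^`()])%:M : 'M[kappa]_1).
  by rewrite sym_unit_scalar mulf_neq0 ?invr_eq0.
rewrite (gw_transfer_class field_trace_neq0 pt_kbasis s1) /resclass.
congr gwclass; rewrite /tgram mul_mx_scalar -scalemxAl.
apply/matrixP => i j; rewrite !mxE big_ord1 !mxE field_trace_ptlin.
rewrite -ptlinE in_qpolyM exprD in_qpolyM; congr ptlin.
by field.
Qed.

End EulerTrace.

(** For p/q = n/d, the hypotheses are the cross-multiplied equality and its derivative. The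
    conclusion makes the quotient rule independent of the fraction chosen. *)
Lemma quotient_rule_cross (R : comRingType) (p q n d p' q' n' d' : R) :
  p * d = n * q -> p' * d + p * d' = n' * q + n * q' ->
  (n' * d - n * d') * q ^+ 2 = (p' * q - p * q') * d ^+ 2.
Proof.
move=> e e'.
have -> : (n' * d - n * d') * q ^+ 2 =
  (n' * q + n * q') * (d * q) - d * q' * (n * q) - d' * q * (n * q) by ring.
by rewrite -e' -e; ring.
Qed.

Lemma fibre_mul_aux (F : fieldType) (s v c c' : F) : c != 0 -> c' != 0 ->
  s * v / c' = s * c / c' * (v / c).
Proof. by move=> c0 c0'; field; rewrite c0 c0'. Qed.

Lemma mulf_div_sqr (F : fieldType) (u p q : F) : q != 0 ->
  u * p * q / (q * q) = u * (p / q).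
Proof. by move=> q0; field. Qed.

(** * Twists by fibres of line bundles *)

Section Fibres.
Variables (k : fieldType) (x : Gm_point k).
Local Notation K := {fraction {poly k}}.
Local Notation "p %:F" := (FracField.tofrac p).
Local Notation pi := ((pt_poly x)%:F : K).
Local Notation kappa := (resfield x).

Lemma fcoordZ (L : fracideal k) (a : kappa) (v : fibre x L) :
  fcoord (a *: v) = a * fcoord v.
Proof. exact: fscale_coord. Qed.

Lemma fcoord_surj (L : fracideal k) (a : kappa) : exists v : fibre x L, fcoord v = a.
Proof.
exists (fcls x L ((a : {poly k})%:F * fgen L)).
have cE : (a : {poly k})%:F * fgen L / fgen L = (a : {poly k})%:F.
  by rewrite mulfK ?fgen_neq0.
by rewrite fcoord_cls ?cE ?red_poly ?resfieldK // /in_stalk cE localring_poly.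
Qed.

(** Fibres are lines with the coordinate [fcoord], so a map between them is one scalar. Comparing
    twists thus becomes arithmetic in k(x). *)
Definition fibre_slope (L L' : fracideal k) (f : fibre x L -> fibre x L') (a : kappa) :=
  forall v, fcoord (f v) = a * fcoord v.

Lemma fibre_slope_linear (L L' : fracideal k) (f : fibre x L -> fibre x L') a :
  fibre_slope f a -> linear f.
Proof.
by move=> fa c u v; apply: fcoord_inj; rewrite fa !raddfD /= !fcoordZ !fa; ring.
Qed.

(** A slope forces f to be linear, and for linear f the values of [linfun f] are those of f. *)
Lemma fibre_slope_linfun (L L' : fracideal k) (f : fibre x L -> fibre x L') a :
  fibre_slope f a -> fibre_slope (linfun f) a.
Proof.
move=> fa v; have fL := fibre_slope_linear fa.
pose fM := GRing.isLinear.Build _ _ _ _ f fL.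
pose fl : {linear fibre x L -> fibre x L'} := HB.pack f fM.
by rewrite -[f]/(fl : _ -> _) lfunE /= fa.
Qed.

Lemma fibre_slope_ext (L L' : fracideal k) (f g : 'Hom(fibre x L, fibre x L')) a :
  fibre_slope f a -> fibre_slope g a -> f = g.
Proof. by move=> fa ga; apply/lfunP => v; apply: fcoord_inj; rewrite fa ga. Qed.

Lemma fibre_slope_exists (L L' : fracideal k) (f : 'Hom(fibre x L, fibre x L')) :
  exists a, fibre_slope f a.
Proof.
have [u u1] := fcoord_surj L 1; exists (fcoord (f u)) => v.
have -> : v = fcoord v *: u by apply: fcoord_inj; rewrite fcoordZ u1 mulr1.
by rewrite linearZ /= !fcoordZ u1 mulr1 mulrC.
Qed.

Lemma fibre_slope_eq0 (L L' : fracideal k) (f : 'Hom(fibre x L, fibre x L')) a :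
  fibre_slope f a -> (f == 0) = (a == 0).
Proof.
move=> fa; apply/eqP/eqP => [f0|a0].
  have [u u1] := fcoord_surj L 1.
  by have := fa u; rewrite f0 lfunE /= raddf0 u1 mulr1.
by apply/lfunP => v; apply: fcoord_inj; rewrite fa a0 mul0r lfunE /= raddf0.
Qed.

Lemma fibre_slope_comp (L L' L'' : fracideal k) (f : 'Hom(fibre x L', fibre x L''))
    (g : 'Hom(fibre x L, fibre x L')) a b :
  fibre_slope f a -> fibre_slope g b -> fibre_slope (f \o g)%VF (a * b).
Proof. by move=> fa gb v; rewrite comp_lfunE fa gb mulrA. Qed.

Lemma fibre_slope_inv (L L' : fracideal k) (f : 'Hom(fibre x L, fibre x L')) a :
  a != 0 -> fibre_slope f a -> fibre_slope (f^-1)%VF a^-1.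
Proof.
move=> a0 fa v; have ker0 : lker f == 0%VS.
  apply/eqP/vspaceP => u; rewrite memv_ker memv0; apply/eqP/eqP => [fu|->].
    apply: fcoord_inj; apply: (mulfI a0); rewrite -fa fu !raddf0 mulr0 //.
  by rewrite linear0.
have [u uv] := fcoord_surj L (a^-1 * fcoord v).
have -> : v = f u by apply: fcoord_inj; rewrite fa uv mulVKf.
by rewrite (lker0_lfunK ker0) fa mulKf.
Qed.

Lemma fibre_slope_scale (L L' : fracideal k) (f : 'Hom(fibre x L, fibre x L')) a b :
  fibre_slope f a -> fibre_slope (b *: f) (b * a).
Proof. by move=> fa v; rewrite lfunE /= fcoordZ fa mulrA. Qed.

Lemma fibre_mul_slope (L L' : fracideal k) (s : K) :
  s * fgen L / fgen L' \in localring x ->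
  fibre_slope (fibre_mul x L L' s) (red x (s * fgen L / fgen L')).
Proof.
move=> sO; apply: fibre_slope_linfun => v.
have vO := frep_stalk v.
have E : s * frep v / fgen L' = s * fgen L / fgen L' * (frep v / fgen L).
  exact: fibre_mul_aux (fgen_neq0 _) (fgen_neq0 _).
have stk : in_stalk x L' (s * frep v) by rewrite /in_stalk E; exact: localringM sO vO.
by rewrite (fcoord_cls stk) E (redM sO vO).
Qed.

Lemma fracderivE (p q : {poly k}) : q != 0 ->
  fracderiv (p%:F / q%:F) = (p^`() * q - p * q^`())%:F / (q ^+ 2)%:F.
Proof.
move=> q0; rewrite /fracderiv; set z := p%:F / q%:F; set r := repr z.
have d0 : \d_r != 0 by exact: denom_ratioP.
have zE : z = (\n_r)%:F / (\d_r)%:F by exact: frac_numden.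
have q0' : q%:F != 0 :> K by rewrite tofrac_eq0.
have d0' : (\d_r)%:F != 0 :> K by rewrite tofrac_eq0.
have cross : p * \d_r = \n_r * q.
  have /eqP : p%:F / q%:F = (\n_r)%:F / (\d_r)%:F :> K by exact: zE.
  by rewrite (eqr_div _ _ q0' d0') -!tofracM tofrac_eq => /eqP.
have q20 : (q ^+ 2)%:F != 0 :> K by rewrite tofrac_eq0 expf_neq0.
have d20 : (\d_r ^+ 2)%:F != 0 :> K by rewrite tofrac_eq0 expf_neq0.
apply/eqP; rewrite (eqr_div _ _ d20 q20) -!tofracM tofrac_eq.
have := congr1 (@deriv k) cross; rewrite !derivM => dcross.
by apply/eqP/quotient_rule_cross.
Qed.

(** In the Leibniz rule for pi z the term with pi vanishes at x. This is where the factor pi'(x)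
    relating m_x/m_x^2 to omega_x comes from. *)
Lemma fracderiv_pt (z : K) : z \in localring x ->
  fracderiv (pi * z) \in localring x /\
  red x (fracderiv (pi * z)) = in_qpoly x (pt_poly x)^`() * red x z.
Proof.
move=> /local_frac_exists[p [q zpq]]; have [/= xq zE] := zpq.
have q0 : q != 0 by apply: contraNneq xq => ->; rewrite dvdp0.
have -> : pi * z = (pt_poly x * p)%:F / q%:F by rewrite zE tofracM mulrA.
rewrite (fracderivE _ q0); set num := _ - _.
have dpq : local_frac x (num%:F / (q ^+ 2)%:F) (num, q ^+ 2).
  by split=> //=; rewrite pt_dvdM negb_or xq.
split; first exact: local_frac_localring dpq.
rewrite (local_fracP dpq) (local_fracP zpq) /num derivM.
set u := (pt_poly x)^`(); set v := p^`(); set w := q^`().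
have pi0 : in_qpoly x (pt_poly x) = 0 :> kappa by apply/eqP; rewrite in_qpoly_eq0 dvdpp.
have qx0 : (in_qpoly x q : kappa) != 0 by rewrite in_qpoly_eq0.
rewrite raddfB /= !in_qpolyM in_qpolyD !in_qpolyM pi0 !mul0r addr0 subr0.
move: (in_qpoly x u : kappa) (in_qpoly x p : kappa) qx0; move: (in_qpoly x q : kappa).
by move=> Q U P Q0; exact: mulf_div_sqr.
Qed.

Lemma fibre_d_slope : fibre_slope (fibre_d x) (in_qpoly x (pt_poly x)^`() : kappa).
Proof.
apply: fibre_slope_linfun => v; have vO := frep_stalk v.
have pi0 := pt_poly_neq0 x.
have vE : frep v = pi * (frep v / pi) by rewrite mulrC divfK.
have [dO rd] := fracderiv_pt vO.
have stk : in_stalk x (omegaX k) (fracderiv (frep v)).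
  by rewrite /in_stalk divr1 vE.
by rewrite (fcoord_cls stk) divr1 vE rd.
Qed.

End Fibres.

Section Action.
Variables (F : fieldType) (n : int).
Implicit Types (a b : F) (z w : KMWdeg F n).

Lemma mwact1 z : mwact 1 z = z.
Proof. by apply/val_inj; rewrite /= mwform1 mul1r. Qed.

Lemma mwactM a b z : a != 0 -> b != 0 -> mwact a (mwact b z) = mwact (a * b) z.
Proof. by move=> a0 b0; apply/val_inj; rewrite /= mwformM // mulrA. Qed.

Lemma mwactD a z w : mwact a (z + w) = mwact a z + mwact a w.
Proof. by apply/val_inj; rewrite /= mulrDr. Qed.

End Action.

Lemma regular_div_neq0 (F : fieldType) (m : F^o) (c : F) :
  m != 0 -> c != 0 -> (m : F) / c != 0.
Proof. by move=> m0 c0; rewrite mulf_neq0 ?invr_eq0. Qed.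

Lemma regular_divZ (F : fieldType) (a : F) (m : F^o) (c : F) :
  ((a *: m : F^o) : F) / c = (m : F) / c * a.
Proof. by rewrite [RHS]mulrC [RHS]mulrA. Qed.

Section Local.
Variables (k : fieldType) (x : Gm_point k).
Local Notation K := {fraction {poly k}}.
Local Notation "p %:F" := (FracField.tofrac p).
Local Notation pi := ((pt_poly x)%:F : K).
Local Notation kappa := (resfield x).

(** The residue lowers degrees by 1, so the default value in [mwresidue1] is never taken. *)
Lemma mwresidue1E (z : KMWdeg K 1) :
  mwval (mwresidue1 x pi z) = mwresidue x pi (mwval z).
Proof.
rewrite /mwresidue1 [LHS]val_insubd; case: ifP => // /negbT/asboolPn[].
have [_ h _ _ _] := mwresidueP x; have /asboolP zn := valP z.
by have := h _ _ zn; rewrite subrr.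
Qed.

Lemma mwresidue1D (z w : KMWdeg K 1) :
  mwresidue1 x pi (z + w) = mwresidue1 x pi z + mwresidue1 x pi w.
Proof.
apply/val_inj; rewrite [LHS]mwresidue1E; have [h _ _ _ _] := mwresidueP x.
by rewrite [LHS]h -!mwresidue1E.
Qed.

Lemma twresidue_tens (L : fracideal k) (z : KMWdeg K 1) (l : K^o) : l != 0 ->
  twresidue x L (mwtens z l) =
  mwtens (mwresidue1 x pi (mwact ((l : K) / fgen L) z))
    (fibre_mul x (pt_ideal x) L (fgen L / pi) : normal_twist x L).
Proof.
move=> l0; apply: twlift_tens => //.
  by move=> u v m _; rewrite mwactD mwresidue1D mwtensD.
move=> a u m a0 m0.
have c0 := regular_div_neq0 m0 (fgen_neq0 L).
by rewrite (mwactM _ c0 a0) -(regular_divZ a m (fgen L)).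
Qed.

Hypothesis sep : (in_qpoly x (pt_poly x)^`() : kappa) != 0.
Local Notation dpi := (in_qpoly x (pt_poly x)^`() : kappa).

Lemma normal_twist_omega (l : normal_twist x (omegaX k)) :
  exists c, l = c *: fibre_d x.
Proof.
have [a la] := fibre_slope_exists l; exists (a / dpi).
apply: (fibre_slope_ext la) => v.
by rewrite (fibre_slope_scale (a / dpi) (@fibre_d_slope k x)) divfK.
Qed.

Lemma fibre_d_neq0 : fibre_d x != 0.
Proof. by rewrite (fibre_slope_eq0 (@fibre_d_slope k x)). Qed.

Lemma untwist_coord (c : kappa) :
  xget 0 [set c' | c *: fibre_d x = c' *: fibre_d x]%classic = c.
Proof.
have : c *: fibre_d x =
    xget 0 [set c' | c *: fibre_d x = c' *: fibre_d x]%classic *: fibre_d x.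
  by apply: (@xgetPex _ 0 [set c' | c *: fibre_d x = c' *: fibre_d x]%classic); exists c.
move/eqP; rewrite -subr_eq0 -scalerBl scaler_eq0 (negPf fibre_d_neq0) orbF.
by rewrite subr_eq0 => /eqP.
Qed.

Lemma untwist_tens (z : KMWdeg kappa 0) (c : kappa) : c != 0 ->
  untwist (mwtens z (c *: fibre_d x : normal_twist x (omegaX k))) = mwact c z.
Proof.
move=> c0; rewrite /untwist twlift_tens ?untwist_coord //.
- by move=> u v l _; exact: mwactD.
- move=> a u l a0 l0; have [b lE] := normal_twist_omega l.
  rewrite lE scalerA !untwist_coord mwactM // 1?mulrC //.
  by apply: contraNneq l0 => b0; rewrite lE b0 scale0r.
- by rewrite scaler_eq0 negb_or c0 fibre_d_neq0.
Qed.

Lemma fibre_chi_slope (D : prdivisor k) : fibre_slope (fibre_chi D x) 1.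
Proof.
have triv (L : fracideal k) : fibre_slope (fibre_triv L x) 1.
  have E : fgen L * fgen (OX k) / fgen L = 1 by rewrite mulr1 divff ?fgen_neq0.
  by have := @fibre_mul_slope k x (OX k) L (fgen L); rewrite E red1; apply; exact: localring1.
rewrite -[1]mulr1 -{2}invr1; apply: fibre_slope_comp => //.
by apply: fibre_slope_inv => //; rewrite oner_eq0.
Qed.

(** Since g^-1 is the generator of O(D), the residue is that of [g] itself, twisted by pi |-> g^-1.
    After [chi] the twist is pi |-> dt, which is 1 / pi'(x) times the canonical map pi |-> pi'
    dt. *)
Lemma untwist_chi_div (D : prdivisor k) : div_support D x ->
  untwist (chi_section (div_section D) x) =
  mwact dpi^-1 (mwresidue1 x pi (mwsym1 (div_eqn D))).
Proof.
move=> Dx; rewrite /chi_section /div_section; case: asboolP => // _.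
have g0 := OXdiv_subproof D.
rewrite twresidue_tens // divff // mwact1.
pose f := (fibre_mul x (pt_ideal x) (OXdiv D) (fgen (OXdiv D) / pi)
  : normal_twist x (OXdiv D)).
have f1 : fibre_slope f 1.
  have := @fibre_mul_slope k x (pt_ideal x) (OXdiv D) (fgen (OXdiv D) / pi).
  have -> : fgen (OXdiv D) / pi * fgen (pt_ideal x) / fgen (OXdiv D) = 1.
    by rewrite divfK ?pt_poly_neq0 // divff ?fgen_neq0.
  by rewrite red1; apply; exact: localring1.
rewrite -/f /twmap twlift_tens; first last.
- by rewrite (fibre_slope_eq0 f1) oner_eq0.
- by move=> a u l a0 _; rewrite mwtensZ // comp_lfunZr.
- by move=> u v l _; rewrite mwtensD.
rewrite -untwist_tens ?invr_eq0 //; congr (untwist (mwtens _ _)).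
apply: (@fibre_slope_ext _ _ _ _ _ _ 1).
  by rewrite -[1]mulr1; apply: fibre_slope_comp => //; exact: fibre_chi_slope.
by rewrite -(mulVf sep); apply: fibre_slope_scale; exact: fibre_d_slope.
Qed.

End Local.

(** * Divisors on G_m *)

Section Counting.
Variables (T : eqType) (l1 l2 s : seq T).
Hypotheses (us : uniq s) (l1s : {subset l1 <= s}) (l2s : {subset l2 <= s}).

Definition dmult (y : T) : int := (count_mem y l1)%:Z - (count_mem y l2)%:Z.

Lemma big_count (E : fieldType) (e : T -> E) (l : seq T) : {subset l <= s} ->
  \prod_(y <- l) e y = \prod_(y <- s) e y ^+ count_mem y l.
Proof.
elim: l => [_|a l IHl als]; first by rewrite big_nil big1 // => y _; rewrite expr0.
rewrite big_cons IHl => [|y yl]; last by apply: als; rewrite inE yl orbT.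
under [RHS]eq_bigr do rewrite /= exprD; rewrite big_split /=; congr (_ * _).
have a_s : a \in s by apply: als; rewrite mem_head.
rewrite (bigD1_seq a) //= eqxx expr1 big1 ?mulr1 // => y ya.
by rewrite eq_sym (negPf ya) expr0.
Qed.

Lemma sum_count (f : T -> int) (l : seq T) : {subset l <= s} ->
  \sum_(y <- l) f y = \sum_(y <- s) (count_mem y l)%:Z * f y.
Proof.
elim: l => [_|a l IHl als].
  by rewrite big_nil big1 // => y _; rewrite mul0r.
rewrite big_cons IHl => [|y yl]; last by apply: als; rewrite inE yl orbT.
under [RHS]eq_bigr do rewrite /= PoszD mulrDl; rewrite big_split /=; congr (_ + _).
have a_s : a \in s by apply: als; rewrite mem_head.
rewrite (bigD1_seq a) //= eqxx mul1r big1 ?addr0 // => y ya.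
by rewrite eq_sym (negPf ya) mul0r.
Qed.

Lemma prod_dmult (E : fieldType) (e : T -> E) : (forall y, e y != 0) ->
  \prod_(y <- l1) e y / \prod_(y <- l2) e y = \prod_(y <- s) e y ^ dmult y.
Proof.
move=> e0; rewrite (big_count e l1s) (big_count e l2s) -prodfV -big_split; apply: eq_bigr => y _ /=.
by rewrite /dmult expfzDr // -invr_expz.
Qed.

Lemma sum_dmult (f : T -> int) :
  \sum_(y <- s) dmult y * f y = \sum_(y <- l1) f y - \sum_(y <- l2) f y.
Proof.
by rewrite (sum_count f l1s) (sum_count f l2s) -sumrB; apply: eq_bigr => y _; rewrite mulrBl.
Qed.

Definition oddm (y : T) : bool := ~~ (2 %| dmult y)%Z.
(** The division is Euclidean: the remainder of an odd multiplicity is 1 for poles as well as for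
    zeros. *)
Definition halfm (y : T) : int := (dmult y %/ 2)%Z.

Lemma dmultE y : dmult y = halfm y * 2 + (oddm y)%:Z.
Proof.
have [r [b e]] := int_parity (dmult y); rewrite /halfm /oddm e.
rewrite divzMDl // rpredDl ?dvdz_mull //.
by case: b {e}; rewrite ?addr0.
Qed.

Lemma prod_dmult_sqr (E : fieldType) (e : T -> E) (P : pred T) : (forall y, e y != 0) ->
  \prod_(y <- s | P y) e y ^ dmult y =
  \prod_(y <- s | P y && oddm y) e y * (\prod_(y <- s | P y) e y ^ halfm y) ^+ 2.
Proof.
move=> e0; rewrite big_mkcondr -prodrXl -big_split; apply: eq_bigr => y _ /=.
rewrite [in LHS]dmultE expfzDr // mulrC exprnP exprz_exp; congr (_ * _).
by case: (oddm y); rewrite ?expr1z ?expr0z.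
Qed.

End Counting.

(** * Factorization into closed points *)

Section Factorization.
Variable k : fieldType.
Implicit Types p q : {poly k}.

Lemma monic_irreducible_factor p : p \is monic -> (1 < size p)%N ->
  exists q, monic_irreducible_poly q /\ q %| p.
Proof.
have [n] := ubnP (size p); elim: n p => // n IHn p pn pm p1.
have [pirr|pred] := pselect (irreducible_poly p).
  by exists p; split=> //; split.
have [q [q1 qp qnp]] : exists q, [/\ size q != 1%N, q %| p & ~~ (q %= p)].
  apply: contrapT => noq; apply: pred; split=> // q q1 qp.
  by apply: contrapT => /negP qnp; apply: noq; exists q.
have p0 := monic_neq0 pm.
have q0 : q != 0 by apply: contraNneq p0 => q0; move: qp; rewrite q0 dvd0p.
pose q' := (lead_coef q)^-1 *: q.
have c0 : (lead_coef q)^-1 != 0 by rewrite invr_eq0 lead_coef_eq0.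
have qq' : q' %= q by exact: eqp_scale.
have q'm : q' \is monic by rewrite monicE lead_coefZ mulVf // lead_coef_eq0.
have sq : size q' = size q by rewrite size_scale.
have qlt : (size q < size p)%N.
  by rewrite ltn_neqAle dvdp_leq // andbT dvdp_size_eqp.
have [||r [rirr rq]] := IHn q' _ q'm.
- by rewrite sq (leq_trans qlt) // -ltnS.
- by rewrite sq; move: q1 q0; rewrite -size_poly_gt0; case: (size q) => [|[]].
by exists r; split=> //; apply: dvdp_trans rq _; rewrite (eqp_dvdl _ qq').
Qed.

Lemma monic_Gm_factor p : p \is monic -> ~~ ('X %| p) ->
  exists l : seq (Gm_point k), p = \prod_(x <- l) pt_poly x.
Proof.
have [n] := ubnP (size p); elim: n p => // n IHn p pn pm pX.
have [p1|p1] := leqP (size p) 1.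
  exists [::]; rewrite big_nil; apply/eqP.
  by move: pm; rewrite (size1_polyC p1) monicE lead_coefC => /eqP->.
have [q [[qirr qm] qp]] := monic_irreducible_factor pm p1.
have qX : q != 'X by apply: contraNneq pX => <-.
pose x := GmPoint (conj qirr qm) qX.
have /dvdpP[r pE] := qp.
have rm : r \is monic by rewrite -(monicMr _ qm) -pE.
have rX : ~~ ('X %| r) by apply: contraNN pX => rX; rewrite pE dvdp_mulr.
have q1 : (1 < size q)%N by have [] := qirr.
have [|l rE] := IHn r _ rm rX.
  rewrite -ltnS (leq_trans _ pn) // ltnS pE size_mul ?monic_neq0 // -ltnS prednK.
    by rewrite -addn2 leq_add2l.
  by rewrite addn_gt0 size_poly_gt0 monic_neq0.
by exists (x :: l); rewrite big_cons -rE /= mulrC.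
Qed.

Lemma Gm_coprimeX (x : Gm_point k) : coprimep (pt_poly x) 'X.
Proof.
rewrite coprimepX; apply/negP => x0.
have : 'X %| pt_poly x by rewrite -[X in X %| _]subr0 -polyC0 dvdp_XsubCl.
have [[_ irr] xm] := pt_irr x => Xx.
have := irr 'X; rewrite size_polyX => /(_ isT Xx).
by rewrite eqp_monic ?monicX // eq_sym (negPf (pt_neqX x)).
Qed.

Lemma Gm_coprime (x y : Gm_point k) : x != y -> coprimep (pt_poly x) (pt_poly y).
Proof.
move=> xy; have [[x1 irrx] xm] := pt_irr x; have [[y1 irry] ym] := pt_irr y.
rewrite /coprimep; apply: contraNT xy => g1.
have gx := irrx _ g1 (dvdp_gcdl _ _); have gy := irry _ g1 (dvdp_gcdr _ _).
apply/eqP/Gm_point_inj/eqP; rewrite -eqp_monic //.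
by rewrite -(eqp_ltrans gx).
Qed.

Lemma Gm_ndvd (x : Gm_point k) (q : {poly k}) : coprimep q (pt_poly x) ->
  ~~ (pt_poly x %| q).
Proof.
move=> qx; apply/negP => xq; have [[x1 _] _] := pt_irr x.
by move: x1; rewrite -(eqp_size (dvdp_gcd_idr xq)) (eqP qx).
Qed.

End Factorization.

Lemma zmod_morphMz (U V : zmodType) (f : U -> V) : zmod_morphism f ->
  forall u n, f (u *~ n) = f u *~ n.
Proof.
move=> fB u n; pose fM := GRing.isZmodMorphism.Build _ _ f fB.
pose fl : {additive U -> V} := HB.pack f fM.
exact: (raddfMz fl).
Qed.

Lemma zmod_morphD (U V : zmodType) (f : U -> V) : zmod_morphism f ->
  {morph f : u v / u + v}.
Proof. by move=> fB u v; apply: (@addIr _ (- f v)); rewrite -fB !addrK. Qed.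

Lemma zmod_morph0 (U V : zmodType) (f : U -> V) : zmod_morphism f -> f 0 = 0.
Proof. by move=> fB; have := fB 0 0; rewrite !subrr. Qed.

Lemma mwvalMz (F : fieldType) n (z : KMWdeg F n) i : mwval (z *~ i) = mwval z *~ i.
Proof. by apply: zmod_morphMz => u v. Qed.

Definition mwhyp0 (F : fieldType) : KMWdeg F 0 := mwform0 1 + mwform0 (-1).

Lemma mwval_hyp0 (F : fieldType) : mwval (mwhyp0 F) = mwhyp F.
Proof. by rewrite -[LHS]/(mwform 1 + mwform (-1)) mwform1. Qed.

(** * Transfers and local contributions *)

Section Transfer.
Variables (k : fieldType) (L : fieldExtType k).
Hypotheses (char2 : 2 != 0 :> k) (char2L : 2 != 0 :> L).

Lemma mw_transferE (z : KMWdeg L 0) :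
  KMW0_GW (mw_transfer z) = gw_transfer (KMW0_GW z).
Proof.
have [_ [g fg gf] _] := KMW0_GWP char2.
apply: (@xgetPex _ 0 [set y | KMW0_GW y = gw_transfer (KMW0_GW z)]%classic).
by exists (g (gw_transfer (KMW0_GW z))); rewrite /= gf.
Qed.

Lemma KMW0_GWB (F : fieldType) : 2 != 0 :> F -> zmod_morphism (@KMW0_GW F).
Proof.
move=> F2 z w; have [fD _ _] := KMW0_GWP F2.
by apply: (@addIr _ (KMW0_GW w)); rewrite -fD !subrK.
Qed.

Hypothesis tr_neq0 : exists c : L, field_trace c != 0.

(** The trace forms of <1> and <-1> are opposite, and a form plus its opposite is hyperbolic; N is
    the degree of L over k. *)
Lemma gw_transfer_hyp N (C : 'M[L]_(N, 1)) : kbasis C ->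
  gw_transfer (KMW0_GW (mwhyp0 L)) = gwhyp k *+ N.
Proof.
move=> b; have [fD _ fE] := KMW0_GWP char2L.
have N1 : -1 != 0 :> L by rewrite oppr_eq0 oner_eq0.
rewrite /mwhyp0 fD !fE ?oner_eq0 // (zmod_morphD (gw_transferB tr_neq0)).
have s1 : sym_unit (1%:M : 'M[L]_1) by rewrite sym_unit_scalar oner_eq0.
have sN1 : sym_unit ((-1)%:M : 'M[L]_1) by rewrite sym_unit_scalar.
rewrite (gw_transfer_class tr_neq0 b s1) (gw_transfer_class tr_neq0 b sN1).
rewrite -(gwclass_addN char2 (tgram_sym_unit tr_neq0 b s1)); congr (_ + gwclass _).
rewrite /tgram !mul_mx_scalar scale1r scaleN1r mulNmx.
by apply/matrixP => i j; rewrite !mxE raddfN.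
Qed.

Lemma KMW0_GW_transfer N (C : 'M[L]_(N, 1)) (i : int) (b : bool) (a : L) :
    kbasis C -> a != 0 ->
  KMW0_GW (mw_transfer (mwhyp0 L *~ i + (if b then 0 else mwform0 a))) =
  gwhyp k *~ (i * N%:Z) + (if b then 0 else gw_transfer (gwclass (a%:M : 'M_1))).
Proof.
move=> bC a0; rewrite mw_transferE; have [fD _ fE] := KMW0_GWP char2L.
have trB := gw_transferB tr_neq0; have fB := KMW0_GWB char2L.
rewrite fD (zmod_morphD trB) (zmod_morphMz fB) (zmod_morphMz trB) (gw_transfer_hyp bC).
congr (_ + _); first by rewrite mulrC mulrzA pmulrn.
by case: b; rewrite ?fE // (zmod_morph0 fB) (zmod_morph0 trB).
Qed.

End Transfer.

Section Contribution.
Variables (k : fieldType) (x : Gm_point k).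
Hypothesis char2 : 2 != 0 :> k.
Local Notation K := {fraction {poly k}}.
Local Notation "p %:F" := (FracField.tofrac p).
Local Notation pi := ((pt_poly x)%:F : K).
Local Notation kappa := (resfield x).
Local Notation dpi := (in_qpoly x (pt_poly x)^`() : kappa).
Hypothesis sep : dpi != 0.

Lemma resfield_char2 : 2 != 0 :> kappa.
Proof.
have -> : 2 = in_alg kappa 2 by rewrite rmorph_nat.
by rewrite fmorph_eq0.
Qed.

(** The twist is absorbed by the copies of h, as <a>h = h, and the square of v by the brackets, so
    only the odd term <w / pi'> feels the choice of twist. *)
Lemma mwact_residue (G v : K) (w : {poly k}) (m : int) :
    coprimep w (pt_poly x) -> local_unit x v ->
    G / pi ^ m = w%:F * (v * v) ->
  mwact dpi^-1 (mwresidue1 x pi (mwsym1 G)) =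
  mwhyp0 kappa *~ (m %/ 2)%Z +
  (if (2 %| m)%Z then 0 else mwform0 ((in_qpoly x w : kappa) / dpi)).
Proof.
move=> wx vU GE; have wU := local_unit_poly (Gm_ndvd wx).
have vvU := local_unitM vU vU; have GU := local_unitM wU vvU.
rewrite -GE in GU.
have G0 : G != 0.
  by have := local_unit_neq0 GU; apply: contraNneq => ->; rewrite mul0r.
have /local_unitE[vO rv] := vU.
have redG : red x (G / pi ^ m) = in_qpoly x w * (red x v * red x v).
  by rewrite GE (redM (localring_poly x w) (localringM vO vO)) red_poly (redM vO vO).
have w0 : (in_qpoly x w : kappa) != 0 by rewrite in_qpoly_eq0 Gm_ndvd.
have d0 : dpi^-1 != 0 by rewrite invr_eq0.
apply/val_inj => /=; rewrite [mwval (mwresidue1 x pi _)]mwresidue1E.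
rewrite (mwresidue_sym x G0) (pt_valE GU) (pt_angE GU) redG /mwint mulrDr.
rewrite mwvalMz; congr (_ + _).
  by rewrite mulrzAr mwform_hyp mwval_hyp0.
case: ifP => _; first by rewrite mulr0.
by rewrite (mwformMsqr w0 rv) -(mwformM d0 w0) mulrC.
Qed.

Lemma transfer_contribution (G v : K) (w : {poly k}) (m : int) :
    coprimep w (pt_poly x) -> local_unit x v ->
    G / pi ^ m = w%:F * (v * v) ->
  KMW0_GW (mw_transfer (mwact dpi^-1 (mwresidue1 x pi (mwsym1 G)))) =
  gwhyp k *~ ((m %/ 2)%Z * ((size (pt_poly x)).-1)%:Z) +
  (if (2 %| m)%Z then 0 else resclass (pt_poly x) w).
Proof.
move=> wx vU GE; rewrite (mwact_residue wx vU GE).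
have a0 : (in_qpoly x w : kappa) / dpi != 0.
  by apply: mulf_neq0; rewrite ?invr_eq0 // in_qpoly_eq0; exact: Gm_ndvd.
rewrite -(gw_transfer_resclass sep wx).
exact: (KMW0_GW_transfer char2 resfield_char2 (field_trace_neq0 sep) _ _ (pt_kbasis x) a0).
Qed.

End Contribution.

Lemma mulf_regroup (F : fieldType) (a b c : F) : a != 0 ->
  a^-1 * (b * c ^+ 2) = a * b * (a^-1 * c * (a^-1 * c)).
Proof.
move=> a0; rewrite expr2 [a^-1 * c * _]mulrACA !mulrA; congr (_ * _ * _).
by rewrite mulrAC (mulrAC a b) divff // mul1r mulrC.
Qed.

Lemma mulf_cancel_mid (F : fieldType) (a b c : F) : b != 0 -> a * (b * c) / b = a * c.
Proof. by move=> b0; rewrite mulrCA mulrAC divff // mul1r. Qed.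

Lemma size_prod_monic (k : fieldType) (T : Type) (pt : T -> {poly k}) (s : seq T)
    (P : pred T) : (forall x, pt x \is monic) ->
  size (\prod_(x <- s | P x) pt x) = (\sum_(x <- s | P x) (size (pt x)).-1).+1.
Proof.
move=> ptm; elim: s => [|x s IH]; first by rewrite !big_nil size_poly1.
rewrite !big_cons; case: ifP => // _.
rewrite size_mul ?monic_neq0 ?monic_prod // IH addnS /= -addSn prednK //.
by rewrite size_poly_gt0 monic_neq0.
Qed.

(** * Summation over the closed points *)

Section Divisor.
Variable k : fieldType.
Local Notation K := {fraction {poly k}}.
Local Notation "p %:F" := (FracField.tofrac p).
Local Notation pt := (@pt_poly k).
Variables (l1 l2 : seq (Gm_point k)).
Local Notation s := (undup (l1 ++ l2)).
Local Notation dmult := (dmult l1 l2).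
Local Notation oddm := (oddm l1 l2).
Local Notation halfm := (halfm l1 l2).

(** The factor 1/X is a unit on G_m, hence invisible in the divisor, but it does affect the values
    w(x) and thereby the forms. *)
Definition divfun : K := ('X%:F)^-1 * \prod_(y <- s) (pt y)%:F ^ dmult y.

Let ptF_neq0 (y : Gm_point k) : (pt y)%:F != 0 :> K.
Proof. exact: pt_ideal_subproof. Qed.

Let XF_neq0 : 'X%:F != 0 :> K.
Proof. by rewrite tofrac_eq0 polyX_eq0. Qed.

Lemma local_unit_exprz (x : Gm_point k) (z : K) (m : int) :
  local_unit x z -> local_unit x (z ^ m).
Proof.
move=> zU; have zX (i : nat) : local_unit x (z ^+ i).
  elim: i => [|i IH]; first by rewrite expr0; exact: local_unit1.
  by rewrite exprS; exact: local_unitM.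
by case: m => i; [exact: zX|rewrite NegzE -exprnN; exact/local_unitV].
Qed.

Lemma local_unit_prod (x : Gm_point k) (P : pred (Gm_point k))
    (e : Gm_point k -> int) (r : seq (Gm_point k)) :
    (forall y, y \in r -> P y -> y != x) ->
  local_unit x (\prod_(y <- r | P y) (pt y)%:F ^ e y : K).
Proof.
elim: r => [_|y r IH Px]; first by rewrite big_nil; exact: local_unit1.
have Ur : local_unit x (\prod_(y <- r | P y) (pt y)%:F ^ e y : K).
  by apply: IH => z zr; apply: Px; rewrite inE zr orbT.
rewrite big_cons; case: ifP => // Py.
apply: (local_unitM _ Ur); apply/local_unit_exprz/local_unit_poly/Gm_ndvd/Gm_coprime.
by apply: Px; rewrite ?mem_head.
Qed.

Lemma local_unitX (x : Gm_point k) : local_unit x ('X%:F : K).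
Proof. by apply/local_unit_poly/Gm_ndvd; rewrite coprimep_sym; exact: Gm_coprimeX. Qed.

(** The unit 1/X is X times the square of 1/X. The square goes to [cofactor_root], which keeps this
    factor a polynomial. *)
Definition cofactor_poly (x : Gm_point k) : {poly k} :=
  'X * \prod_(y <- s | (y != x) && oddm y) pt y.

Definition cofactor_root (x : Gm_point k) : K :=
  ('X%:F)^-1 * \prod_(y <- s | y != x) (pt y)%:F ^ halfm y.

Lemma cofactor_root_unit x : local_unit x (cofactor_root x).
Proof.
by apply: (local_unitM (local_unitV (local_unitX x))); apply: local_unit_prod.
Qed.

Lemma coprime_cofactor x : coprimep (cofactor_poly x) (pt x).
Proof.
rewrite coprimepMl coprimep_sym Gm_coprimeX /=.
elim/big_rec: _ => [|y q /andP[yx _] IH]; first exact: coprime1p.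
by rewrite coprimepMl IH andbT Gm_coprime.
Qed.

Lemma divfun_cofactor x : x \in s ->
  divfun / (pt x)%:F ^ dmult x =
  (cofactor_poly x)%:F * (cofactor_root x * cofactor_root x).
Proof.
move=> xs; rewrite /divfun (bigD1_seq x) ?undup_uniq //=.
rewrite (mulf_cancel_mid _ _ (expfz_neq0 _ (ptF_neq0 x))).
rewrite (prod_dmult_sqr l1 l2 s _ ptF_neq0).
rewrite (mulf_regroup _ _ XF_neq0) /cofactor_poly /cofactor_root tofracM.
by rewrite rmorph_prod.
Qed.

Lemma divfun_unit x : x \notin s -> local_unit x divfun.
Proof.
move=> xs; apply: (local_unitM (local_unitV (local_unitX x))).
by apply: local_unit_prod => y ys _; apply: contraNneq xs => <-.
Qed.

Hypothesis char2 : 2 != 0 :> k.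
Local Notation deg p := (size (p : {poly k})).-1.

Lemma resclass_odd_sum :
    \prod_(y <- l1) (pt y).[0] = \prod_(y <- l2) (pt y).[0] ->
    \sum_(y <- l1) (deg (pt y))%:Z - \sum_(y <- l2) (deg (pt y))%:Z = 1 ->
  gwhyp k *~ (\sum_(y <- s) halfm y * (deg (pt y))%:Z) +
    \sum_(y <- s | oddm y) resclass (pt y) (cofactor_poly y) =
  gwclass ((-1)%:M : 'M[k]_1).
Proof.
move=> ev dg; set H := \sum_(y <- s) _.
pose F := \prod_(y <- s | oddm y) pt y.
pose D := (\sum_(y <- s | oddm y) deg (pt y))%N.
have ptm (y : Gm_point k) : pt y \is monic := pt_monic y.
(* Each multiplicity is twice its half plus its parity; weighting by degrees and summing gives the
   degree of X g. *)
have HD : H * 2 + D%:Z = 1.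
  rewrite -[RHS]dg -[RHS](@sum_dmult _ l1 l2 s) ?undup_uniq //; first last.
  - by move=> y; rewrite mem_undup mem_cat => ->; rewrite orbT.
  - by move=> y; rewrite mem_undup mem_cat => ->.
  rewrite /D (big_morph Posz PoszD (erefl _)) /H mulr_suml [X in _ + X]big_mkcond -big_split.
  apply: eq_bigr => y _ /=; rewrite [dmult y]dmultE mulrDl mulrAC; congr (_ + _).
  by case: (oddm y); rewrite ?mul1r ?mul0r.
(* By [HD] the degree D of F is odd, so X F has even degree D + 1 = 2M. *)
pose M := (D.+1)./2.
have DM : D.+1 = (M + M)%N by rewrite /M; lia.
have HM : H = 1 - M%:Z by lia.
(* [None] stands for the point X = 0 of the affine line, which is missing from G_m but occurs in the
   factorization of X F. *)
pose opt (o : option (Gm_point k)) : {poly k} := if o is Some y then pt y else 'X.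
pose os := None :: [seq Some y | y <- s & oddm y].
have optm o : opt o \is monic by case: o => [y|] /=; rewrite ?monicX.
have oscop : {in os &, forall o o', o != o' -> coprimep (opt o) (opt o')}.
  move=> [y|] [z|] _ _ //= yz; rewrite ?Gm_coprimeX //; first exact: Gm_coprime.
  by rewrite coprimep_sym Gm_coprimeX.
have osu : uniq os.
  rewrite /= map_inj_uniq; last by move=> ? ? [].
  rewrite filter_uniq ?undup_uniq // andbT.
  by apply/mapP => -[].
have prodE : \prod_(o <- os) opt o = 'X * F.
  by rewrite big_cons big_map big_filter.
have FM : size ('X * F) = (M + M).+1.
  by rewrite mulrC size_mulX ?monic_neq0 ?monic_prod // /F size_prod_monic // -DM.
have := resclass_prod optm oscop osu (coprime1p _).
rewrite prodE (resclass_even char2 _ FM) ?monicMl ?monicX ?monic_prod //.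
rewrite big_cons big_map big_filter.
have -> : \prod_(o <- os | o != None) opt o = F.
  by rewrite big_cons /= big_map big_filter.
rewrite mul1r => rE.
have -> : \sum_(y <- s | oddm y) resclass (pt y) (cofactor_poly y) =
    gwhyp k *+ M - resclass 'X F.
  rewrite rE addrAC subrr add0r; apply: eq_bigr => y _; rewrite mul1r.
  congr resclass; rewrite /cofactor_poly big_cons /= big_map big_filter_cond.
  by congr (_ * _); apply: eq_bigl => z; rewrite andbC.
(* The form at X is <F(0)>. Evaluating X g = F times a square at 0 gives F(0) c^2 = 1, so F(0) is a
   square. *)
have -> : resclass 'X F = gwclass (1%:M : 'M[k]_1).
  rewrite -(@resclassE _ 1) ?size_polyX //.
  have -> : resform 1 'X F = (F.[0])%:M.
    apply/matrixP => i j; rewrite !ord1 !mxE /reslin size_polyX /= mulr1.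
    by rewrite -['X]subr0 -polyC0 modp_XsubC coefC eqxx.
  have e0 (y : Gm_point k) : (pt y).[0] != 0.
    have := Gm_coprimeX y; rewrite coprimepX.
    by [].
  have l1s : {subset l1 <= s} by move=> y; rewrite mem_undup mem_cat => ->.
  have l2s : {subset l2 <= s} by move=> y; rewrite mem_undup mem_cat => ->; rewrite orbT.
  have := prod_dmult (undup_uniq _) l1s l2s e0; rewrite ev divff; last first.
    by rewrite prodf_seq_neq0; apply/allP => y _; rewrite e0.
  rewrite (prod_dmult_sqr l1 l2 s xpredT e0); set c := \prod_(y <- s) _.
  have -> : \prod_(y <- s | true && oddm y) (pt y).[0] = F.[0].
    by rewrite /F horner_prod.
  move=> Fc; have c0 : c != 0.
    by apply: contraNneq (oner_neq0 k) => c0; rewrite Fc c0 expr0n mulr0.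
  apply/esym/gwclass_congr; exists c%:M; first by rewrite unitmxE det_scalar1 unitfE.
  by rewrite tr_scalar_mx -!scalar_mxM Fc; congr (_%:M); rewrite expr2 mulrA mulrAC mulrC mulrA.
(* The remaining class is h - <1>. *)
by rewrite HM mulrzBr mulr1z -pmulrn addrA subrK /gwhyp addrAC subrr add0r.
Qed.

End Divisor.

(** * The divisor of g *)

Section Main.
Variable k : fieldType.
Local Notation K := {fraction {poly k}}.
Local Notation "p %:F" := (FracField.tofrac p).
Local Notation pt := (@pt_poly k).

(** Factors are listed with repetition, as X^n - 1 may be inseparable. The value -1 at 0 is the same
    for all n, so it cancels between numerator and denominator of X g. *)
Lemma Xn1_factor n : (0 < n)%N -> exists l : seq (Gm_point k),
  [/\ 'X^n - 1 = \prod_(x <- l) pt x, \prod_(x <- l) (pt x).[0] = -1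
    & \sum_(x <- l) ((size (pt x)).-1)%:Z = n%:Z].
Proof.
move=> n0; have sz : size ('X^n - 1 : {poly k}) = n.+1 by rewrite size_XnsubC.
have pm : ('X^n - 1 : {poly k}) \is monic by rewrite monicXnsubC.
have p0 : ('X^n - 1 : {poly k}).[0] = -1.
  by rewrite hornerD hornerN hornerXn hornerC expr0n gtn_eqF // sub0r.
have [|l lE] := monic_Gm_factor pm.
  by rewrite -[X in X %| _]subr0 -polyC0 dvdp_XsubCl rootE p0 oppr_eq0 oner_eq0.
exists l; split=> //; first by rewrite -p0 lE horner_prod.
have := size_prod_monic l xpredT (@pt_monic k); rewrite -lE sz => -[->].
by rewrite (big_morph Posz PoszD (erefl _)).
Qed.

Lemma gfrac_divfun n : (0 < n)%N -> exists l1 l2 : seq (Gm_point k),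
  [/\ gfrac k n = divfun l1 l2,
      \prod_(y <- l1) (pt y).[0] = \prod_(y <- l2) (pt y).[0]
    & \sum_(y <- l1) ((size (pt y)).-1)%:Z - \sum_(y <- l2) ((size (pt y)).-1)%:Z = 1].
Proof.
move=> n0; have [l1 [p1 e1 d1]] := Xn1_factor (ltn0Sn n).
have [l2 [p2 e2 d2]] := Xn1_factor n0.
exists l1, l2; split; [|by rewrite e1 e2|by rewrite d1 d2; lia].
have l1s : {subset l1 <= undup (l1 ++ l2)} by move=> y; rewrite mem_undup mem_cat => ->.
have l2s : {subset l2 <= undup (l1 ++ l2)}.
  by move=> y; rewrite mem_undup mem_cat => ->; rewrite orbT.
rewrite /divfun -(prod_dmult (undup_uniq _) l1s l2s (@pt_ideal_subproof k)).
have -> : gfrac k n = ('X^(n.+1) - 1)%:F / ('X%:F * ('X^n - 1)%:F).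
  by rewrite /gfrac -tofracM mulrBr mulr1 -exprS.
by rewrite p1 p2 !rmorph_prod invfM mulrCA.
Qed.

Hypotheses (k_perfect : perfect_field k) (char2 : 2 != 0 :> k).

Lemma pt_separable (x : Gm_point k) :
  (in_qpoly x (pt x)^`() : resfield x) != 0.
Proof.
have [irr _] := pt_irr x; have := k_perfect irr.
by rewrite unlock coprimep_sym in_qpoly_eq0 => /Gm_ndvd.
Qed.

Lemma pushforward_chi_div (D : prdivisor k) (l1 l2 : seq (Gm_point k)) :
    div_eqn D = divfun l1 l2 ->
  KMW0_GW (pushforward (chi (div_class D))) =
  gwhyp k *~ (\sum_(y <- undup (l1 ++ l2)) halfm l1 l2 y * ((size (pt y)).-1)%:Z) +
  \sum_(y <- undup (l1 ++ l2) | oddm l1 l2 y) resclass (pt y) (cofactor_poly l1 l2 y).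
Proof.
move=> DE; set s := undup _.
have contr x : x \in s -> KMW0_GW (mw_transfer (mwact
      (in_qpoly x (pt x)^`() : resfield x)^-1 (mwresidue1 x (pt x)%:F (mwsym1 (div_eqn D))))) =
    gwhyp k *~ (halfm l1 l2 x * ((size (pt x)).-1)%:Z) +
    (if oddm l1 l2 x then resclass (pt x) (cofactor_poly l1 l2 x) else 0).
  move=> xs; rewrite DE.
  rewrite (transfer_contribution char2 (pt_separable x) (coprime_cofactor l1 l2 x)
    (cofactor_root_unit l1 l2 x) (divfun_cofactor xs)).
  by rewrite /oddm if_neg.
have Ts x : div_support D x -> x \in s.
  by move=> Dx; apply: contrapT => /negP xs; apply: Dx; rewrite DE; exact: divfun_unit.
have fin := finite_div_support D.
have suppP x : reflect (div_support D x) (x \in fset_set (div_support D)).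
  by rewrite in_fset_set //; apply: (iffP idP) => [/set_mem|/mem_set].
rewrite /pushforward fsbig_finite //=.
have -> : \sum_(x <- fset_set (div_support D)) mw_transfer (untwist (h1val (chi (div_class D)) x)) =
    \sum_(x <- s | x \in fset_set (div_support D))
      mw_transfer (untwist (h1val (chi (div_class D)) x)).
  rewrite -[RHS]big_filter; apply: perm_big; apply: uniq_perm.
  - exact: fset_uniq.
  - by rewrite filter_uniq ?undup_uniq.
  move=> x; rewrite mem_filter; case: (boolP (x \in fset_set _)) => //=.
  by move=> /suppP/Ts ->.
have fB := KMW0_GWB char2.
rewrite (big_morph _ (zmod_morphD fB) (zmod_morph0 fB)) big_mkcond.
pose c x := gwhyp k *~ (halfm l1 l2 x * ((size (pt x)).-1)%:Z) +
  (if oddm l1 l2 x then resclass (pt x) (cofactor_poly l1 l2 x) else 0).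
transitivity (\sum_(x <- s) c x).
  apply: eq_big_seq => x xs; case: suppP => [Dx|nDx].
    by rewrite (untwist_chi_div (pt_separable x) Dx); exact: contr.
  have gU : local_unit x (div_eqn D).
    by apply: contrapT.
  have := divfun_cofactor xs; rewrite -DE => gE.
  (* Such a point occurs when a factor common to numerator and denominator cancels. Its multiplicity
     is then 0, so extending the sum from the support to [s] adds nothing. *)
  have d0 : dmult l1 l2 x = 0.
    rewrite -(pt_val_unit gU); apply/esym/pt_valE; rewrite gE.
    have vU := cofactor_root_unit l1 l2 x.
    apply: (local_unitM _ (local_unitM vU vU)).
    exact/local_unit_poly/Gm_ndvd/coprime_cofactor.
  by rewrite /c /halfm /oddm d0 div0z mul0r mulr0z dvdz0 addr0.
rewrite /c big_split -big_mkcond /=; congr (_ + _).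
by rewrite (big_morph _ (mulrzDr (gwhyp k)) (mulr0z (gwhyp k))).
Qed.

End Main.

Theorem lemma2p1p9 (k : fieldType) (k_perfect : perfect_field k)
    (k_char : 2%N \notin [pchar k]) (n : nat) (n_gt0 : (0 < n)%N) :
  let D := gdiv k n_gt0 in
  pushforward (chi (div_class D)) = mwform0 (- 1 : k).
Proof.
have char2 : 2 != 0 :> k by apply: contra k_char => k2; rewrite inE /=.
move=> D; have [_ fbij fE] := KMW0_GWP char2.
have [l1 [l2 [gE ev dg]]] := gfrac_divfun k n_gt0.
(* The identity is checked in GW, where the transfers are trace forms. *)
apply: (bij_inj fbij); rewrite fE ?oppr_eq0 ?oner_eq0 //.
by rewrite (@pushforward_chi_div k k_perfect char2 D l1 l2 gE) resclass_odd_sum.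
Qed.
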